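(* Out of the 92 Johnson solids $J1,\dots,J92$, at least 82 have Rupert's property; namely, every Johnson solid $Jk$ with $1\le k\le 92$ and $k\notin\{25,45,47,71,72,73,74,75,76,77\}$ has Rupert's property.
   Context: A polyhedron $\mathbf{P}$ is a finite set of points of $\mathbb{R}^3$ (its vertices) in convex position and non-degenerate (not all contained in a plane); $\overline{\mathbf{P}}$ denotes its convex hull. A set with a hole is a subset of $\mathbb{R}^3$ whose interior is connected but not simply connected. $\mathbf{P}$ has Rupert's property (is Rupert) if there are a polyhedron $\mathbf{Q}$ of the same shape and size as (i.e. congruent to) $\mathbf{P}$ and a direction vector $v\in\mathbb{R}^3\setminus\{0\}$ such that $\overline{\mathbf{P}}\setminus\{q+tv: q\in\overline{\mathbf{Q}},\ t\in\mathbb{R}\}$ is a set with a hole. Notation: $T_{x,y}:\mathbb{R}^2\to\mathbb{R}^2$ is the translation by $(x,y)^t$; $R_\alpha:\mathbb{R}^2\to\mathbb{R}^2$ is the counter-clockwise rotation about the origin by the angle $\alpha$; and $M_{\theta,\varphi}:\mathbb{R}^3\to\mathbb{R}^2$ is the linear map with matrix $\begin{pmatrix}-\sin\theta&\cos\theta&0\\-\cos\theta\cos\varphi&-\sin\theta\cos\varphi&\sin\varphi\end{pmatrix}$. These maps act on sets elementwise. For a finite set $\mathcal{Q}\subset\mathbb{R}^2$, $\mathcal{Q}^\circ$ is the interior of its convex hull. Equivalently to the definition above, $\mathbf{P}$ is Rupert iff there are $x,y\in\mathbb{R}$, $\alpha,\theta_1,\theta_2\in[0,2\pi)$, $\varphi_1,\varphi_2\in[0,\pi]$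 with $(T_{x,y}\circ R_\alpha\circ M_{\theta_1,\varphi_1})(\mathbf{P})\subset M_{\theta_2,\varphi_2}(\mathbf{P})^\circ$. The Johnson solids are the 92 (up to similarity) strictly convex polyhedra all of whose faces are regular polygons and which are not uniform (not Platonic, Archimedean, prisms or antiprisms), in Johnson's standard numbering: J1 square pyramid, J2 pentagonal pyramid, J3 triangular cupola, J4 square cupola, J5 pentagonal cupola, J6 pentagonal rotunda, J7 elongated triangular pyramid, J8 elongated square pyramid, J9 elongated pentagonal pyramid, J10 gyroelongated square pyramid, J11 gyroelongated pentagonal pyramid, J12 triangular bipyramid, J13 pentagonal bipyramid, J14 elongated triangular bipyramid, J15 elongated square bipyramid, J16 elongated pentagonal bipyramid, J17 gyroelongated square bipyramid, J18 elongated triangular cupola, J19 elongated square cupola, J20 elongated pentagonal cupola, J21 elongated pentagonal rotunda, J22 gyroelongated triangular cupola, J23 gyroelongated square cupola, J24 gyroelongated pentagonal cupola, J25 gyroelongated pentagonal rotunda, J26 gyrobifastigium, J27 triangular orthobicupola, J28 square orthobicupola, J29 square gyrobicupola, J30 pentagonal orthobicupola, J31 pentagonal gyrobicupola, J32 pentagonal orthocupolarotunda, J33 pentagonal gyrocupolarotunda, J34 pentagonal orthobirotunda, J35 elongated triangular orthobicupola, J36 elongated triangular gyrobicupola, J37 elongated square gyrobicupola, J38 elongated pentagonal orthobicupola, J39 elongated pentagonal gyrobicupola, J40 elongated pentagonal orthocupolarotunda, J41 elongated pentagonal gyrocupolarotunda, J42 elongated pentagonal orthobirotunda, J43 elongated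 pentagonal gyrobirotunda, J44 gyroelongated triangular bicupola, J45 gyroelongated square bicupola, J46 gyroelongated pentagonal bicupola, J47 gyroelongated pentagonal cupolarotunda, J48 gyroelongated pentagonal birotunda, J49 augmented triangular prism, J50 biaugmented triangular prism, J51 triaugmented triangular prism, J52 augmented pentagonal prism, J53 biaugmented pentagonal prism, J54 augmented hexagonal prism, J55 parabiaugmented hexagonal prism, J56 metabiaugmented hexagonal prism, J57 triaugmented hexagonal prism, J58 augmented dodecahedron, J59 parabiaugmented dodecahedron, J60 metabiaugmented dodecahedron, J61 triaugmented dodecahedron, J62 metabidiminished icosahedron, J63 tridiminished icosahedron, J64 augmented tridiminished icosahedron, J65 augmented truncated tetrahedron, J66 augmented truncated cube, J67 biaugmented truncated cube, J68 augmented truncated dodecahedron, J69 parabiaugmented truncated dodecahedron, J70 metabiaugmented truncated dodecahedron, J71 triaugmented truncated dodecahedron, J72 gyrate rhombicosidodecahedron, J73 parabigyrate rhombicosidodecahedron, J74 metabigyrate rhombicosidodecahedron, J75 trigyrate rhombicosidodecahedron, J76 diminished rhombicosidodecahedron, J77 paragyrate diminished rhombicosidodecahedron, J78 metagyrate diminished rhombicosidodecahedron, J79 bigyrate diminished rhombicosidodecahedron, J80 parabidiminished rhombicosidodecahedron, J81 metabidiminished rhombicosidodecahedron, J82 gyrate bidiminished rhombicosidodecahedron, J83 tridiminished rhombicosidodecahedron, J84 snub disphenoid, J85 snub square antiprism, J86 sphenocorona, J87 augmented sphenocorona, J88 sphenomegacorona, J89 hebesphenomegacorona, J90 disphenocingulum,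 J91 bilunabirotunda, J92 triangular hebesphenorotunda. No assertion is made about the ten excluded solids. *)

(* Defs.v *)
From HB Require Import structures.
From Stdlib Require Import BinInt.
From mathcomp Require Import all_boot all_order all_algebra.
From mathcomp Require Import all_classical all_reals all_analysis.

Set Implicit Arguments.
Unset Strict Implicit.
Unset Printing Implicit Defensive.

Import Order.TTheory GRing.Theory Num.Theory.
Import numFieldNormedType.Exports.

Delimit Scope Z_scope with stdZ.

Local Open Scope classical_set_scope.
Local Open Scope ring_scope.

Section Topology.
Context {R : realType} {T : topologicalType}.
Implicit Types A : set T.

Let I01 : set R := `[0, 1].

Definition path_in A (f : R -> T) : Prop :=
  {within I01, continuous f} /\ f @` I01 `<=` A.

Definition path_connected A : Prop :=
  forall x y, A x -> A y -> exists f, [/\ path_in A f, f 0 = x & f 1 = y].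

(* Homotopy relative to the base point: in [h], the first coordinate is the
   deformation parameter, the second the parameter of the loop. *)
Definition null_homotopic_in A (f : R -> T) : Prop :=
  exists h : R * R -> T,
    [/\ {within I01 `*` I01, continuous h}, h @` (I01 `*` I01) `<=` A,
        forall t, I01 t -> h (0, t) = f t /\ h (1, t) = f 0 &
        forall s, I01 s -> h (s, 0) = f 0 /\ h (s, 1) = f 0].

Definition simply_connected A : Prop :=
  path_connected A /\
  forall f, path_in A f -> f 0 = f 1 -> null_homotopic_in A f.

End Topology.

Section Polyhedra.
Context {R : realType}.
Local Notation V := 'rV[R]_3.
Implicit Types (P Q A : set V) (u v : V).

Definition has_hole A : Prop :=
  connected A° /\ ~ simply_connected (R := R) A°.

Definition dot u v : R := \sum_(j < 3) u 0 j * v 0 j.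

Definition hull A : set V :=
  \bigcap_(C in [set C : set V | convex_set C /\ A `<=` C]) C.

Definition convex_position P : Prop :=
  forall x, P x -> ~ hull (P `\ x) x.

Definition coplanar P : Prop :=
  exists u (c : R), u != 0 /\ forall x, P x -> dot u x = c.

Definition polyhedron P : Prop :=
  [/\ finite_set P, convex_position P & ~ coplanar P].

(* The similarities of Euclidean space, with ratio [c]; reflections are
   included. *)
Definition similar_with (c : R) P Q : Prop :=
  exists (M : 'M[R]_3) (b : V),
    M *m M^T = 1%:M /\ Q = [set c *: (x *m M) + b | x in P].

Definition congruent_to P Q : Prop := similar_with 1 P Q.

Definition similar_to P Q : Prop := exists2 c : R, 0 < c & similar_with c P Q.

Definition cylinder A v : set V := [set q + t *: v | q in A & t in [set: R]].

Definition rupert P : Prop :=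
  exists Q v, [/\ polyhedron Q, congruent_to P Q, v != 0 &
                  has_hole (hull P `\` cylinder (hull Q) v)].

End Polyhedra.

Section Blocks.
Context {R : realType}.
Local Notation V := 'rV[R]_3.

Definition pt (x y z : R) : V := \row_(j < 3) [:: x; y; z]`_j.

(* Regular [n]-gon of circumradius [r] in the plane of height [z]; the angle
   [a] is the direction of the midpoint of an edge. *)
Definition polygon (n : nat) (r a z : R) : seq V :=
  [seq pt (r * cos (a + (2 * k + 1)%:R * pi / n%:R))
          (r * sin (a + (2 * k + 1)%:R * pi / n%:R)) z | k <- iota 0 n].

Definition circumradius (n : nat) : R := (2 * sin (pi / n%:R))^-1.

Definition apothem (n : nat) : R := circumradius n * cos (pi / n%:R).

Definition ngon (n : nat) (a z : R) : seq V := polygon n (circumradius n) a z.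

(* Height of the pyramid over the unit [n]-gon with unit lateral edges; it is
   also the height of the [n]-gonal cupola with unit edges. *)
Definition slant (n : nat) : R := Num.sqrt (1 - circumradius n ^+ 2).

Definition gold : R := (1 + Num.sqrt 5) / 2.

Definition prism (n : nat) : seq V := ngon n 0 0 ++ ngon n 0 (-1).

Definition antiprism_height (n : nat) : R :=
  Num.sqrt (1 - (2 * cos (pi / (2 * n)%:R)) ^- 2).

Definition antiprism (n : nat) : seq V :=
  ngon n 0 0 ++ ngon n (pi / n%:R) (- antiprism_height n).

(* The caps contain only the vertices above the base plane [z = 0]. The base
   of [cupola_cap n a] is [ngon (2 * n) a 0], with squares over the edges in
   the directions [a + 2 k pi / n] and triangles over the other edges. The base
   of [rotunda_cap a] is [ngon 10 a 0], with triangles over the edges in the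
   directions [a + 2 k pi / 5] and pentagons over the other edges. In both,
   [a] is also the direction of an edge of the top face. *)
Definition pyramid_cap (n : nat) : seq V := [:: pt 0 0 (slant n)].

Definition cupola_cap (n : nat) (a : R) : seq V := ngon n a (slant n).

(* Half of an icosidodecahedron with unit edge, whose circumradius is
   [gold]: the middle layer is a pentagon with edge [gold]. *)
Definition rotunda_cap (a : R) : seq V :=
  polygon 5 (gold * circumradius 5) (a + pi / 5) (gold * slant 5) ++
  ngon 5 a (Num.sqrt (gold ^+ 2 - circumradius 5 ^+ 2)).

(* The mirror image of a cap, hung below the plane [z = - d]. *)
Definition below (d : R) (C : seq V) : seq V :=
  [seq pt (v 0 0) (v 0 1) (- d - v 0 2) | v : V <- C].

(* Apex of the square pyramid over the [k]-th lateral face of [prism n]. *)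
Definition side_apex (n k : nat) : V :=
  let r := apothem n + slant 4 in
  pt (r * cos (2 * k%:R * pi / n%:R)) (r * sin (2 * k%:R * pi / n%:R)) (- 2^-1).

(* Apex of the pyramid with edges [e] over the [n]-gonal face in the plane
   [dot u x = c], when the centre of this face lies on the line of [u]. *)
Definition apex (u : V) (c : R) (n : nat) (e : R) : V :=
  ((c + slant n * e * Num.sqrt (dot u u)) / dot u u) *: u.

Definition signs (x y z : R) : seq V :=
  [:: pt x y z; pt x y (- z); pt x (- y) z; pt x (- y) (- z);
      pt (- x) y z; pt (- x) y (- z); pt (- x) (- y) z; pt (- x) (- y) (- z)].

Definition even_signs (x y z : R) : seq V :=
  [:: pt x y z; pt x (- y) (- z); pt (- x) y (- z); pt (- x) (- y) z].

Definition cyclic (x y z : R) : seq V :=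
  signs x y z ++ signs y z x ++ signs z x y.

(* Edge lengths: [2 / gold], [2], [2 * Num.sqrt 2], [2], [2 / gold], [2]. *)
Definition dodecahedron : seq V := signs 1 1 1 ++ cyclic 0 gold^-1 gold.

Definition icosahedron : seq V := cyclic 1 0 gold.

Definition truncated_tetrahedron : seq V :=
  even_signs 3 1 1 ++ even_signs 1 3 1 ++ even_signs 1 1 3.

Definition truncated_cube : seq V :=
  cyclic 1 (1 + Num.sqrt 2) (1 + Num.sqrt 2).

Definition truncated_dodecahedron : seq V :=
  cyclic 0 gold^-1 (2 + gold) ++ cyclic gold^-1 gold (2 * gold) ++
  cyclic gold 2 (gold + 1).

Definition rhombicosidodecahedron : seq V :=
  cyclic 1 1 (gold ^+ 3) ++ cyclic (gold ^+ 2) gold (2 * gold) ++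
  cyclic (2 + gold) 0 (gold ^+ 2).

(* Vertices of [icosahedron], hence five-fold axes of the dodecahedron, the
   truncated dodecahedron and the rhombicosidodecahedron above. The vertices
   [ax1], [ax2], [ax3] are pairwise neither adjacent nor opposite. *)
Definition ax1 : V := pt 1 0 gold.
Definition ax2 : V := pt 1 0 (- gold).
Definition ax3 : V := pt (- gold) 1 0.

Definition remove (u : V) (P : seq V) : seq V := [seq v <- P | v != u].

(* Apex over the face of [dodecahedron] in the direction [u]. *)
Definition dodecahedron_apex (u : V) : V := apex u (gold ^+ 2) 5 (2 / gold).

(* Top face of the pentagonal cupola over the decagon of
   [truncated_dodecahedron] in the direction [ax1], which lies in the plane
   [dot ax1 x = 3 * gold + 1]: one vertex over each edge between two decagons,
   in the direction of one of the five vertices of [icosahedron] adjacent to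
   [ax1]. *)
Definition decagon_cap : seq V :=
  [seq ((5 * gold - 2) / (gold + 2)) *: ax1 + gold^-1 *: w
  | w <- [:: pt (-1) 0 gold; pt gold 1 0; pt gold (-1) 0;
             pt 0 gold 1; pt 0 (- gold) 1]].

(* The images of [decagon_cap] under symmetries of [truncated_dodecahedron]
   that map [ax1] to [- ax1], [ax2] and [ax3]. *)
Definition decagon_cap_opp : seq V := [seq - v | v : V <- decagon_cap].
Definition decagon_cap2 : seq V :=
  [seq pt (v 0 0) (v 0 1) (- v 0 2) | v : V <- decagon_cap].
Definition decagon_cap3 : seq V :=
  [seq pt (- v 0 2) (v 0 0) (v 0 1) | v : V <- decagon_cap].

(* For a five-fold axis [u], the five vertices of [rhombicosidodecahedron] on
   the pentagon in the direction [u] have [dot u v = 3 * gold + 3]; the other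
   ones have [dot u v <= 3 * gold + 1]. *)
Definition in_cap (u v : V) : bool := 3 * gold + 2 < dot u v.

Definition diminish (u : V) (P : seq V) : seq V :=
  [seq v <- P | ~~ in_cap u v].

(* The cupola is turned by [pi], which is the same as [pi / 5] because of its
   symmetry of order 5. *)
Definition gyrate (u : V) (P : seq V) : seq V :=
  [seq if in_cap u v then (2 * dot u v / dot u u) *: u - v else v | v <- P].

(* The symmetry group of order 4 generated by the reflections in [x = 0] and
   [y = 0]. *)
Definition signs_xy (x y z : R) : seq V :=
  [:: pt x y z; pt x (- y) z; pt (- x) y z; pt (- x) (- y) z].

(* [Z] is used only for its binary numerals: those of [nat] and [int] are unary
   and cannot be as large as the coefficients below. *)
Definition zpoly (c : seq Z) : {poly R} :=
  Poly [seq match z with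
            | Z0 => 0
            | Zpos p => (Pos.to_nat p)%:R
            | Zneg p => - (Pos.to_nat p)%:R
            end | z <- c].

(* In the definitions below, the root is unique in the interval. The
   polynomials eliminate the other coordinates from the equations that all the
   edges have the same length. *)
Definition root_between (p : {poly R}) (a b : R) : R :=
  xget 0 [set x | a <= x <= b /\ root p x].

(* Edge length 2. *)
Definition snub_disphenoid : seq V :=
  let q := root_between (Poly [:: -1; 4; 11; 2]) 0 1 in
  let r := Num.sqrt q in
  let s := Num.sqrt ((1 - q) / (2 * q)) in
  let t := Num.sqrt (2 - 2 * q) in
  [:: pt t r 0; pt (- t) r 0; pt 0 (- r) t; pt 0 (- r) (- t);
      pt 1 (- s) 0; pt (-1) (- s) 0; pt 0 s 1; pt 0 s (-1)].

(* Edge length 2. *)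
Definition snub_square_antiprism : seq V :=
  let k := root_between
    (Poly [:: 7 * Num.sqrt 6 - 17 * Num.sqrt 3; - 3 * (5 - 2 * Num.sqrt 2);
              3 * Num.sqrt 3 * (5 - Num.sqrt 2); 9]) 0 1 in
  let d := Num.sqrt (3 - 3 * k ^+ 2) in
  let h := (Num.sqrt 2 + 8 + 2 * Num.sqrt 3 * k
            - 3 * (2 + Num.sqrt 2) * k ^+ 2) / (4 * d) in
  let r := 1 + Num.sqrt 3 * k in
  polygon 4 (Num.sqrt 2) 0 h ++ polygon 4 r (pi / 4) (h - d) ++
  polygon 4 (Num.sqrt 2) (pi / 4) (- h) ++ polygon 4 r 0 (d - h).

(* Edge length 1 in this and the next four solids. The parameter [k] makes the
   last family of edges have length 1; the other edges have length 1 for all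
   [k] in a neighbourhood. *)
Definition sphenocorona_k : R :=
  (6 + Num.sqrt 6 + 2 * Num.sqrt (213 - 57 * Num.sqrt 6)) / 30.

Definition sphenocorona : seq V :=
  let k := sphenocorona_k in
  let s := Num.sqrt (1 - k ^+ 2) in
  signs_xy 0 (1 / 2) s ++ signs_xy k (1 / 2) 0 ++
  signs_xy 0 (1 / 2 + Num.sqrt (3 - 4 * k ^+ 2) / (2 * s))
             ((1 - 2 * k ^+ 2) / (2 * s)) ++
  signs_xy (1 / 2) 0 (- Num.sqrt (1 / 2 + k - k ^+ 2)).

(* Apex over the square with vertices [pt 0 (+-1/2) s], [pt k (+-1/2) 0]. *)
Definition sphenocorona_apex : V :=
  let k := sphenocorona_k in
  let s := Num.sqrt (1 - k ^+ 2) in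
  pt (k / 2 + slant 4 * s) 0 (s / 2 + slant 4 * k).

Definition sphenomegacorona : seq V :=
  let k := root_between
    (zpoly [:: -23; -56; 200; 304; -776; 240; 2000; -5584; -3384; 17248;
              2464; -24576; 1568; 17216; -3712; -4800; 1680]%stdZ)
    (1 / 2) (3 / 5) in
  let s := Num.sqrt (1 - k ^+ 2) in
  signs_xy 0 (1 / 2) s ++ signs_xy k (1 / 2) 0 ++
  signs_xy 0 (1 / 2 + Num.sqrt (3 - 4 * k ^+ 2) / (2 * s))
             ((1 - 2 * k ^+ 2) / (2 * s)) ++
  signs_xy (1 / 2) 0 (- Num.sqrt (1 / 2 + k - k ^+ 2)) ++
  signs_xy 0
    (1 / 2 + Num.sqrt (3 - 4 * k ^+ 2) * (1 - 2 * k ^+ 2) / (2 * s ^+ 3))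
    ((2 * k ^+ 4 - 1) / (2 * s ^+ 3)).

Definition hebesphenomegacorona : seq V :=
  let k := root_between
    (zpoly [:: -47; 494; -1119; -1808; 2128; 13696; 6112; -39680; -25600;
              35328; 26880]%stdZ) (1 / 5) (1 / 4) in
  let s := Num.sqrt (1 - k ^+ 2) in
  let w := Num.sqrt (3 / 4 - k ^+ 2) in
  let m := Num.sqrt ((2 - 4 * k) / (1 + k)) in
  signs_xy (1 / 2) (1 / 2) s ++ signs_xy (1 / 2 + k) (1 / 2) 0 ++
  signs_xy (1 / 2) 0 (- w) ++
  signs_xy 0 (1 / 2 + Num.sqrt ((2 - 4 * k) / (1 - k)) / 2)
             (s - (1 + k) / (2 * s)) ++
  signs_xy 0 ((1 + 2 * m * w) / (4 * (1 - k)))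
             (((4 * k - 2) * w - m) / (4 * (1 - k))).

(* The lower half is the image of the upper one under a rotary reflection of
   order 4. *)
Definition disphenocingulum : seq V :=
  let k := root_between
    (zpoly [:: -23; -24; 672; -944; -2024; 4352; 1248; -6592; 1552; 3712;
              -1664; -512; 256]%stdZ) (3 / 4) (4 / 5) in
  let s := Num.sqrt (1 - k ^+ 2) in
  let g := Num.sqrt (1 - 2 * (k - 1 / 2) ^+ 2) / 2 in
  let top :=
    signs_xy (1 / 2) 0 (g + s) ++ signs_xy (1 / 2) k g ++
    signs_xy (1 / 2 + Num.sqrt (3 - 4 * k ^+ 2) / (2 * s)) 0
             (g + (1 - 2 * k ^+ 2) / (2 * s)) in
  top ++ [seq pt (v 0 1) (- v 0 0) (- v 0 2) | v : V <- top].

(* Edge length 2. *)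
Definition bilunabirotunda : seq V :=
  signs gold 1 1 ++ signs 1 0 (gold ^+ 2) ++ signs 0 gold 0.

(* Edge length 2; the base hexagon is in the plane [z = 0], the other vertices
   are vertices of an icosidodecahedron centred at the origin. *)
Definition triangular_hebesphenorotunda : seq V :=
  let c := (Num.sqrt 3)^-1 in
  polygon 6 2 (pi / 6) 0 ++
  [:: pt 0 (- 2 * gold ^+ 2 * c) (2 * c);
      pt (gold ^+ 2) (gold ^+ 2 * c) (2 * c);
      pt (- gold ^+ 2) (gold ^+ 2 * c) (2 * c);
      pt gold (- (gold + 2) * c) (2 * gold * c);
      pt (- gold) (- (gold + 2) * c) (2 * gold * c);
      pt (gold ^+ 2) (- gold^-1 * c) (2 * gold * c);
      pt (- gold ^+ 2) (- gold^-1 * c) (2 * gold * c);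
      pt 1 (gold ^+ 3 * c) (2 * gold * c);
      pt (-1) (gold ^+ 3 * c) (2 * gold * c);
      pt 0 (2 * c) (2 * gold ^+ 2 * c);
      pt 1 (- c) (2 * gold ^+ 2 * c);
      pt (-1) (- c) (2 * gold ^+ 2 * c)].

End Blocks.

Section Johnson.
Context {R : realType}.
Local Notation V := 'rV[R]_3.

(* Vertices of a representative of each solid, up to similarity, in Johnson's
   numbering; some lists contain repetitions. *)
Definition johnson_vertices (k : nat) : seq V :=
  match k with
  | 1%N => ngon 4 0 0 ++ pyramid_cap 4
  | 2%N => ngon 5 0 0 ++ pyramid_cap 5
  | 3%N => ngon 6 0 0 ++ cupola_cap 3 0
  | 4%N => ngon 8 0 0 ++ cupola_cap 4 0
  | 5%N => ngon 10 0 0 ++ cupola_cap 5 0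
  | 6%N => ngon 10 0 0 ++ rotunda_cap 0
  | 7%N => prism 3 ++ pyramid_cap 3
  | 8%N => prism 4 ++ pyramid_cap 4
  | 9%N => prism 5 ++ pyramid_cap 5
  | 10%N => antiprism 4 ++ pyramid_cap 4
  | 11%N => antiprism 5 ++ pyramid_cap 5
  | 12%N => ngon 3 0 0 ++ pyramid_cap 3 ++ below 0 (pyramid_cap 3)
  | 13%N => ngon 5 0 0 ++ pyramid_cap 5 ++ below 0 (pyramid_cap 5)
  | 14%N => prism 3 ++ pyramid_cap 3 ++ below 1 (pyramid_cap 3)
  | 15%N => prism 4 ++ pyramid_cap 4 ++ below 1 (pyramid_cap 4)
  | 16%N => prism 5 ++ pyramid_cap 5 ++ below 1 (pyramid_cap 5)
  | 17%N => antiprism 4 ++ pyramid_cap 4 ++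
          below (antiprism_height 4) (pyramid_cap 4)
  | 18%N => prism 6 ++ cupola_cap 3 0
  | 19%N => prism 8 ++ cupola_cap 4 0
  | 20%N => prism 10 ++ cupola_cap 5 0
  | 21%N => prism 10 ++ rotunda_cap 0
  | 22%N => antiprism 6 ++ cupola_cap 3 0
  | 23%N => antiprism 8 ++ cupola_cap 4 0
  | 24%N => antiprism 10 ++ cupola_cap 5 0
  | 25%N => antiprism 10 ++ rotunda_cap 0
  (* two triangular prisms glued along a square face, turned by [pi / 2] *)
  | 26%N => ngon 4 0 0 ++
          [:: pt (1 / 2) 0 (Num.sqrt 3 / 2);
              pt (- (1 / 2)) 0 (Num.sqrt 3 / 2);
              pt 0 (1 / 2) (- (Num.sqrt 3 / 2));
              pt 0 (- (1 / 2)) (- (Num.sqrt 3 / 2))]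
  | 27%N => ngon 6 0 0 ++ cupola_cap 3 0 ++ below 0 (cupola_cap 3 0)
  | 28%N => ngon 8 0 0 ++ cupola_cap 4 0 ++ below 0 (cupola_cap 4 0)
  | 29%N => ngon 8 0 0 ++ cupola_cap 4 0 ++ below 0 (cupola_cap 4 (pi / 4))
  | 30%N => ngon 10 0 0 ++ cupola_cap 5 0 ++ below 0 (cupola_cap 5 0)
  | 31%N => ngon 10 0 0 ++ cupola_cap 5 0 ++ below 0 (cupola_cap 5 (pi / 5))
  | 32%N => ngon 10 0 0 ++ cupola_cap 5 0 ++ below 0 (rotunda_cap 0)
  | 33%N => ngon 10 0 0 ++ cupola_cap 5 0 ++ below 0 (rotunda_cap (pi / 5))
  | 34%N => ngon 10 0 0 ++ rotunda_cap 0 ++ below 0 (rotunda_cap 0)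
  | 35%N => prism 6 ++ cupola_cap 3 0 ++ below 1 (cupola_cap 3 0)
  | 36%N => prism 6 ++ cupola_cap 3 0 ++ below 1 (cupola_cap 3 (pi / 3))
  | 37%N => prism 8 ++ cupola_cap 4 0 ++ below 1 (cupola_cap 4 (pi / 4))
  | 38%N => prism 10 ++ cupola_cap 5 0 ++ below 1 (cupola_cap 5 0)
  | 39%N => prism 10 ++ cupola_cap 5 0 ++ below 1 (cupola_cap 5 (pi / 5))
  | 40%N => prism 10 ++ cupola_cap 5 0 ++ below 1 (rotunda_cap 0)
  | 41%N => prism 10 ++ cupola_cap 5 0 ++ below 1 (rotunda_cap (pi / 5))
  | 42%N => prism 10 ++ rotunda_cap 0 ++ below 1 (rotunda_cap 0)
  | 43%N => prism 10 ++ rotunda_cap 0 ++ below 1 (rotunda_cap (pi / 5))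
  (* 44 to 48 are chiral; the two forms are mirror images of each other *)
  | 44%N => antiprism 6 ++ cupola_cap 3 0 ++
          below (antiprism_height 6) (cupola_cap 3 (pi / 6))
  | 45%N => antiprism 8 ++ cupola_cap 4 0 ++
          below (antiprism_height 8) (cupola_cap 4 (pi / 8))
  | 46%N => antiprism 10 ++ cupola_cap 5 0 ++
          below (antiprism_height 10) (cupola_cap 5 (pi / 10))
  | 47%N => antiprism 10 ++ cupola_cap 5 0 ++
          below (antiprism_height 10) (rotunda_cap (pi / 10))
  | 48%N => antiprism 10 ++ rotunda_cap 0 ++
          below (antiprism_height 10) (rotunda_cap (pi / 10))
  | 49%N => prism 3 ++ [:: side_apex 3 0]
  | 50%N => prism 3 ++ [:: side_apex 3 0; side_apex 3 1]
  | 51%N => prism 3 ++ [:: side_apex 3 0; side_apex 3 1; side_apex 3 2]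
  | 52%N => prism 5 ++ [:: side_apex 5 0]
  | 53%N => prism 5 ++ [:: side_apex 5 0; side_apex 5 2]
  | 54%N => prism 6 ++ [:: side_apex 6 0]
  | 55%N => prism 6 ++ [:: side_apex 6 0; side_apex 6 3]
  | 56%N => prism 6 ++ [:: side_apex 6 0; side_apex 6 2]
  | 57%N => prism 6 ++ [:: side_apex 6 0; side_apex 6 2; side_apex 6 4]
  | 58%N => dodecahedron ++ [:: dodecahedron_apex ax1]
  | 59%N => dodecahedron ++
          [:: dodecahedron_apex ax1; dodecahedron_apex (- ax1)]
  | 60%N => dodecahedron ++ [:: dodecahedron_apex ax1; dodecahedron_apex ax2]
  | 61%N => dodecahedron ++
          [:: dodecahedron_apex ax1; dodecahedron_apex ax2;
              dodecahedron_apex ax3]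
  | 62%N => remove ax1 (remove ax2 icosahedron)
  | 63%N => remove ax1 (remove ax2 (remove ax3 icosahedron))
  (* the augmented triangle [pt 0 gold 1], [pt 0 gold (-1)], [pt gold 1 0] is
     the one that is adjacent to the three pentagons *)
  | 64%N => remove ax1 (remove ax2 (remove ax3 icosahedron)) ++
          [:: apex (pt 1 (gold ^+ 2) 0) (gold ^+ 3) 3 2]
  (* cupola over the hexagon in the plane [x + y + z = - 3] *)
  | 65%N => truncated_tetrahedron ++
          [:: pt (- (11 / 3)) (- (5 / 3)) (- (5 / 3));
              pt (- (5 / 3)) (- (11 / 3)) (- (5 / 3));
              pt (- (5 / 3)) (- (5 / 3)) (- (11 / 3))]
  | 66%N => truncated_cube ++ polygon 4 (Num.sqrt 2) (pi / 4) (1 + 2 * Num.sqrt 2)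
  | 67%N => truncated_cube ++
          polygon 4 (Num.sqrt 2) (pi / 4) (1 + 2 * Num.sqrt 2) ++
          polygon 4 (Num.sqrt 2) (pi / 4) (- (1 + 2 * Num.sqrt 2))
  | 68%N => truncated_dodecahedron ++ decagon_cap
  | 69%N => truncated_dodecahedron ++ decagon_cap ++ decagon_cap_opp
  | 70%N => truncated_dodecahedron ++ decagon_cap ++ decagon_cap2
  | 71%N => truncated_dodecahedron ++ decagon_cap ++ decagon_cap2 ++ decagon_cap3
  | 72%N => gyrate ax1 rhombicosidodecahedron
  | 73%N => gyrate ax1 (gyrate (- ax1) rhombicosidodecahedron)
  | 74%N => gyrate ax1 (gyrate ax2 rhombicosidodecahedron)
  | 75%N => gyrate ax1 (gyrate ax2 (gyrate ax3 rhombicosidodecahedron))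
  | 76%N => diminish ax1 rhombicosidodecahedron
  | 77%N => gyrate (- ax1) (diminish ax1 rhombicosidodecahedron)
  | 78%N => gyrate ax2 (diminish ax1 rhombicosidodecahedron)
  | 79%N => gyrate ax3 (gyrate ax2 (diminish ax1 rhombicosidodecahedron))
  | 80%N => diminish ax1 (diminish (- ax1) rhombicosidodecahedron)
  | 81%N => diminish ax1 (diminish ax2 rhombicosidodecahedron)
  | 82%N => gyrate ax3 (diminish ax1 (diminish ax2 rhombicosidodecahedron))
  | 83%N => diminish ax1 (diminish ax2 (diminish ax3 rhombicosidodecahedron))
  | 84%N => snub_disphenoid
  | 85%N => snub_square_antiprism
  | 86%N => sphenocorona
  | 87%N => sphenocorona ++ [:: sphenocorona_apex]
  | 88%N => sphenomegacorona
  | 89%N => hebesphenomegacorona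
  | 90%N => disphenocingulum
  | 91%N => bilunabirotunda
  | 92%N => triangular_hebesphenorotunda
  | _ => [::]
  end.

Definition johnson_solid (k : nat) (P : set V) : Prop :=
  similar_to [set` johnson_vertices k] P.

End Johnson.

(* Main.v *)
(* Suppose that, after a rotation, the shadow of some vertices of P traces a
   closed loop turning strictly to the left around the shadow of a moved copy Q.
   The hole of hull P minus the cylinder over Q is then detected as follows.
   The loop, shrunk a little towards an interior point of hull P, stays in the
   interior of the difference. It is not contractible there: a homotopy to a
   constant, sampled on a fine grid, would give the loop the winding number 0
   around a point of the shadow of Q, whereas a loop turning to the left has a
   positive one. The interior is connected, because from any of its points one
   reaches a vertex of the loop along a segment that moves away from the shadow
   of Q.

   For each of the 82 solids, two rational quaternions, a translation and a
   loop of vertices with this property were found by a numerical search. The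
   coordinates of the vertices are enclosed in integer intervals; with them one
   checks the turning of the loop around the inner shadow, the convex position
   of the vertices and that these are not coplanar. *)

From HB Require Import structures.
From Stdlib Require Import ZArith.
From mathcomp Require Import all_boot all_order all_algebra.
From mathcomp Require Import ring lra zify ssrZ.
From mathcomp Require Import all_classical all_reals all_analysis.
Require Import Defs.

Set Implicit Arguments.
Unset Strict Implicit.
Unset Printing Implicit Defensive.

Import Order.TTheory GRing.Theory Num.Theory.
Import numFieldNormedType.Exports.

Local Open Scope classical_set_scope.
Local Open Scope ring_scope.

(** * Convex hulls *)

(** The winding number is discrete. The plane is cut into three sectors that meet only at the
    origin, and passages between two of them are counted with sign. Around a grid cell that misses a
    sector the count is 0, so homotopy invariance is a telescoping double sum, without angle
    functions or covering spaces. All that is decided numerically about a solid is a finite set of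
    strict inequalities between polynomials in the coordinates, hence stable under small errors. The
    rotations come from integer quaternions and are exactly orthogonal; only the vertices carry
    errors. To reach this form, convex position is strengthened: for each vertex there is a
    direction in which it lies strictly beyond all others. Non-coplanarity becomes a nonzero
    determinant, which also provides an interior point of the hull, the centre of the shrinking. The
    loop need not be the whole outline of the outer shadow: left turns around every inner vertex
    suffice. *)

Lemma interior_conv (R : numFieldType) (V : normedModType R) (C : set V) x y t :
  (forall x y t, C x -> C y -> 0 <= t <= 1 -> C (t *: x + (1 - t) *: y)) ->
  C° x -> C y -> 0 < t <= 1 -> C° (t *: x + (1 - t) *: y).
Proof.
move=> cC Cx Cy /andP[t0 t1].
(* The inverse of the homothety of centre [y] and ratio [t]. That homothety maps [C] into itself, so
   the points that [f] sends into [C] are in [C], and near the combination all points are such. *)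
pose f (w : V) := t^-1 *: (w - (1 - t) *: y).
have cf : continuous f.
  move=> w; apply: cvgZl_tmp.
  by apply: cvgB; [exact: cvg_id|exact: cvg_cst].
have tn : t != 0 by rewrite gt_eqF.
have /cf : nbhs (f (t *: x + (1 - t) *: y)) C.
  by rewrite /f addrK scalerA mulVf // scale1r.
apply: (@filterS _ _ _ (f @^-1` C)) => w /= Cfw.
have -> : w = t *: f w + (1 - t) *: y.
  by rewrite /f scalerA mulfV // scale1r subrK.
by apply: cC => //; rewrite ltW.
Qed.

Section Convexity.
Context {R : realType}.
Local Notation V := 'rV[R]_3.
Implicit Types (A C : set V) (x y : V) (t : R).

Lemma convex_setP C : convex_set C <->
  forall x y t, C x -> C y -> 0 <= t <= 1 -> C (t *: x + (1 - t) *: y).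
Proof.
split=> [cC x y t Cx Cy /andP[t0 t1]|cC x y t]; last first.
  by rewrite !inE => Cx Cy; apply: cC => //; rewrite ge0 le1.
have := cC x y (Itv01 t0 t1).
by rewrite !inE; apply.
Qed.

Lemma hull_convex A : convex_set (hull A).
Proof.
apply/convex_setP => x y t Ax Ay t01 C /= [cC AC].
by apply: ((convex_setP C).1 cC) => //; [exact: Ax|exact: Ay].
Qed.

Lemma sub_hull A : A `<=` hull A.
Proof. by move=> x Ax C [_]; apply. Qed.

Lemma hull_min A C : convex_set C -> A `<=` C -> hull A `<=` C.
Proof. by move=> cC AC x; apply; split. Qed.

Lemma hull0 : hull (set0 : set V) = set0.
Proof.
apply/seteqP; split=> // x hx; by apply: (hx set0); split.
Qed.

(** Turns the hull, defined as an intersection, into an iterated join, which is a continuous image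
    of a compact product. The point [x] is listed apart because the join is empty when [s] is. *)
Lemma hull_cons x (s : seq V) : hull [set` x :: s] =
  [set x] `|` (fun p : R * V => p.1 *: x + (1 - p.1) *: p.2) @`
              (`[0, 1]%classic `*` hull [set` s]).
Proof.
apply/seteqP; split; last first.
  move=> _ [->|[[t y] [/= t01 sy] <-]].
    by apply: sub_hull; rewrite /= inE eqxx.
  apply: ((convex_setP _).1 (@hull_convex _)) => //.
    by apply: sub_hull; rewrite /= inE eqxx.
  apply: hull_min sy; first exact: hull_convex.
  by move=> z zs; apply: sub_hull => /=; rewrite inE [z \in s]zs orbT.
apply: hull_min; last first.
  move=> y /=; rewrite inE => /orP[/eqP ->|ys]; first by left.
  right; exists (0, y); rewrite /= ?in_itv /=.
    by split; [rewrite lexx ler01|exact: sub_hull].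
  by rewrite scale0r subr0 scale1r add0r.
have cs := (convex_setP _).1 (@hull_convex [set` s]).
apply/convex_setP => y z t.
have aux : forall t1 t2 (y1 y2 : V), 0 <= t1 <= 1 -> 0 <= t2 <= 1 ->
    hull [set` s] y1 -> hull [set` s] y2 -> 0 <= t <= 1 ->
  ((fun p : R * V => p.1 *: x + (1 - p.1) *: p.2) @`
              (`[0, 1]%classic `*` hull [set` s]))
   (t *: (t1 *: x + (1 - t1) *: y1) + (1 - t) *: (t2 *: x + (1 - t2) *: y2)).
  move=> t1 t2 y1 y2 /andP[t10 t11] /andP[t20 t21] h1 h2 /andP[t0 t1'].
  (* The total weight of [x]. The remaining [1 - T] is shared by [y1] and [y2], whose normalised
     combination is in the hull of [s]; when [T = 1] their weights vanish and any point of that hull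
     is a witness. *)
  pose T := t * t1 + (1 - t) * t2.
  have T0 : 0 <= T by rewrite /T; nra.
  have T1 : T <= 1 by rewrite /T; nra.
  have [T1E|T1E] := eqVneq T 1.
    exists (1, y1); first by split; rewrite //= in_itv /= ler01 lexx.
    rewrite /= subrr scale0r addr0 scale1r.
    have e1 : t * (1 - t1) = 0.
      by apply/eqP; rewrite eq_le; apply/andP; split; rewrite /T in T1E; nra.
    have e2 : (1 - t) * (1 - t2) = 0.
      by apply/eqP; rewrite eq_le; apply/andP; split; rewrite /T in T1E; nra.
    rewrite !scalerDr !scalerA e1 e2 !scale0r !addr0 -scalerDl -/T.
    by rewrite T1E scale1r.
  have T1n : 1 - T != 0 by rewrite subr_eq0 eq_sym.
  have T1p : 0 < 1 - T by rewrite subr_gt0 lt_neqAle T1E.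
  exists (T, (t * (1 - t1) / (1 - T)) *: y1 +
             (1 - t * (1 - t1) / (1 - T)) *: y2).
    split; rewrite /= ?in_itv /= ?T0 //.
    apply: cs => //; rewrite divr_ge0 ?mulr_ge0 ?subr_ge0 //.
    by rewrite ler_pdivrMr // mul1r /T; nra.
  rewrite /=.
  rewrite [(1 - T) *: _]scalerDr !scalerA !scalerDr !scalerA.
  have -> : (1 - T) * (t * (1 - t1) / (1 - T)) = t * (1 - t1).
    by rewrite mulrC divfK.
  have -> : (1 - T) * (1 - t * (1 - t1) / (1 - T)) = (1 - t) * (1 - t2).
    by rewrite mulrBr mulr1 [_ * (_ / _)]mulrC divfK // /T; ring.
  by rewrite addrACA -scalerDl.
have one : 0 <= (1 : R) <= 1 by rewrite ler01 lexx.
have E (w : V) : 1 *: x + (1 - 1) *: w = x.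
  by rewrite scale1r subrr scale0r addr0.
move=> [->|[[t1 y1] [/= t1P h1] <-]] [->|[[t2 y2] [/= t2P h2] <-]] t01.
- by left; rewrite -scalerDl addrC subrK scale1r.
- by right; rewrite -[X in t *: X](E y2); apply: aux.
- by right; rewrite -[X in (1 - t) *: X](E y1); apply: aux.
- by right; apply: aux.
Qed.

Lemma compact_hull (s : seq V) : compact (hull [set` s]).
Proof.
elim: s => [|x s IH].
  rewrite (_ : [set` [::]] = set0) ?hull0; first exact: compact0.
  by apply/seteqP; split.
rewrite hull_cons; apply: compactU; first exact: compact_set1.
apply: continuous_compact; last first.
  by apply: compact_setX => //; exact: segment_compact.
apply: continuous_subspaceT => -[u y].
apply: cvgD.
  by apply: cvgZ; [exact: cvg_fst|exact: cvg_cst].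
apply: cvgZ; last exact: cvg_snd.
by apply: cvgB; [exact: cvg_cst|exact: cvg_fst].
Qed.

Lemma interior_segment C x y t : convex_set C -> C° x -> C y -> 0 < t <= 1 ->
  C° (t *: x + (1 - t) *: y).
Proof.
by move=> /convex_setP cC; exact: interior_conv.
Qed.

Lemma interior_convex C : convex_set C -> convex_set C°.
Proof.
move=> cC; apply/convex_setP => x y t Cx Cy /andP[t0 t1].
have [->|tn] := eqVneq t 0; first by rewrite scale0r subr0 scale1r add0r.
apply: interior_segment => //; first exact: interior_subset.
by rewrite lt_def tn t0.
Qed.

End Convexity.

(** * Winding numbers *)

Section Winding.
Context {R : realType}.
Implicit Types (x y : nat -> R).

Lemma lt_iter (r : nat -> R) n : (0 < n)%N ->
  (forall i, (i < n)%N -> r i < r i.+1) -> r 0%N < r n.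
Proof.
elim: n => // -[|n] IH _ h; first exact: h.
by apply: lt_trans (IH _ _) (h _ _) => // i ilt; apply: h; lia.
Qed.

(** [r] is the tangent of the angle measured from the direction [(l1, l2)]. In an open half-plane a
    left turn increases it: the difference of two consecutive values has as numerator
    [l1 ^+ 2 + l2 ^+ 2] times the turning determinant. A closed loop would need [r 0 < r 0]. *)
Lemma half_plane_cycle x y n (l1 l2 : R) : (0 < n)%N ->
  x n = x 0%N -> y n = y 0%N ->
  (forall i, (i < n)%N -> 0 < x i * y i.+1 - y i * x i.+1) ->
  (forall i, (i <= n)%N -> 0 < l1 * x i + l2 * y i) -> False.
Proof.
move=> n0 xn yn D L.
pose r i := (l1 * y i - l2 * x i) / (l1 * x i + l2 * y i).
suff : r 0%N < r n by rewrite /r xn yn ltxx.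
apply: lt_iter => // i ilt.
have Li := L i (ltnW ilt); have Li1 := L i.+1 ilt; have Di := D i ilt.
rewrite /r ltr_pdivrMr // mulrAC ltr_pdivlMr //.
have l0 : 0 < l1 ^+ 2 + l2 ^+ 2.
  rewrite lt_def addr_ge0 ?sqr_ge0 // andbT.
  rewrite paddr_eq0 ?sqr_ge0 // !sqrf_eq0.
  by apply: contraTN Li => /andP[/eqP -> /eqP ->]; rewrite !mul0r addr0 ltxx.
have := mulr_gt0 l0 Di; nra.
Qed.

(** The open upper half-plane and the two parts of its complement. Every point other than the origin
    has a neighbourhood that misses one of the three. *)
Definition sector (x y : R) : nat :=
  if 0 < y then 0%N else if 0 < x then 1%N else 2%N.

Lemma sector_lt3 (x y : R) : (sector x y < 3)%N.
Proof. by rewrite /sector; case: ifP => //; case: ifP. Qed.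

(* Summed over a loop in the plane minus the origin, this is the winding number:
   each turn passes once from sector 1 to sector 0. *)
Definition crossing (a b : nat) : int :=
  ((a == 1) && (b == 0))%N%:Z - ((a == 0) && (b == 1))%N%:Z.

(** If sector 0 or 1 is missing there is no crossing at all; if sector 2 is missing, [crossing a b]
    is the difference [a - b], and both ways around the cell give [a - c]. *)
Lemma crossing_square (a b c d : nat) : (a < 3)%N -> (b < 3)%N -> (c < 3)%N ->
  (d < 3)%N ->
  (exists k, [/\ (k < 3)%N, a != k, b != k, c != k & d != k]) ->
  crossing a b + crossing b c = crossing a d + crossing d c.
Proof.
move=> + + + + [k [+ + + + +]].
by case: k => [|[|[|?]]]; case: a => [|[|[|?]]]; case: b => [|[|[|?]]];
  case: c => [|[|[|?]]]; case: d => [|[|[|?]]].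
Qed.

(** Discrete homotopy invariance. Summed along a row of cells, [crossing_square] shows that two
    adjacent rows differ by the crossings on the two sides, which join equal sectors; the last row
    is constant. *)
Lemma crossing_grid n m (c : nat -> nat -> nat) :
  (forall i j, (c i j < 3)%N) ->
  (forall i j, (i < n)%N -> (j < m)%N -> exists k,
     [/\ (k < 3)%N, c i j != k, c i j.+1 != k, c i.+1 j.+1 != k &
         c i.+1 j != k]) ->
  (forall i, (i <= n)%N -> c i 0%N = c n 0%N /\ c i m = c n 0%N) ->
  (forall j, (j <= m)%N -> c n j = c n 0%N) ->
  \sum_(j < m) crossing (c 0%N j) (c 0%N j.+1) = 0.
Proof.
move=> c3 cell side top.
have crossxx a : crossing a a = 0 by rewrite /crossing; case: a => [|[|a]].
have row i : (i < n)%N -> \sum_(j < m) crossing (c i j) (c i j.+1) =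
                          \sum_(j < m) crossing (c i.+1 j) (c i.+1 j.+1).
  move=> ilt; apply/eqP; rewrite -subr_eq0 -sumrB.
  rewrite (eq_bigr (fun j : 'I_m => crossing (c i j) (c i.+1 j) -
                              crossing (c i j.+1) (c i.+1 j.+1))); last first.
    move=> j _; have := crossing_square (c3 i j) (c3 i j.+1) (c3 i.+1 j.+1)
      (c3 i.+1 j) (cell _ _ ilt (ltn_ord j)).
    by move=> h; apply/eqP; rewrite subr_eq addrAC eq_sym subr_eq h addrC.
  have := telescope_sumr (fun j => - crossing (c i j) (c i.+1 j)) (leq0n m).
  rewrite big_mkord => h.
  under eq_bigr => j _ do rewrite addrC -[crossing _ (c i.+1 j)]opprK.
  rewrite h opprK.
  have [-> ->] := side i (ltnW ilt); have [-> ->] := side i.+1 ilt.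
  by rewrite crossxx.
have {}row i : (i <= n)%N -> \sum_(j < m) crossing (c 0%N j) (c 0%N j.+1) =
                          \sum_(j < m) crossing (c i j) (c i j.+1).
  by elim: i => // i IH ilt; rewrite IH ?(ltnW ilt) // (row i).
rewrite (row n) // big1 // => j _.
by rewrite (top j) 1?ltnW // (top j.+1).
Qed.

(** The changes allowed follow the counter-clockwise order 1, 0, 2, 1. From 0 to 1 or from 2 to 0,
    the segment would meet the line [y = 0] at the abscissa determinant over [y2 - y1], whose sign
    puts that point in the third sector, so none would be avoided. From 1 to 2 the determinant
    cannot be positive. *)
Lemma sector_step (x1 y1 x2 y2 : R) : 0 < x1 * y2 - y1 * x2 ->
  (exists2 k, (k < 3)%N & forall t, 0 <= t <= 1 ->
     sector (x1 + t * (x2 - x1)) (y1 + t * (y2 - y1)) != k) ->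
  (sector x1 y1, sector x2 y2) \in
    [:: (0, 0); (1, 1); (2, 2); (1, 0); (0, 2); (2, 1)]%N.
Proof.
move=> D [k k3 hk].
have k1 : sector x1 y1 != k.
  by have := hk 0; rewrite lexx ler01 !mul0r !addr0; apply.
have k2 : sector x2 y2 != k.
  have := hk 1; rewrite lexx ler01 !mul1r.
  by rewrite ![_ + (_ - _)]addrC !subrK; apply.
(* the point of the segment on the line y = 0 *)
have mid : (0 < y1) != (0 < y2) -> y1 != y2 -> exists2 t, 0 <= t <= 1 &
    y1 + t * (y2 - y1) = 0 /\
    x1 + t * (x2 - x1) = (x1 * y2 - y1 * x2) / (y2 - y1).
  move=> y12 ne.
  have ne' : y2 - y1 != 0 by rewrite subr_eq0 eq_sym.
  exists (- y1 / (y2 - y1)); last by split; field.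
  move: y12; case: (ltP 0 y1) => h1; case: (ltP 0 y2) => h2 // _.
    have ny : y2 - y1 < 0 by lra.
    by rewrite ler_ndivlMr // ler_ndivrMr //; apply/andP; split; lra.
  have ny : 0 < y2 - y1 by lra.
  by rewrite ler_pdivlMr // ler_pdivrMr //; apply/andP; split; lra.
move: k1 k2; rewrite {1 3}/sector.
case: (ltP 0 y1) => h1; last case: (ltP 0 x1) => h3.
- rewrite /sector; case: (ltP 0 y2) => h2 //; case: (ltP 0 x2) => h4 // k0 k1.
  have ny : y2 - y1 < 0 by lra.
  have [||t t01 [ty tx]] := mid.
    by rewrite h1 ltNge h2.
    by rewrite gt_eqF // -subr_lt0.
  have := hk t t01; rewrite tx ty /sector ltxx ltNge ler_ndivrMr // mul0r (ltW D) /=.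
  by move: k3 k0 k1; case: (k) => [|[|[|?]]].
- rewrite /sector; case: (ltP 0 y2) => h2 //; case: (ltP 0 x2) => h4 // _ _.
  exfalso; nra.
- rewrite /sector; case: (ltP 0 y2) => h2 //; last by case: (ltP 0 x2).
  move=> k0 k1.
  have y1n : y1 < 0.
    rewrite lt_neqAle h1 andbT; apply/eqP => y10.
    by move: D; rewrite y10; nra.
  have ny : 0 < y2 - y1 by lra.
  have [||t t01 [ty tx]] := mid.
    by rewrite h2 ltNge h1.
    by rewrite lt_eqF // -subr_gt0.
  have := hk t t01; rewrite tx ty /sector ltxx divr_gt0 //.
  by move: k3 k0 k1; case: (k) => [|[|[|?]]].
Qed.

(** By [sector_step] all terms are nonnegative. If the sum were 0, the loop would never pass from
    sector 1 to sector 0, hence never leave its first sector; but a sector without the origin lies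
    in an open half-plane, against [half_plane_cycle]. *)
Lemma crossing_turning_loop x y n : (0 < n)%N ->
  x n = x 0%N -> y n = y 0%N ->
  (forall i, (i < n)%N -> 0 < x i * y i.+1 - y i * x i.+1) ->
  (forall i, (i < n)%N -> exists2 k, (k < 3)%N & forall t, 0 <= t <= 1 ->
     sector (x i + t * (x i.+1 - x i)) (y i + t * (y i.+1 - y i)) != k) ->
  \sum_(i < n) crossing (sector (x i) (y i)) (sector (x i.+1) (y i.+1)) != 0.
Proof.
move=> n0 xn yn D fine; apply/eqP => sum0.
pose c i := sector (x i) (y i).
have step i : (i < n)%N -> (c i, c i.+1) \in
    [:: (0, 0); (1, 1); (2, 2); (1, 0); (0, 2); (2, 1)]%N.
  by move=> ilt; apply: sector_step; [exact: D|exact: fine].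
have c0 i : (i < n)%N -> crossing (c i) (c i.+1) = 0.
  move=> ilt; apply/eqP; move: sum0 => /eqP.
  rewrite psumr_eq0 => [/allP /(_ (Ordinal ilt) (mem_index_enum _)) //|j _].
  move: (step j (ltn_ord j)); rewrite -/(c j) -/(c j.+1).
  by rewrite !inE !xpair_eqE => /or4P[| | |/or3P[| |]] /andP[/eqP -> /eqP ->].
(* The position in the cyclic order 0, 2, 1, cut between 1 and 0: without a passage from 1 to 0 it
   cannot decrease. *)
pose rk a : nat := if a == 0%N then 0%N else if a == 2%N then 1%N else 2%N.
have rkS i : (i < n)%N -> (rk (c i) <= rk (c i.+1))%N.
  move=> ilt; move: (step i ilt) (c0 i ilt).
  rewrite !inE !xpair_eqE => /or4P[| | |/or3P[| |]] /andP[/eqP -> /eqP ->] //.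
have rkle i j : (i <= j <= n)%N -> (rk (c i) <= rk (c j))%N.
  elim: j => [|j IH]; first by rewrite leqn0 => /andP[/eqP ->].
  move=> /andP[+ jn]; rewrite leq_eqVlt => /orP[/eqP -> //|ij].
  by apply: leq_trans (IH _) (rkS _ _) => //; rewrite -ltnS ij ltnW.
have cst i : (i <= n)%N -> c i = c 0%N.
  move=> ile; have h1 : (rk (c 0%N) <= rk (c i))%N by apply: rkle.
  have : (rk (c i) <= rk (c n))%N by apply: rkle; rewrite ile leqnn.
  rewrite {2}/c xn yn -/(c 0%N) => h2.
  move: h1 h2; rewrite /rk; have := sector_lt3 (x i) (y i).
  have := sector_lt3 (x 0%N) (y 0%N); rewrite -/(c i) -/(c 0%N).
  by case: (c i) => [|[|[|?]]]; case: (c 0%N) => [|[|[|?]]].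
have nz i : (i <= n)%N -> ~ (x i = 0 /\ y i = 0).
  rewrite leq_eqVlt => /orP[/eqP ->|/D + [x0 y0]]; last first.
    by rewrite x0 y0 !mul0r subrr ltxx.
  by rewrite xn yn => -[x0 y0]; have := D 0%N n0; rewrite x0 y0 !mul0r subrr ltxx.
(* Coefficients of a linear form positive on the sector: [y], [x] or [- x - y]. In the last case
   strictness comes from [nz]. *)
pose l1 : R := if c 0%N == 0%N then 0 else if c 0%N == 1%N then 1 else -1.
pose l2 : R := if c 0%N == 0%N then 1 else if c 0%N == 1%N then 0 else -1.
apply: (half_plane_cycle (l1 := l1) (l2 := l2) n0 xn yn D) => i ile.
rewrite /l1 /l2 -(cst i ile) /c /sector.
case: (ltP 0 (y i)) => yi /=; first by rewrite mul0r add0r mul1r.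
case: (ltP 0 (x i)) => xi /=; first by rewrite mul0r addr0 mul1r.
rewrite !mulN1r -opprD oppr_gt0 lt_neqAle.
apply/andP; split; last by rewrite -[0]addr0 lerD.
apply/eqP => e; apply: (nz i ile); split; lra.
Qed.

End Winding.

Section FineGrid.
Context {R : realType}.
Let I01 : set R := `[0, 1]%classic.
Let I2 : set (R * R) := I01 `*` I01.

Lemma within_near_gt (K : set (R * R)) (g : R * R -> R) z a :
  {within K, continuous g} -> K z -> a < g z ->
  \forall z' \near z, K z' -> a < g z'.
Proof.
move=> cg Kz agz.
move/subspace_continuousP: cg => /(_ z Kz) h.
exact: (@cvgr_gt R _ (within K (nbhs z)) _ g (g z) h a agz).
Qed.

(** A strict sign persists nearby: [g2 > 0] excludes sector 1 and [g2 < 0] sector 0; where [g2]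
    vanishes, [g1 > 0] excludes sector 2 and [g1 < 0] sector 1. *)
Lemma sector_avoided (g1 g2 : R * R -> R) z :
  {within I2, continuous g1} -> {within I2, continuous g2} -> I2 z ->
  ~ (g1 z = 0 /\ g2 z = 0) ->
  exists2 k, (k < 3)%N & \forall z' \near z, I2 z' -> sector (g1 z') (g2 z') != k.
Proof.
move=> c1 c2 Iz nz.
have lt_near (g : R * R -> R) : {within I2, continuous g} -> g z < 0 ->
    \forall z' \near z, I2 z' -> g z' < 0.
  move=> cg gz; have := @within_near_gt I2 (fun z => - g z) z 0.
  rewrite oppr_gt0 => /(_ _ Iz gz) h.
  have {}h := h _; apply: filterS (h _) => [z' + Iz'|].
    by move=> /(_ Iz'); rewrite oppr_gt0.
  by move=> u; apply: continuousN; exact: cg.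
have [g2p|g2n|g20] := ltgtP 0 (g2 z).
- exists 1%N => //; apply: filterS (within_near_gt c2 Iz g2p) => z' h /h.
  by rewrite /sector => ->.
- exists 0%N => //; apply: filterS (lt_near _ c2 g2n) => z' h /h z'0.
  by rewrite /sector ltNge (ltW z'0) /=; case: ifP.
have [g1p|g1n|g10] := ltgtP 0 (g1 z); last by case: nz.
- exists 2%N => //; apply: filterS (within_near_gt c1 Iz g1p) => z' h /h.
  by rewrite /sector => ->; case: ifP.
- exists 1%N => //; apply: filterS (lt_near _ c1 g1n) => z' h /h.
  by rewrite /sector => g1z; case: ifP => // _; rewrite ltNge (ltW g1z).
Qed.

(** A Lebesgue number for the neighbourhoods of [sector_avoided]. Half of their radius locates the
    point, the other half is left for the step from it. *)
Lemma sector_fine (g1 g2 : R * R -> R) :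
  {within I2, continuous g1} -> {within I2, continuous g2} ->
  (forall z, I2 z -> ~ (g1 z = 0 /\ g2 z = 0)) ->
  \forall n \near \oo, forall z, I2 z -> exists2 k, (k < 3)%N &
    forall z', I2 z' -> `|z.1 - z'.1| <= n.+1%:R^-1 -> `|z.2 - z'.2| <= n.+1%:R^-1 ->
      sector (g1 z') (g2 z') != k.
Proof.
move=> c1 c2 nz.
have /compact_near_coveringP /near_covering_withinP cov : compact I2.
  by apply: compact_setX; exact: segment_compact.
apply: cov => z Iz.
have [k k3 /nbhs_ballP [e /= e0 He]] := sector_avoided c1 c2 Iz (nz z Iz).
have e2 : 0 < e / 2 by rewrite divr_gt0.
exists (ball z (e / 2), [set n : nat | n.+1%:R^-1 < e / 2]).
  split; first exact: nbhsx_ballx.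
  exact: near_infty_natSinv_lt (PosNum e2).
move=> [z' n] /= [[zz1 zz2] ne] Iz'.
exists k => // z'' Iz'' d1 d2; apply: He => //.
by split; rewrite /= [e]splitr /ball /=;
  [apply: le_lt_trans (ler_distD z'.1 _ _) _|
   apply: le_lt_trans (ler_distD z'.2 _ _) _];
  apply: ltr_leD => //; apply: ltW; apply: le_lt_trans ne.
Qed.

End FineGrid.

Lemma cvg_sum (K : numFieldType) (V : normedModType K) (T : Type)
    (F : set_system T) (n : nat) (f : 'I_n -> T -> V) (a : 'I_n -> V) :
  Filter F -> (forall i, f i x @[x --> F] --> a i) ->
  \sum_(i < n) f i x @[x --> F] --> \sum_(i < n) a i.
Proof.
by move=> FF fa; apply: cvg_big => //; exact: add_continuous.
Qed.

Section Dot.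
Context {R : realType}.
Local Notation V := 'rV[R]_3.
Implicit Types (u x y : V).

Lemma dotE u x : dot u x = u 0 0 * x 0 0 + u 0 1 * x 0 1 + u 0 2 * x 0 2.
Proof.
rewrite /dot !big_ord_recr big_ord0 /= add0r.
by congr (_ * _ + _ * _ + _ * _); congr (_ _ _); apply: val_inj.
Qed.

Lemma dotDr u x y : dot u (x + y) = dot u x + dot u y.
Proof. by rewrite !dotE !mxE; ring. Qed.

Lemma dotBr u x y : dot u (x - y) = dot u x - dot u y.
Proof. by rewrite !dotE !mxE; ring. Qed.

Lemma dotZr u a x : dot u (a *: x) = a * dot u x.
Proof. by rewrite !dotE !mxE; ring. Qed.

Lemma dot_continuous u : continuous (dot u : V -> R).
Proof.
apply: continuous_big => [|j _]; first exact: add_continuous.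
by move=> x; apply: continuousM; [exact: cst_continuous|exact: coord_continuous].
Qed.

End Dot.

(** * Polygonal loops and their winding *)

Section Polygon.
Context {R : realType}.
Local Notation V := 'rV[R]_3.
Variables (m : nat) (s : nat -> V).

Definition clamp (u : R) : R := (1 + `|u| - `|u - 1|) / 2.

Lemma clamp_le0 u : u <= 0 -> clamp u = 0.
Proof. by move=> u0; rewrite /clamp !ler0_norm //; lra. Qed.

Lemma clamp_ge1 u : 1 <= u -> clamp u = 1.
Proof. by move=> u1; rewrite /clamp !ger0_norm //; lra. Qed.

Lemma clamp_id u : 0 <= u <= 1 -> clamp u = u.
Proof.
by move=> /andP[u0 u1]; rewrite /clamp ger0_norm // ler0_norm //; lra.
Qed.

Lemma clamp_continuous : continuous clamp.
Proof.
move=> u; apply: cvgM; last exact: cvg_cst.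
apply: cvgB; last first.
  by apply: cvg_norm; apply: cvgB; [exact: cvg_id|exact: cvg_cst].
by apply: cvgD; [exact: cvg_cst|apply: cvg_norm; exact: cvg_id].
Qed.

(** One clamped ramp per edge, of which only the [i]-th moves while [t * m] goes from [i] to
    [i + 1]. A single formula on the whole line makes continuity immediate, without gluing
    pieces. *)
Definition closed_polygon (t : R) : V :=
  s 0%N + \sum_(i < m) clamp (t * m%:R - i%:R) *: (s i.+1 - s i).

Lemma closed_polygon_continuous : continuous closed_polygon.
Proof.
move=> t; apply: cvgD; first exact: cvg_cst.
apply: cvg_sum => i; apply: cvgZr_tmp.
apply: (@cvg_comp _ _ _ (fun t => t * m%:R - i%:R) clamp); last first.
  exact: clamp_continuous.
apply: cvgB; last exact: cvg_cst.
by apply: cvgM; [exact: cvg_id|exact: cvg_cst].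
Qed.

Lemma closed_polygonE (i : nat) u : (i < m)%N -> 0 <= u <= 1 ->
  closed_polygon ((i%:R + u) / m%:R) = s i + u *: (s i.+1 - s i).
Proof.
move=> ilt u01; rewrite /closed_polygon.
have mn : m%:R != 0 :> R by rewrite pnatr_eq0; lia.
under eq_bigr => j _ do rewrite divfK //.
rewrite -(big_mkord predT (fun j => clamp (i%:R + u - j%:R) *: (s j.+1 - s j))).
rewrite (@big_cat_nat _ _ _ i) //= 1?ltnW // addrA; congr (_ + _).
  rewrite (eq_big_nat _ _ (F2 := fun j => s j.+1 - s j)).
    by rewrite telescope_sumr // addrC subrK.
  move=> j /andP[_ ji]; rewrite clamp_ge1 ?scale1r //.
  have : j.+1%:R <= i%:R :> R by rewrite ler_nat.
  by rewrite -natr1; case/andP: u01; lra.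
rewrite big_ltn // big_nat_cond big1 ?addr0.
  by rewrite addrAC subrr add0r clamp_id.
move=> j /andP[/andP[ij _] _]; rewrite clamp_le0 ?scale0r //.
have : i.+1%:R <= j%:R :> R by rewrite ler_nat.
by rewrite -natr1; case/andP: u01; lra.
Qed.

Lemma closed_polygon_param (t : R) : (0 < m)%N -> 0 <= t <= 1 ->
  exists i (u : R), [/\ (i < m)%N, 0 <= u <= 1 & t = (i%:R + u) / m%:R].
Proof.
move=> m0 /andP[t0 t1].
have mp : 0 < m%:R :> R by rewrite ltr0n.
have [->|tn] := eqVneq t 1.
  (* At [t = 1] truncation would give the index [m], so the end of the last edge is used. *)
  exists m.-1, 1; rewrite ler01 lexx prednK // leqnn; split => //.
  by rewrite natr1 prednK // divff // gt_eqF.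
pose i := Num.truncn (t * m%:R).
have /Num.Theory.truncn_itv /andP[h1 h2] : 0 <= t * m%:R by rewrite mulr_ge0 // ltW.
exists i, (t * m%:R - i%:R); split.
- rewrite -(ltr_nat R); apply: le_lt_trans h1 _.
  by rewrite -[ltRHS]mul1r ltr_pM2r // lt_neqAle tn.
- by rewrite -/i in h1 h2 *; rewrite -natr1 in h2; apply/andP; split; lra.
- by rewrite addrC subrK mulfK // gt_eqF.
Qed.

End Polygon.

Lemma turning_loop_not_contractible (R : realType) (A : set 'rV[R]_3)
    (p q : 'rV[R]_3) (a b : R) (m : nat) (s : nat -> 'rV[R]_3) :
  (0 < m)%N -> s m = s 0%N ->
  (forall i u, (i < m)%N -> 0 <= u <= 1 -> A (s i + u *: (s i.+1 - s i))) ->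
  (forall x, A x -> ~ (dot p x = a /\ dot q x = b)) ->
  (forall i, (i < m)%N ->
     0 < (dot p (s i) - a) * (dot q (s i.+1) - b) -
         (dot q (s i) - b) * (dot p (s i.+1) - a)) ->
  ~ simply_connected (R := R) A.
Proof.
move=> m0 sm segA avoid turn [_ contr].
pose f := closed_polygon m s.
have m0R : (0 < m%:R :> R) by rewrite ltr0n.
have f0 : f 0 = s 0%N.
  have := @closed_polygonE _ m s 0%N 0 m0.
  by rewrite lexx ler01 addr0 mul0r scale0r addr0; apply.
have f1 : f 1 = s 0%N.
  have := @closed_polygonE _ m s m.-1 1.
  rewrite prednK // leqnn lexx ler01 natr1 prednK // divff ?gt_eqF //.
  by rewrite scale1r addrC subrK sm; apply.
have [||h [hc hA h01 hs]] := contr f _ _.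
- split; first by apply: continuous_subspaceT; exact: closed_polygon_continuous.
  move=> _ [t /= + <-]; rewrite in_itv /= => t01.
  have [i [u [im u01 ->]]] := closed_polygon_param m0 t01.
  by rewrite /f closed_polygonE //; exact: segA.
- by rewrite f0 f1.
pose g1 z := dot p (h z) - a; pose g2 z := dot q (h z) - b.
pose K : set (R * R) := `[0, 1]%classic `*` `[0, 1]%classic.
have gc (r : 'rV[R]_3) (c : R) : {within K, continuous (fun z => dot r (h z) - c)}.
  move=> z; apply: cvgB; last exact: cvg_cst.
  apply: (@cvg_comp _ _ _ h (dot r) _ (nbhs (h z))); first exact: hc.
  exact: dot_continuous.
have nz z : K z -> ~ (g1 z = 0 /\ g2 z = 0).
  move=> Kz [/eqP + /eqP]; rewrite !subr_eq0 => /eqP e1 /eqP e2.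
  by apply: (avoid (h z)) => //; apply: hA; exists z.
have [n0 _ fine] := sector_fine (gc p a) (gc q b) nz.
(* A multiple of [m], so that each sampling step stays on one edge, and large enough for
   [sector_fine]. *)
pose l := n0.+1; pose N := (m * l)%N.
have N0 : (0 < N)%N by rewrite muln_gt0 m0.
have {fine} fine z : K z -> exists2 k, (k < 3)%N & forall z', K z' ->
    `|z.1 - z'.1| <= N%:R^-1 -> `|z.2 - z'.2| <= N%:R^-1 ->
    sector (g1 z') (g2 z') != k.
  have /fine : (n0 <= N.-1)%N by rewrite /N /l; nia.
  by rewrite prednK // => H Kz; exact: H.
have NR : (0 < N%:R :> R) by rewrite ltr0n.
have frac (i : nat) : (i <= N)%N -> (`[0, 1]%classic : set R) (i%:R / N%:R).
  move=> iN; rewrite /= in_itv /= divr_ge0 // ler_pdivrMr // mul1r ler_nat.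
  by rewrite iN.
have frac0 : 0%:R / N%:R = 0 :> R by rewrite mul0r.
have I0 : (`[0, 1]%classic : set R) 0 by rewrite -[X in _ X]frac0; exact: frac.
have frac1 : N%:R / N%:R = 1 :> R by rewrite divff // gt_eqF.
have fracB (i : nat) : `|i%:R / N%:R - i.+1%:R / N%:R| <= N%:R^-1 :> R.
  rewrite -mulrBl -natr1 opprD addrA subrr add0r mulN1r normrN.
  by rewrite ger0_norm // invr_ge0 ltW.
pose c (i j : nat) := sector (g1 (i%:R / N%:R, j%:R / N%:R))
                     (g2 (i%:R / N%:R, j%:R / N%:R)).
have : \sum_(j < N) crossing (c 0%N j) (c 0%N j.+1) = 0.
  apply: (@crossing_grid N N) => [i j|i j iN jN|i iN|j jN].
  - exact: sector_lt3.
  - have [|k k3 H] := fine (i%:R / N%:R, j%:R / N%:R).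
      by split; apply: frac; exact: ltnW.
    have Ni : 0 <= N%:R^-1 :> R by rewrite invr_ge0 ltW.
    by exists k; split => //; apply: H; rewrite /= ?subrr ?normr0 //;
      split; apply: frac => //; exact: ltnW.
  - have [h1 h2] := hs _ (frac i iN); have [h3 _] := hs _ (frac N (leqnn N)).
    by rewrite /c /g1 /g2 frac0 h1 h3 frac1 h2.
  - have [_ h1] := h01 _ (frac j jN); have [_ h2] := h01 _ (frac 0%N (leq0n N)).
    by rewrite /c /g1 /g2 frac1 h1 h2.
apply/eqP.
pose x j := dot p (f (j%:R / N%:R)) - a; pose y j := dot q (f (j%:R / N%:R)) - b.
have cE j : (j <= N)%N -> c 0%N j = sector (x j) (y j).
  by move=> jN; have [h1 _] := h01 _ (frac j jN); rewrite /c /g1 /g2 frac0 h1.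
rewrite (eq_bigr (fun j : 'I_N => crossing (sector (x j) (y j))
    (sector (x j.+1) (y j.+1)))); last first.
  by move=> j _; rewrite !cE // ltnW.
have l0 : (0 < l%:R :> R) by rewrite ltr0n.
(* the sample points j / N and j.+1 / N lie on the same edge *)
have edge j t : (j < N)%N -> 0 <= t <= 1 -> let i := (j %/ l)%N in
    f ((j%:R + t) / N%:R) = s i + (((j %% l)%N%:R + t) / l%:R) *: (s i.+1 - s i).
  move=> jN /andP[t0 t1] i; rewrite -(@closed_polygonE _ m).
  - congr f; rewrite {1}(divn_eq j l) natrD natrM /N natrM.
    by field; rewrite !gt_eqF.
  - by rewrite /i ltn_divLR.
  - rewrite divr_ge0 ?addr_ge0 ?ler0n //= ler_pdivrMr // mul1r.
    have : (j %% l)%N.+1%:R <= l%:R :> R by rewrite ler_nat ltn_pmod.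
    by rewrite -natr1; lra.
apply: crossing_turning_loop => //.
- by rewrite /x frac0 frac1 f0 f1.
- by rewrite /y frac0 frac1 f0 f1.
- move=> j jN; rewrite /x /y -natr1.
  rewrite -[j%:R / N%:R]/((j%:R) / N%:R) -{1 3}[j%:R]addr0.
  rewrite !edge ?lexx ?ler01 //.
  have := turn (j %/ l)%N; rewrite -/N ltn_divLR // => /(_ jN).
  rewrite !(dotBr, dotDr, dotZr) addr0.
  set P1 := dot p (s _); set P2 := dot p (s _); set Q2 := dot q (s _); set Q1 := dot q (s _).
  move=> D; set w := (j %% l)%N%:R.
  (* Two consecutive samples cut off one [l]-th of the edge, and their determinant is one [l]-th of
     that of its ends. *)
  rewrite (_ : _ - _ = ((P1 - a) * (Q2 - b) - (Q1 - b) * (P2 - a)) / l%:R).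
    by rewrite divr_gt0.
  by field; rewrite gt_eqF.
- move=> j jN.
  have [|k k3 H] := fine (0, j%:R / N%:R).
    by split; [exact: I0|apply: frac; exact: ltnW].
  exists k => // t t01.
  have Kt : K (0, (j%:R + t) / N%:R).
    split; first exact: I0.
    case/andP: t01 => t0 t1.
    rewrite /= in_itv /= divr_ge0 ?addr_ge0 // ler_pdivrMr // mul1r.
    by move: jN; rewrite -(ler_nat R) -natr1; lra.
  have : sector (g1 (0, (j%:R + t) / N%:R)) (g2 (0, (j%:R + t) / N%:R)) != k.
    apply: H => //=; first by rewrite subrr normr0 invr_ge0 ltW.
    case/andP: t01 => t0 t1.
    rewrite -mulrBl opprD addrA subrr add0r normrM normrN ger0_norm //.
    by rewrite ger0_norm ?invr_ge0 ?(ltW NR) // ler_piMl // invr_ge0 (ltW NR).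
  have [_ Kt2] := Kt; have [h1 _] := h01 _ Kt2.
  rewrite /g1 /g2 h1 /x /y edge //.
  have -> : f (j.+1%:R / N%:R) = f ((j%:R + 1) / N%:R) by rewrite natr1.
  have -> : f (j%:R / N%:R) = f ((j%:R + 0) / N%:R) by rewrite addr0.
  rewrite !edge ?lexx ?ler01 //.
  have E (u u' v v' : R) : u = u' -> v = v' ->
      sector u v != k -> sector u' v' != k by move=> -> ->.
  apply: E; rewrite !(dotBr, dotDr, dotZr).
    by field; rewrite gt_eqF.
  by field; rewrite gt_eqF.
Qed.

(** Serves twice: to push the loop into the interior of the hull, and to move the point around which
    it turns. For one pair, [e <= a / D] gives [e * (a + |b|) < a]. *)
Lemma small_perturbation (R : realFieldType) (s : seq (R * R)) :
  (forall z, z \in s -> 0 < z.1) ->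
  exists2 d, 0 < d < 1 & forall e, 0 < e <= d -> forall z, z \in s ->
    0 < (1 - e) * z.1 + e * z.2.
Proof.
elim: s => [|[a b] s IH] pos; first by exists (2^-1) => //; apply/andP; split; lra.
have [|d /andP[d0 d1] dP] := IH; first by move=> z zs; apply: pos; rewrite inE zs orbT.
have a0 : 0 < a by apply: (pos (a, b)); rewrite inE eqxx.
pose D := a + `|b| + 1.
have D0 : 0 < D by rewrite /D; have := normr_ge0 b; lra.
exists (Num.min d (a / D)).
  by rewrite lt_min d0 divr_gt0 //= gt_min d1.
move=> e /andP[e0]; rewrite le_min => /andP[ed ea] z.
rewrite inE => /orP[/eqP -> /=|zs]; last by apply: dP => //; rewrite e0.
move: ea; rewrite ler_pdivlMr // /D => ea.
have := ler_norm (- b); rewrite normrN => nb.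
have : e * - b <= e * `|b| by rewrite ler_pM2l.
by lra.
Qed.

(** * The hole *)

Section ContinuousCombination.
Context {R : realType} {T : topologicalType} (f g : T -> R).
Hypothesis (cf : continuous f) (cg : continuous g).

Lemma linear_combination_continuous a b :
  continuous (fun z => a * f z + b * g z).
Proof.
by move=> z; apply: cvgD; (apply: cvgM; first exact: cvg_cst);
  [exact: cf|exact: cg].
Qed.

Lemma square_distance_continuous a b :
  continuous (fun z => (f z - a) ^+ 2 + (g z - b) ^+ 2).
Proof.
move=> z; have fa : f x - a @[x --> z] --> f z - a.
  by apply: cvgB; [exact: cf|exact: cvg_cst].
have gb : g x - b @[x --> z] --> g z - b.
  by apply: cvgB; [exact: cg|exact: cvg_cst].
by rewrite /continuous_at !expr2; apply: cvgD; apply: cvgM.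
Qed.

Lemma nbhs_gt a x : a < f x -> nbhs x [set z | a < f z].
Proof. exact: (@cvgr_gt R _ (nbhs x) _ f (f x) (@cf x) a). Qed.

End ContinuousCombination.

Section Hole.
Context {R : realType}.
Local Notation V := 'rV[R]_3.
Variables (H : set V) (Q : seq V) (p q v c0 y0 : V) (m : nat) (s0 : nat -> V).
Hypothesis (convH : convex_set H) (c0H : H° c0) (y0Q : y0 \in Q).
Hypothesis (pv : dot p v = 0) (qv : dot q v = 0).
Hypothesis ker : forall x, dot p x = 0 -> dot q x = 0 -> exists t, x = t *: v.
Hypothesis (m0 : (0 < m)%N) (s0m : s0 m = s0 0%N).
Hypothesis s0H : forall i, H (s0 i).

Let K := hull [set` Q].
Let C := cylinder K v.

(** Twice the signed area of a plane triangle. The third vertex is given by coordinates because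
    [loop_vertex_beyond] displaces it within the plane. *)
Definition turn_at (a b : V) (x y : R) : R :=
  (dot p b - dot p a) * (y - dot q a) - (dot q b - dot q a) * (x - dot p a).

Definition turn (a b x : V) : R := turn_at a b (dot p x) (dot q x).

Hypothesis turn0 : forall i x, (i < m)%N -> x \in Q ->
  0 < turn (s0 i) (s0 i.+1) x.

Lemma shrunk_loop : exists s : nat -> V,
  [/\ s m = s 0%N, forall i, H° (s i) &
      forall i x, (i < m)%N -> x \in Q -> 0 < turn (s i) (s i.+1) x].
Proof.
(* Shrinking towards [c0] multiplies the edge by [1 - d] and replaces the vector from [s0 i] to [x]
   by its combination, with weights [1 - d] and [d], with the vector from [c0] to [x]; the second
   entry is the area for the latter. *)
pose L := [seq (turn (s0 i) (s0 i.+1) x,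
  (dot p (s0 i.+1) - dot p (s0 i)) * (dot q x - dot q c0) -
  (dot q (s0 i.+1) - dot q (s0 i)) * (dot p x - dot p c0)) |
  i <- iota 0 m, x <- Q].
have [|d /andP[d0 d1] dP] := @small_perturbation R L.
  by move=> z /allpairsP[[i x] [/= im xQ ->]]; apply: turn0; rewrite // mem_iota in im *.
exists (fun i => d *: c0 + (1 - d) *: s0 i); split.
- by rewrite s0m.
- by move=> i; apply: interior_segment => //; rewrite d0 ltW.
move=> i x im xQ.
have /dP : 0 < d <= d by rewrite d0 lexx.
move=> /(_ (_, _) (allpairs_f _ _ xQ)) => /(_ i); rewrite mem_iota /= => /(_ im).
have d1' : 0 < 1 - d by rewrite subr_gt0.
move=> /(mulr_gt0 d1'); congr (0 < _).
by rewrite /turn /turn_at !(dotDr, dotZr); ring.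
Qed.

Lemma cylinderP x : C x <-> exists2 k, K k & dot p x = dot p k /\ dot q x = dot q k.
Proof.
split=> [[k Kk [t _ <-]]|[k Kk [xp xq]]].
  by exists k => //; rewrite !dotDr !dotZr pv qv !mulr0 !addr0.
have [||t xt] := @ker (x - k); rewrite ?dotBr ?xp ?xq ?subrr //.
by exists k => //; exists t => //; rewrite -xt addrC subrK.
Qed.

(** [k] is a point of [K] whose shadow is nearest to that of [x], and [(l1, l2)] points from the
    former shadow to the latter. Compactness of the hull gives [k]. *)
Lemma cylinder_separated x : ~ C x -> exists l1 l2 k,
  [/\ K k, l1 != 0 \/ l2 != 0,
      forall z, K z -> l1 * dot p z + l2 * dot q z <= l1 * dot p k + l2 * dot q k &
      l1 * dot p k + l2 * dot q k < l1 * dot p x + l2 * dot q x].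
Proof.
move=> nCx.
pose dist (z : V) : R := (dot p z - dot p x) ^+ 2 + (dot q z - dot q x) ^+ 2.
have cdist : continuous dist.
  by apply: square_distance_continuous; exact: dot_continuous.
have [||k] := compact_EVT_min (f := dist) _ (@compact_hull R Q) _.
- by exists y0; apply: sub_hull.
- exact: continuous_subspaceT.
rewrite inE => Kk kmin.
exists (dot p x - dot p k), (dot q x - dot q k), k.
have ne : dot p x != dot p k \/ dot q x != dot q k.
  have [e1|] := eqVneq (dot p x) (dot p k); last by left.
  have [e2|] := eqVneq (dot q x) (dot q k); last by right.
  by case: nCx; apply/cylinderP; exists k.
split => //; first by rewrite !subr_eq0.
- move=> z Kz; rewrite leNgt; apply/negP => lt.
  set a := dot p x - dot p k in lt; set b := dot q x - dot q k in lt.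
  set u := dot p z - dot p k; set w := dot q z - dot q k.
  have pos : 0 < a * u + b * w by rewrite /u /w; lra.
  (* Going from [k] to [z] by a fraction [t] lowers the squared distance by [t * (2 * (a * u + b *
     w) - t * (u ^+ 2 + w ^+ 2))]. With this denominator [t <= 1] and the second factor is positive,
     against minimality. *)
  pose N := u ^+ 2 + w ^+ 2 + (a * u + b * w).
  have N0 : 0 < N by rewrite /N; have := sqr_ge0 u; have := sqr_ge0 w; lra.
  pose t := (a * u + b * w) / N.
  have t0 : 0 < t by rewrite divr_gt0.
  have t1 : t <= 1.
    by rewrite ler_pdivrMr // mul1r /N; have := sqr_ge0 u; have := sqr_ge0 w; lra.
  have : dist k <= dist (t *: z + (1 - t) *: k).
    apply: kmin; rewrite inE; apply: ((convex_setP _).1 (@hull_convex _ _)) => //.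
    by rewrite ltW.
  have -> : dist k = a ^+ 2 + b ^+ 2 by rewrite /dist /a /b; ring.
  have -> : dist (t *: z + (1 - t) *: k) = a ^+ 2 + b ^+ 2
      - t * (2 * (a * u + b * w) - t * (u ^+ 2 + w ^+ 2)).
    by rewrite /dist !(dotDr, dotZr) /a /b /u /w; ring.
  rewrite leNgt ltrBlDr ltrDl mulr_gt0 // subr_gt0.
  have tN : t * N = a * u + b * w by rewrite /t divfK // gt_eqF.
  by move: tN; rewrite /N; nra.
- rewrite -subr_gt0.
  have -> : (dot p x - dot p k) * dot p x + (dot q x - dot q k) * dot q x -
     ((dot p x - dot p k) * dot p k + (dot q x - dot q k) * dot q k) =
     (dot p x - dot p k) ^+ 2 + (dot q x - dot q k) ^+ 2 by ring.
  rewrite lt_def addr_ge0 ?sqr_ge0 // andbT paddr_eq0 ?sqr_ge0 //.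
  by rewrite !sqrf_eq0 !subr_eq0 negb_and; apply/orP.
Qed.

Lemma closed_cylinder : closed C.
Proof.
rewrite -openC openE => x /= nCx.
have [l1 [l2 [k [Kk _ lk lx]]]] := cylinder_separated nCx.
have cl : continuous (fun z : V => l1 * dot p z + l2 * dot q z).
  by apply: linear_combination_continuous; exact: dot_continuous.
apply: filterS (nbhs_gt cl lx) => z /= lz /cylinderP[z' Kz' [zp zq]].
by move: lz; rewrite zp zq ltNge lk.
Qed.

Lemma interior_hole : (H `\` C)° = H° `\` C.
Proof.
rewrite setDE interiorI; congr (_ `&` _).
by apply/interior_id; rewrite openC; exact: closed_cylinder.
Qed.

(** Otherwise the whole loop is behind the line through [k] orthogonal to [(l1, l2)]. Seen from a
    point displaced slightly by [d * (l1, l2)], it still turns left and is now in an open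
    half-plane, against [half_plane_cycle]. *)
Lemma loop_vertex_beyond (s : nat -> V) l1 l2 k : s m = s 0%N ->
  (forall i, (i < m)%N -> 0 < turn (s i) (s i.+1) k) ->
  l1 != 0 \/ l2 != 0 ->
  exists2 i, (i < m)%N &
    l1 * dot p k + l2 * dot q k < l1 * dot p (s i) + l2 * dot q (s i).
Proof.
move=> sm tk l0; apply: contrapT => none.
have le i : (i <= m)%N ->
    l1 * dot p (s i) + l2 * dot q (s i) <= l1 * dot p k + l2 * dot q k.
  rewrite leq_eqVlt => /orP[/eqP ->|im]; rewrite leNgt; apply/negP => h.
    by apply: none; exists 0%N => //; rewrite -sm.
  by apply: none; exists i.
pose L := [seq (turn (s i) (s i.+1) k,
               turn_at (s i) (s i.+1) (dot p k + l1) (dot q k + l2)) | i <- iota 0 m].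
have [|d /andP[d0 d1] dP] := @small_perturbation R L.
  by move=> z /mapP[i im ->]; apply: tk; rewrite mem_iota in im.
have l0' : 0 < l1 ^+ 2 + l2 ^+ 2.
  rewrite lt_def addr_ge0 ?sqr_ge0 // andbT paddr_eq0 ?sqr_ge0 //.
  by rewrite !sqrf_eq0 negb_and; apply/orP.
apply: (@half_plane_cycle R (fun i => dot p (s i) - dot p k - d * l1)
         (fun i => dot q (s i) - dot q k - d * l2) m (- l1) (- l2)) => //.
- by rewrite sm.
- by rewrite sm.
- move=> i im; have /dP : 0 < d <= d by rewrite d0 lexx.
  move=> /(_ (_, _) (map_f _ _)) => /(_ i); rewrite mem_iota /= => /(_ im).
  by congr (0 < _); rewrite /turn /turn_at; ring.
- move=> i im; have := le i im; have := mulr_gt0 d0 l0'; lra.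
Qed.

Lemma turn_hull a b : (forall x, x \in Q -> 0 < turn a b x) ->
  forall x, K x -> 0 < turn a b x.
Proof.
move=> tQ; apply: (@hull_min _ _ [set x | 0 < turn a b x]) => //.
apply/convex_setP => x y t /= tx ty /andP[t0 t1].
have -> : turn a b (t *: x + (1 - t) *: y) = t * turn a b x + (1 - t) * turn a b y.
  by rewrite /turn /turn_at !(dotDr, dotZr); ring.
have [->|tn] := eqVneq t 0; first by rewrite mul0r add0r subr0 mul1r.
have tp : 0 < t by rewrite lt_def tn.
have h2 : 0 <= (1 - t) * turn a b y by apply: mulr_ge0; [rewrite subr_ge0|exact: ltW].
by have := mulr_gt0 tp tx; lra.
Qed.

Lemma has_hole_cylinder : has_hole (H `\` C).
Proof.
have [s [sm sH sQ]] := shrunk_loop.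
have sK i x : (i < m)%N -> K x -> 0 < turn (s i) (s i.+1) x.
  by move=> im; apply: turn_hull => y; exact: sQ.
have convH' := (convex_setP _).1 (interior_convex convH).
have segE (x y : V) (u : R) : x + u *: (y - x) = u *: y + (1 - u) *: x.
  by rewrite scalerBr scalerBl scale1r addrCA.
have edges i u : (i < m)%N -> 0 <= u <= 1 ->
    (H° `\` C) (s i + u *: (s i.+1 - s i)).
  move=> im u01; split; first by rewrite segE; apply: convH'.
  move=> /cylinderP[k Kk [kp kq]].
  have := sK i k im Kk; rewrite /turn /turn_at -kp -kq !(dotBr, dotDr, dotZr).
  by rewrite (_ : _ - _ = 0) ?ltxx //; ring.
rewrite /has_hole interior_hole; split; last first.
  (* The loop winds around the line over the vertex [y0], which lies in the cylinder. *)
  apply: (@turning_loop_not_contractible R _ p q (dot p y0) (dot q y0) m s) => //.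
    by move=> x [_ nCx] [xp xq]; apply: nCx; apply/cylinderP; exists y0 => //; exact: sub_hull.
  move=> i im; have := sQ i y0 im y0Q; congr (0 < _).
  by rewrite /turn /turn_at; ring.
pose loop := closed_polygon m s @` `[0, 1]%classic.
have loop_sub : loop `<=` H° `\` C.
  move=> _ [t /= + <-]; rewrite in_itv /= => t01.
  have [i [u [im u01 ->]]] := closed_polygon_param m0 t01.
  by rewrite closed_polygonE //; exact: edges.
have loopV i : (i < m)%N -> loop (s i).
  move=> im; exists (i%:R / m%:R).
    have mp : 0 < m%:R :> R by rewrite ltr0n.
    by rewrite /= in_itv /= divr_ge0 // ler_pdivrMr // mul1r ler_nat ltnW.
  have := @closed_polygonE _ m s i 0 im.
  by rewrite addr0 scale0r addr0 lexx ler01; apply.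
pose seg (z : V * nat) := (fun u : R => z.1 + u *: (s z.2 - z.1)) @` `[0, 1]%classic.
pose good (z : V * nat) := (z.2 < m)%N /\ seg z `<=` H° `\` C.
have seg0 z : seg z z.1.
  by exists 0; rewrite /= ?in_itv /= ?lexx ?ler01 // scale0r addr0.
(* Each member of this union is connected, since its segment ends at a vertex of the loop, and all
   members contain [s 0]. *)
have -> : H° `\` C = \bigcup_(z in good) (seg z `|` loop).
  apply/seteqP; split; last by move=> x [z [_ zs]] [/zs|/loop_sub].
  move=> x [Hx nCx].
  have [l1 [l2 [k [Kk l0 lk lx]]]] := cylinder_separated nCx.
  have [i im li] := loop_vertex_beyond sm (fun i im => sK i k im Kk) l0.
  exists (x, i); last by left; exact: (seg0 (x, i)).
  split=> // _ [u /= + <-]; rewrite in_itv /= => u01; split.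
    by rewrite segE; apply: convH'.
  move=> /cylinderP[z Kz [zp zq]]; have := lk z Kz; rewrite -zp -zq.
  rewrite leNgt => /negP; apply; rewrite !(dotBr, dotDr, dotZr).
  case/andP: u01 => u0 u1.
  set A := l1 * dot p k + _ in lx li *.
  have -> : l1 * (dot p x + u * (dot p (s i) - dot p x)) +
            l2 * (dot q x + u * (dot q (s i) - dot q x)) =
     u * (l1 * dot p (s i) + l2 * dot q (s i)) +
     (1 - u) * (l1 * dot p x + l2 * dot q x) by ring.
  move: (l1 * dot p (s i) + _) (l1 * dot p x + _) lx li => B D AD AB.
  have [->|un] := eqVneq u 0; first by lra.
  have up : 0 < u by rewrite lt_def un.
  have AB' : 0 < u * (B - A) by rewrite mulr_gt0 ?subr_gt0.
  have AD' : 0 <= (1 - u) * (D - A) by rewrite mulr_ge0 ?subr_ge0 // ltW.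
  by lra.
apply: bigcup_connected.
  by exists (s 0%N) => z _; right; exact: loopV.
move=> [x i] [im _]; apply: connectedU.
- exists (s i); split; last exact: loopV.
  exists 1; rewrite /= ?in_itv /= ?lexx ?ler01 //.
  by rewrite scale1r addrC subrK.
- apply: connected_continuous_connected; first exact: segment_connected.
  apply: continuous_subspaceT => u; apply: cvgD; first exact: cvg_cst.
  by apply: cvgZr_tmp; exact: cvg_id.
- apply: connected_continuous_connected; first exact: segment_connected.
  by apply: continuous_subspaceT; exact: closed_polygon_continuous.
Qed.

End Hole.

(** * Shadows *)

Section Spanning.
Context {R : realType}.
Local Notation V := 'rV[R]_3.

(** The vectors are weighted sums, to be divided by their total weight. In this form partial
    barycentres can be combined pairwise, which assembles the four terms in [spanning_interior]. *)
Lemma convex_bary (C : set V) (a b : R) (x y : V) : convex_set C ->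
  0 < a -> 0 < b -> C (a^-1 *: x) -> C (b^-1 *: y) ->
  C ((a + b)^-1 *: (x + y)).
Proof.
move=> /convex_setP cC a0 b0 Cx Cy; have ab0 : 0 < a + b by rewrite addr_gt0.
have -> : (a + b)^-1 *: (x + y) =
    (a / (a + b)) *: (a^-1 *: x) + (1 - a / (a + b)) *: (b^-1 *: y).
  rewrite !scalerA scalerDr; congr (_ *: _ + _ *: _); field; rewrite !gt_eqF //.
apply: cC => //; rewrite divr_ge0 ?(ltW a0) ?(ltW ab0) //=.
by rewrite ler_pdivrMr // mul1r lerDl ltW.
Qed.

(** Four affinely independent points: non-coplanarity in a form that one determinant certifies. *)
Definition spanning (A : set V) : Prop :=
  exists a (f : 'I_3 -> V), [/\ A a, forall i, A (f i) &
    \matrix_(i < 3) (f i - a) \in unitmx].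

Lemma spanning_interior (A : set V) : spanning A -> hull A !=set0 /\ exists c, (hull A)° c.
Proof.
move=> [a [f [Aa Af unitW]]]; set W := \matrix_(i < 3) (f i - a) in unitW.
split; first by exists a; exact: sub_hull.
(* The basis dual to the edges [f i - a], so that [l i] is a barycentric coordinate in the
   tetrahedron. The fourth coordinate, 1 minus their sum, is expressed by [r3]; at the centroid [c]
   all four are [4^-1], and they stay positive nearby. *)
pose r (i : 'I_3) : V := \row_j invmx W j i.
have rE i x : dot (r i) x = (x *m invmx W) 0 i.
  by rewrite /dot mxE; apply: eq_bigr => j _; rewrite mxE mulrC.
pose l i x := dot (r i) x - dot (r i) a.
have xE x : x = a + \sum_i l i x *: (f i - a).
  have : (x - a) *m invmx W *m W = \sum_i l i x *: (f i - a).
    rewrite mulmx_sum_row; apply: eq_bigr => i _.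
    by rewrite rowK /l !rE mulmxBl !mxE.
  by rewrite mulmxKV // => <-; rewrite addrC subrK.
pose r3 : V := - (r 0 + r 1 + r 2).
have r3E x : dot r3 x = - (dot (r 0) x + dot (r 1) x + dot (r 2) x).
  by rewrite !dotE !mxE; ring.
pose c : V := a + \sum_i 4^-1 *: (f i - a).
have lc i : l i c = 4^-1.
  have : c - a = (\row_j 4^-1) *m W.
    rewrite mulmx_sum_row /c addrC addKr; apply: eq_bigr => j _.
    by rewrite rowK mxE.
  move=> /(congr1 (fun x => x *m invmx W)); rewrite mulmxK // => /rowP/(_ i).
  by rewrite mulmxBl [LHS]mxE [X in _ + X]mxE [RHS]mxE /l !rE.
exists c.
have ngt i : nbhs c [set x | dot (r i) a < dot (r i) x].
  apply: nbhs_gt; first exact: dot_continuous.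
  by have := lc i; rewrite /l => e; lra.
have ngt3 : nbhs c [set x | dot r3 a - 1 < dot r3 x].
  apply: nbhs_gt; first exact: dot_continuous.
  have := lc 0; have := lc 1; have := lc 2; rewrite !r3E /l => e0 e1 e2; lra.
apply: filterS (filterI (filterI (ngt 0) (ngt 1)) (filterI (ngt 2) ngt3)).
move=> x [[/= x0 x1] [x2 x3]]; rewrite !r3E in x3.
have p0 : 0 < l 0 x by rewrite subr_gt0.
have p1 : 0 < l 1 x by rewrite subr_gt0.
have p2 : 0 < l 2 x by rewrite subr_gt0.
have p3 : 0 < 1 - (l 0 x + l 1 x + l 2 x) by rewrite /l; lra.
have hV (w : R) z : 0 < w -> A z -> hull A (w^-1 *: (w *: z)).
  by move=> w0 Az; rewrite scalerA mulVf ?gt_eqF // scale1r; exact: sub_hull.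
have := convex_bary (@hull_convex _ A) (addr_gt0 p0 p1) (addr_gt0 p2 p3)
  (convex_bary (@hull_convex _ A) p0 p1 (hV _ _ p0 (Af 0)) (hV _ _ p1 (Af 1)))
  (convex_bary (@hull_convex _ A) p2 p3 (hV _ _ p2 (Af 2)) (hV _ _ p3 Aa)).
rewrite (_ : l 0 x + l 1 x + (l 2 x + (1 - (l 0 x + l 1 x + l 2 x))) = 1); last by ring.
rewrite invr1 scale1r; congr (hull A); rewrite [RHS]xE !big_ord_recr big_ord0 /= add0r.
have e0 : widen_ord (leqnSn 2) (widen_ord (leqnSn 1) ord_max) = 0 :> 'I_3 by exact: val_inj.
have e1 : widen_ord (leqnSn 2) ord_max = 1 :> 'I_3 by exact: val_inj.
have e2 : ord_max = 2 :> 'I_3 by exact: val_inj.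
rewrite e0 e1 e2; apply/rowP => j; rewrite !mxE; ring.
Qed.

End Spanning.

Section Criterion.
Context {R : realType}.
Local Notation V := 'rV[R]_3.
Implicit Types (S : seq V) (M F G : 'M[R]_3).

(** Implies convex position, and is witnessed by one direction per vertex, which can be found
    approximately and verified exactly. *)
Definition exposed S : Prop :=
  forall x, x \in S -> exists u, forall y, y \in S -> y != x -> dot u y < dot u x.

Lemma dot_mulmx (u x : V) M : dot u (x *m M) = dot (u *m M^T) x.
Proof.
have dE (w y : V) : dot w y = (w *m y^T) 0 0.
  by rewrite mxE; apply: eq_bigr => j _; rewrite mxE.
by rewrite !dE trmx_mul mulmxA.
Qed.

Lemma polyhedron_image S c M b : exposed S -> spanning [set` S] ->
  c != 0 -> M *m M^T = 1%:M ->
  polyhedron [set c *: (x *m M) + b | x in [set` S]].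
Proof.
move=> expS [a [f [Sa Sf unitW]]] c0 MM.
have dE (u x : V) : dot u (c *: (x *m M) + b) = c * dot (u *m M^T) x + dot u b.
  by rewrite dotDr dotZr dot_mulmx.
split.
- by apply: finite_image; exact: finite_seq.
- move=> _ [x Sx <-] hx.
  have [u ux] := expS x Sx.
  (* The functional [u] transported by the similarity. The open half-space below its value at the
     vertex is convex and contains the other vertices, hence their hull, but not the vertex. *)
  suff : [set z : V | dot (c^-1 *: (u *m M)) z <
             dot (c^-1 *: (u *m M)) (c *: (x *m M) + b)] (c *: (x *m M) + b).
    by rewrite /= ltxx.
  apply: hull_min hx.
    apply/convex_setP => y z t /=; set w := c^-1 *: (u *m M).
    move: (dot w (c *: _ + b)) => B hy hz /andP[t0 t1]; rewrite dotDr !dotZr.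
    have [->|tn] := eqVneq t 0; first by rewrite mul0r add0r subr0 mul1r.
    have tp : 0 < t by rewrite lt_def tn.
    have h1 : t * dot w y < t * B by rewrite ltr_pM2l.
    have h2 : (1 - t) * dot w z <= (1 - t) * B.
      by rewrite ler_wpM2l ?subr_ge0 // ltW.
    by lra.
  move=> _ [[y Sy <-] ne] /=.
  have cE z : dot (c^-1 *: (u *m M)) (c *: (z *m M) + b) =
      dot u z + dot (c^-1 *: (u *m M)) b.
    rewrite dotDr dotZr dot_mulmx -scalemxAl -mulmxA MM mulmx1.
    by rewrite !dotE !mxE; field.
  rewrite !cE ltrD2r; apply: ux => //.
  by apply: contra_notN ne => /eqP ->.
- move=> [u [d [u0 ud]]].
  have ud' x : x \in S -> c * dot (u *m M^T) x + dot u b = d.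
    by move=> xS; rewrite -dE; apply: ud; exists x.
  have W0 : \matrix_(i < 3) (f i - a) *m (u *m M^T)^T = 0.
    apply/matrixP => i j; rewrite [in RHS]mxE [in LHS]mxE.
    transitivity (dot (u *m M^T) (f i - a)).
      by rewrite /dot; apply: eq_bigr => l _; rewrite !mxE mulrC (ord1 j).
    have := ud' _ (Sf i); have := ud' _ Sa; rewrite dotBr => e1 e2.
    apply: (mulfI c0); rewrite mulr0 mulrBr; lra.
  have : u *m M^T = 0.
    by apply: trmx_inj; rewrite -(mulKmx unitW (_ ^T)) W0 mulmx0 trmx0.
  move=> /(congr1 (fun x => x *m M)); rewrite mul0mx -mulmxA (mulmx1C MM) mulmx1.
  by move=> u0'; rewrite u0' eqxx in u0.
Qed.

(** Vectors are rows, and the shadow consists of the first two coordinates. The inequality says that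
    the edge from [s i] to [s i.+1], rotated by [F], passes the moved copy of [x] on its left. *)
Definition passage S F G (t : V) (m : nat) (s : nat -> V) : Prop :=
  forall i x, (i < m)%N -> x \in S ->
  0 < ((s i.+1 *m F) 0 0 - (s i *m F) 0 0) * ((x *m G + t) 0 1 - (s i *m F) 0 1)
    - ((s i.+1 *m F) 0 1 - (s i *m F) 0 1) * ((x *m G + t) 0 0 - (s i *m F) 0 0).

Theorem rupert_criterion S F G t m s P :
  exposed S -> spanning [set` S] -> F *m F^T = 1%:M -> G *m G^T = 1%:M ->
  (0 < m)%N -> s m = s 0%N -> (forall i, s i \in S) -> passage S F G t m s ->
  similar_to [set` S] P -> rupert P.
Proof.
move=> expS spanS FF GG m0 sm sS pass [c c0 [M [b [MM PE]]]].
(* The outer body has to be [P] itself, so instead of rotating it the frame of projection is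
   transported to it. The existential keeps [F'] opaque. *)
have [F' F'E] : exists F', F' = M^T *m F by exists (M^T *m F).
have FF' : F' *m F'^T = 1%:M.
  rewrite F'E trmx_mul trmxK mulmxA -[_ *m F *m _]mulmxA FF mulmx1.
  exact: mulmx1C.
have FF'C := mulmx1C FF'.
pose phi x : V := c *: (x *m M) + b.
(* [N] performs the inner rotation and undoes [F']: in the frame [F'], the point [psi x] shows
   [x *m G + t], up to the ratio [c] and the translation that also affects [phi]. *)
have [N NE] : exists N, N = G *m F'^T by exists (G *m F'^T).
pose b' : V := c *: (t *m F'^T) + b.
pose psi x : V := c *: (x *m N) + b'.
have NN : N *m N^T = 1%:M.
  by rewrite NE trmx_mul trmxK mulmxA -[_ *m _ *m F']mulmxA FF'C mulmx1.
pose row (i : 'I_3) : V := \row_j F' j i.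
have rowE i x : dot (row i) x = (x *m F') 0 i.
  by rewrite /dot mxE; apply: eq_bigr => j _; rewrite mxE mulrC.
have rowrow i j : dot (row i) (row j) = (i == j)%:R.
  transitivity ((F'^T *m F') i j); last by rewrite FF'C mxE.
  by rewrite /dot mxE; apply: eq_bigr => l _; rewrite !mxE.
have phiE x i : dot (row i) (phi x) = c * (x *m F) 0 i + (b *m F') 0 i.
  by rewrite rowE /phi mulmxDl -scalemxAl F'E -!mulmxA [M *m _]mulmxA MM mul1mx !mxE.
have psiE x i : dot (row i) (psi x) = c * (x *m G + t) 0 i + (b *m F') 0 i.
  rewrite rowE /psi /b' NE !mulmxDl -!scalemxAl -!mulmxA FF'C !mulmx1 addrA.
  by rewrite -scalerDr !mxE.
have phiP x : x \in S -> P (phi x) by move=> xS; rewrite PE; exists x.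
have spanP : spanning P.
  have [a [f [Sa Sf unitW]]] := spanS.
  exists (phi a), (fun i => phi (f i)); split.
    - exact: phiP _ Sa.
    - by move=> i; exact: phiP _ (Sf i).
  have -> : \matrix_(i < 3) (phi (f i) - phi a) =
            c *: (\matrix_(i < 3) (f i - a) *m M).
    apply/row_matrixP => i; rewrite rowK linearZ /= row_mul rowK /phi.
    by rewrite mulmxBl scalerBr opprD addrACA subrr addr0.
  rewrite unitmxZ ?unitfE ?gt_eqF // unitmx_mul unitW /=.
  by have [] := mulmx1_unit MM.
have [_ [c1 c1P]] := spanning_interior spanP.
have [a0 [_ [Sa0 _ _]]] := spanS.
(* The columns [row i] of [F'] are orthonormal; the first two give the shadow, the third the
   direction of the cylinder. *)
exists [set psi x | x in [set` S]], (row 2); split.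
- by apply: polyhedron_image => //; rewrite gt_eqF.
- exists (M^T *m N), (b' - b *m (M^T *m N)); split.
    rewrite trmx_mul trmxK mulmxA -[_ *m N *m _]mulmxA NN mulmx1.
    exact: mulmx1C.
  have phiN x : 1 *: (phi x *m (M^T *m N)) + (b' - b *m (M^T *m N)) = psi x.
    rewrite scale1r /phi mulmxDl -scalemxAl mulmxA -(mulmxA x) MM mulmx1.
    by rewrite -addrA [b *m _ + _]addrC subrK.
  rewrite PE; apply/seteqP; split=> [_ [x Sx <-]|_ [_ [x Sx <-] <-]].
    by exists (phi x); [exists x|exact: phiN].
  by exists x => //; rewrite -phiN.
- apply/eqP => r0; have := rowrow 2 2; rewrite r0 eqxx dotE !mxE !mul0r !addr0.
  by move=> /eqP; rewrite eq_sym oner_eq0.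
- have -> : [set psi x | x in [set` S]] = [set` map psi S].
    apply/seteqP; split=> [_ [x Sx <-]|x /= /mapP[y yS ->]]; last by exists y.
    exact: map_f.
  apply: (@has_hole_cylinder R (hull P) (map psi S) (row 0) (row 1) (row 2) c1
           (psi a0) m (fun i => phi (s i))) => //.
  + exact: hull_convex.
  + exact: map_f.
  + move=> x x0 x1; exists (dot (row 2) x).
    rewrite -[LHS]mulmx1 -FF' mulmxA mulmx_sum_row !big_ord_recr big_ord0 /= add0r.
    have e0 : widen_ord (leqnSn 2) (widen_ord (leqnSn 1) ord_max) = 0 :> 'I_3
      by exact: val_inj.
    have e1 : widen_ord (leqnSn 2) ord_max = 1 :> 'I_3 by exact: val_inj.
    have e2 : ord_max = 2 :> 'I_3 by exact: val_inj.
    rewrite e0 e1 e2 -!rowE x0 x1 !scale0r !add0r; congr (_ *: _).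
    by apply/rowP => j; rewrite !mxE.
  + by rewrite sm.
  + by move=> i; apply: sub_hull; exact: phiP.
  + move=> i _ im /mapP[x xS ->]; have := pass i x im xS.
    move=> /(mulr_gt0 (mulr_gt0 c0 c0)); congr (0 < _).
    rewrite /turn /turn_at !phiE !psiE; ring.
Qed.

End Criterion.

(** * Interval arithmetic *)

Section IntegerEmbedding.
Context {R : realType}.

(* Locked so that unification never computes the image of a large integer. *)
Definition zR (z : Z) : R := locked (int_of_Z z)%:~R.

Lemma zRD a b : zR (a + b)%stdZ = zR a + zR b.
Proof. by rewrite /zR -!lock -intrD; congr (_%:~R); lia. Qed.

Lemma zRN a : zR (- a)%stdZ = - zR a.
Proof. by rewrite /zR -!lock -intrN; congr (_%:~R); lia. Qed.

Lemma zRB a b : zR (a - b)%stdZ = zR a - zR b.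
Proof. by rewrite -zRN -zRD. Qed.

Lemma zRM a b : zR (a * b)%stdZ = zR a * zR b.
Proof. by rewrite /zR -!lock -intrM; congr (_%:~R); lia. Qed.

Lemma zR_le a b : (a <= b)%stdZ -> zR a <= zR b.
Proof. by move=> ab; rewrite /zR -!lock ler_int; lia. Qed.

Lemma zR_lt a b : (a < b)%stdZ -> zR a < zR b.
Proof. by move=> ab; rewrite /zR -!lock ltr_int; lia. Qed.

Lemma zR0 : zR 0 = 0. Proof. by rewrite /zR -lock. Qed.
Lemma zR_max0 z : zR (Z.max 0 z) = Num.max 0 (zR z).
Proof.
have [z0|z0] := Z.le_gt_cases 0 z.
  by rewrite Z.max_r // max_r // -zR0; exact: zR_le.
have zn : (z <= 0)%stdZ by lia.
by rewrite Z.max_l // max_l ?zR0 // -zR0; exact: zR_le.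
Qed.

Lemma zR_nat (n : nat) : zR (Z.of_nat n) = n%:R.
Proof. by rewrite /zR -lock [RHS]pmulrn; congr (_ *~ _); lia. Qed.

End IntegerEmbedding.

Definition itv : Type := option (Z * Z).

Definition prec : Z := 40.
Definition unit_scale : Z := 2 ^ prec.

Lemma unit_scale_gt0 : (0 < unit_scale)%stdZ. Proof. by []. Qed.

Lemma floor_unit_scale z : (unit_scale * Z.shiftr z prec <= z)%stdZ.
Proof.
by rewrite Z.shiftr_div_pow2 //; exact: (Z.mul_div_le z unit_scale unit_scale_gt0).
Qed.

(* Conversion must never compute with closed intervals outside of [vm_compute]. *)
Global Opaque unit_scale.

Section Intervals.
Context {R : realType}.
Local Notation zR := (@zR R).
Local Notation S := (zR unit_scale).
Implicit Types (x y : R) (X Y : itv).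

(* [None] is the interval without bounds; bounds are multiples of [2 ^ - prec]. *)
Definition encl X x : Prop :=
  if X is Some (l, h) then zR l <= x * S <= zR h else True.

Lemma S_gt0 : 0 < S.
Proof. by rewrite -[0]zR0; apply: zR_lt; exact: unit_scale_gt0. Qed.

Definition cst_itv (z : Z) : itv := Some (z * unit_scale, z * unit_scale)%stdZ.

Definition add_itv X Y : itv :=
  if X is Some (a, b) then if Y is Some (c, d) then Some (a + c, b + d)%stdZ
  else None else None.

Definition opp_itv X : itv := if X is Some (a, b) then Some (- b, - a)%stdZ else None.

Definition floor_scale (z : Z) : Z := Z.shiftr z prec.
Definition ceil_scale (z : Z) : Z := (- Z.shiftr (- z) prec)%stdZ.

(** When the second factor is nonnegative, the signs of [a] and [b] select the two extreme products;
    otherwise all four are compared. *)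
Definition mul_itv X Y : itv :=
  if X is Some (a, b) then if Y is Some (c, d) then
    if (0 <=? c)%stdZ then
      Some (floor_scale (a * if (0 <=? a)%stdZ then c else d),
            ceil_scale (b * if (0 <=? b)%stdZ then d else c))%stdZ
    else
      Some (floor_scale (Z.min (Z.min (a * c) (a * d)) (Z.min (b * c) (b * d))),
            ceil_scale (Z.max (Z.max (a * c) (a * d)) (Z.max (b * c) (b * d))))%stdZ
  else None else None.

Definition inv_itv X : itv :=
  if X is Some (a, b) then
    if (0 <? a)%stdZ then
      Some (unit_scale * unit_scale / b, unit_scale * unit_scale / a + 1)%stdZ
    else if (b <? 0)%stdZ then
      Some (- (unit_scale * unit_scale / - b + 1),
            - (unit_scale * unit_scale / - a))%stdZ
    else None
  else None.

(** With scale [S], the scaled root is the square root of [(x * S) * S]. Cutting at 0 agrees with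
    [Num.sqrt], which is 0 on negative numbers. *)
Definition sqrt_itv X : itv :=
  if X is Some (a, b) then
    Some (Z.sqrt (Z.max 0 a * unit_scale), Z.sqrt (Z.max 0 b * unit_scale) + 1)%stdZ
  else None.

Lemma encl_cst (n : nat) : encl (cst_itv (Z.of_nat n)) (n%:R : R).
Proof. by rewrite /= zRM zR_nat lexx. Qed.

Lemma encl_cstZ z : encl (cst_itv z) (zR z).
Proof. by rewrite /= zRM lexx. Qed.

Lemma encl_add X Y x y : encl X x -> encl Y y -> encl (add_itv X Y) (x + y).
Proof.
move: X Y => [[a b]|] [[c d]|] //= /andP[ax xb] /andP[cy yd].
by rewrite !zRD mulrDl !lerD.
Qed.

Lemma encl_opp X x : encl X x -> encl (opp_itv X) (- x).
Proof.
move: X => [[a b]|] //= /andP[ax xb].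
by rewrite !zRN mulNr !lerN2 xb.
Qed.

Lemma floor_scaleP z : zR (floor_scale z) * S <= zR z.
Proof.
rewrite -zRM; apply: zR_le; rewrite /floor_scale.
by have := @floor_unit_scale z; lia.
Qed.

Lemma ceil_scaleP z : zR z <= zR (ceil_scale z) * S.
Proof.
have := floor_scaleP (- z)%stdZ; rewrite /ceil_scale /floor_scale zRN.
by rewrite (zRN (Z.shiftr _ _)) mulNr lerNr.
Qed.

Lemma encl_mul X Y x y : encl X x -> encl Y y -> encl (mul_itv X Y) (x * y).
Proof.
move: X Y => [[a b]|] [[c d]|] //= /andP[ax xb] /andP[cy yd].
(* A product of scaled values carries the scale twice; the outward rounding removes it once. *)
have scale l h : zR l <= (x * S) * (y * S) <= zR h ->
    encl (Some (floor_scale l, ceil_scale h)) (x * y).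
  have e : x * y * S * S = (x * S) * (y * S) by ring.
  move=> /andP[lz zh] /=; apply/andP; split; rewrite -(ler_pM2r S_gt0) e.
    exact: le_trans (floor_scaleP _) lz.
  exact: le_trans zh (ceil_scaleP _).
move: scale ax xb cy yd; move: (x * S) (y * S) => u v scale au ub cv vd.
case: ifP => c0.
  have v0 : 0 <= v by apply: le_trans cv; rewrite -zR0; apply: zR_le; lia.
  apply: scale; rewrite !zRM; apply/andP; split.
    apply: (@le_trans _ _ (zR a * v)); last by rewrite ler_wpM2r.
    case: ifP => a0.
      by rewrite ler_wpM2l // -zR0; apply: zR_le; lia.
    by rewrite ler_wnM2l // -zR0; apply: zR_le; lia.
  apply: (@le_trans _ _ (zR b * v)); first by rewrite ler_wpM2r.
  case: ifP => b0.
    by rewrite ler_wpM2l // -zR0; apply: zR_le; lia.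
  by rewrite ler_wnM2l // -zR0; apply: zR_le; lia.
apply: scale.
set l := Z.min _ _; set h := Z.max _ _.
have lac : zR l <= zR a * zR c by rewrite -zRM; apply: zR_le; lia.
have lad : zR l <= zR a * zR d by rewrite -zRM; apply: zR_le; lia.
have lbc : zR l <= zR b * zR c by rewrite -zRM; apply: zR_le; lia.
have lbd : zR l <= zR b * zR d by rewrite -zRM; apply: zR_le; lia.
have hac : zR a * zR c <= zR h by rewrite -zRM; apply: zR_le; lia.
have had : zR a * zR d <= zR h by rewrite -zRM; apply: zR_le; lia.
have hbc : zR b * zR c <= zR h by rewrite -zRM; apply: zR_le; lia.
have hbd : zR b * zR d <= zR h by rewrite -zRM; apply: zR_le; lia.
clearbody l h; clear c0.
move: (zR a) (zR b) (zR c) (zR d) (zR l) (zR h)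
  au ub cv vd lac lad lbc lbd hac had hbc hbd => {}a {}b {}c {}d {}l {}h.
move=> au ub cv vd lac lad lbc lbd hac had hbc hbd.
have bnd w : l <= w * c -> l <= w * d -> w * c <= h -> w * d <= h ->
    l <= w * v <= h.
  move=> l1 l2 h1 h2; have [w0|/ltW w0] := leP 0 w; apply/andP; split.
  - by apply: le_trans l1 _; rewrite ler_wpM2l.
  - by apply: le_trans h2; rewrite ler_wpM2l.
  - by apply: le_trans l2 _; rewrite ler_wnM2l.
  - by apply: le_trans h1; rewrite ler_wnM2l.
have /andP[la ha] := bnd a lac lad hac had.
have /andP[lb hb] := bnd b lbc lbd hbc hbd.
have [v0|/ltW v0] := leP 0 v; apply/andP; split.
- by apply: le_trans la _; rewrite ler_wpM2r.
- by apply: le_trans hb; rewrite ler_wpM2r.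
- by apply: le_trans lb _; rewrite ler_wnM2r.
- by apply: le_trans ha; rewrite ler_wnM2r.
Qed.

Lemma encl_inv X x : encl X x -> encl (inv_itv X) x^-1.
Proof.
have pos (a b : Z) y : (0 < a)%stdZ -> zR a <= y * S <= zR b ->
    zR (unit_scale * unit_scale / b)%stdZ <= y^-1 * S <=
    zR (unit_scale * unit_scale / a + 1)%stdZ.
  move=> a0 /andP[ay yb].
  have aR : 0 < zR a :> R by rewrite -zR0; apply: zR_lt.
  have yS : 0 < y * S by apply: lt_le_trans ay.
  have bR : 0 < zR b :> R by apply: lt_le_trans yb.
  have b0 : (0 < b)%stdZ.
    by rewrite Z.lt_nge => /(@zR_le R _ _); rewrite zR0 leNgt bR.
  have -> : y^-1 * S = S * S / (y * S).
    have y0 : y != 0 by apply: contraTneq yS => ->; rewrite mul0r ltxx.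
    move: S_gt0; move: S => s s0; field.
    by rewrite gt_eqF.
  rewrite ler_pdivlMr // ler_pdivrMr //; apply/andP; split.
    apply: (@le_trans _ _ (zR (unit_scale * unit_scale / b)%stdZ * zR b)).
      rewrite ler_wpM2l // -zR0; apply: zR_le; apply: Z.div_pos; have := unit_scale_gt0; nia.
    rewrite -!zRM; apply: zR_le.
    by have := Z.mul_div_le (unit_scale * unit_scale) b b0; lia.
  apply: (@le_trans _ _ (zR (unit_scale * unit_scale / a + 1)%stdZ * zR a)).
    rewrite -!zRM; apply: zR_le.
    have := Z.mul_succ_div_gt (unit_scale * unit_scale) a a0; lia.
  rewrite ler_wpM2l // -zR0; apply: zR_le.
  have : (0 <= unit_scale * unit_scale / a)%stdZ by apply: Z.div_pos; have := unit_scale_gt0; nia.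
  lia.
move: X => [[a b]|] //= ab; case: ifP => a0; first by apply: pos => //; lia.
case: ifP => // b0 /=.
have b0' : (0 < - b)%stdZ by lia.
have /(pos _ _ _ b0') : zR (- b)%stdZ <= (- x) * S <= zR (- a)%stdZ.
  by rewrite !zRN mulNr !lerN2 andbC.
by rewrite invrN mulNr !zRN lerNr lerNl andbC.
Qed.

Lemma encl_sqrt X x : encl X x -> encl (sqrt_itv X) (Num.sqrt x).
Proof.
move: X => [[a b]|] //= /andP[ax xb].
have S0 := S_gt0.
have sqS : (Num.sqrt x * S) ^+ 2 = Num.max 0 x * S * S.
  move: S => s; rewrite exprMn -mulrA -expr2; congr (_ * _).
  case: (leP 0 x) => x0; first by rewrite sqr_sqrtr.
  by rewrite ler0_sqrtr ?expr0n // ltW.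
have S0' := ltW S0.
have s0 : 0 <= Num.sqrt x * S by apply: mulr_ge0 S0'; exact: sqrtr_ge0.
have mx0 : 0 <= Num.max 0 x by rewrite le_max lexx.
have max_le (z : Z) : zR (Z.max 0 z) = Num.max 0 (zR z) := zR_max0 z.
have max_S : Num.max 0 x * S = Num.max 0 (x * S).
  by move: S S0' => s s_ge0; rewrite maxr_pMl // mul0r.
have sqrt0 (z : Z) : 0 <= zR (Z.sqrt z).
  by rewrite -zR0; apply: zR_le; exact: Z.sqrt_nonneg.
have z0 (z : Z) : (0 <= Z.max 0 z * unit_scale)%stdZ.
  by have := unit_scale_gt0; nia.
apply/andP; split.
  rewrite -(@ler_pXn2r _ 2 isT) ?nnegrE; [|exact: sqrt0|exact: s0].
  rewrite sqS expr2 -(zRM (Z.sqrt (Z.max 0 a * unit_scale)%stdZ)).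
  apply: (@le_trans _ _ (zR (Z.max 0 a * unit_scale)%stdZ)).
    by apply: zR_le; have := Z.sqrt_spec _ (z0 a); lia.
  rewrite zRM; apply: ler_wpM2r S0' _ _ _; rewrite max_S max_le ge_max !le_max lexx /= ax.
  by rewrite orbT.
have b1 : 0 <= zR (Z.sqrt (Z.max 0 b * unit_scale) + 1)%stdZ.
  rewrite -zR0; apply: zR_le; have := Z.sqrt_nonneg (Z.max 0 b * unit_scale); lia.
rewrite -(@ler_pXn2r _ 2 isT) ?nnegrE; [|exact: s0|exact: b1].
rewrite sqS expr2 -(zRM (Z.sqrt (Z.max 0 b * unit_scale) + 1)%stdZ).
apply: (@le_trans _ _ (zR (Z.max 0 b * unit_scale)%stdZ)); last first.
  by apply: zR_le; have := Z.sqrt_spec _ (z0 b); lia.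
rewrite zRM; apply: ler_wpM2r S0' _ _ _; rewrite max_S max_le ge_max !le_max lexx /= xb.
by rewrite orbT.
Qed.

End Intervals.

Arguments encl : simpl never.
Arguments cst_itv : simpl never.
Arguments add_itv : simpl never.
Arguments opp_itv : simpl never.
Arguments mul_itv : simpl never.
Arguments inv_itv : simpl never.
Arguments sqrt_itv : simpl never.

(** * Cosines and sines of the multiples of pi / 240 *)

Section Angles.
Context {R : realType}.

(* The antiprisms involve pi / 12, pi / 16 and pi / 20, hence 240. *)
Definition angle (j : nat) : R := j%:R * pi / 240.

Lemma angleD i j : angle (i + j) = angle i + angle j.
Proof. by rewrite /angle natrD !mulrDl. Qed.

Lemma angle_div n : (n %| 240)%N -> pi / n%:R = angle (240 %/ n).
Proof.
move=> n240; have n0 : n != 0%N by apply: contraTneq n240 => ->.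
have -> : pi / n%:R = (240 %/ n * n)%N%:R * pi / 240 / n%:R :> R.
  by rewrite divnK //; field; rewrite pnatr_eq0.
by rewrite /angle natrM; field; rewrite pnatr_eq0.
Qed.

Lemma angle_half j : angle j.*2 = angle j *+ 2.
Proof. by rewrite -addnn angleD mulr2n. Qed.

(** The triple angle formula and [cos pi = -1] give [(c + 1) * (2 * c - 1) ^+ 2 = 0], where
    [c > 0]. *)
Lemma cos_pi3 : cos (pi / 3) = 1 / 2 :> R.
Proof.
have pi0 := pi_gt0 R.
set c := cos _; have c0 : 0 < c.
  by apply: cos_gt0_pihalf; apply/andP; split; lra.
have : cos (pi / 3 *+ 2 + pi / 3) = cos pi :> R by congr cos; field.
rewrite cospi cosD sin_mulr2n cos_mulr2n -/c => e.
have s2 : sin (pi / 3) ^+ 2 = 1 - c ^+ 2 by rewrite sin2cos2.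
have : (c + 1) * (2 * c - 1) ^+ 2 = 0.
  have -> : (c + 1) * (2 * c - 1) ^+ 2 =
    (c ^+ 2 *+ 2 - 1) * c - (c * sin (pi / 3)) *+ 2 * sin (pi / 3) + 1
    + 2 * c * (sin (pi / 3) ^+ 2 - (1 - c ^+ 2)) by ring.
  by rewrite e s2; ring.
move/eqP; rewrite mulf_eq0 gt_eqF ?addr_gt0 //= sqrf_eq0 subr_eq0 => /eqP e2.
by lra.
Qed.

(** For [x = pi / 5], [cos (3 x) = - cos (2 x)] is a cubic equation in [c] with the root -1; the
    other factor is [(4 * c - 1) ^+ 2 - 5] up to a constant. The negative root is excluded because
    [c > 0] would make the square less than 1. *)
Lemma cos_pi5 : cos (pi / 5) = (1 + Num.sqrt 5) / 4 :> R.
Proof.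
have pi0 := pi_gt0 R.
set c := cos _; have c0 : 0 < c.
  by apply: cos_gt0_pihalf; apply/andP; split; lra.
have : cos (pi / 5 *+ 2 + pi / 5) = - cos (pi / 5 *+ 2) :> R.
  transitivity (cos (- (pi / 5 *+ 2) + pi : R)); first by congr cos; field.
  by rewrite cosDpi cosN.
rewrite cosD sin_mulr2n cos_mulr2n -/c => e.
have s2 : sin (pi / 5) ^+ 2 = 1 - c ^+ 2 by rewrite sin2cos2.
have : (c + 1) * ((4 * c - 1) ^+ 2 - 5) = 0.
  have -> : (c + 1) * ((4 * c - 1) ^+ 2 - 5) =
    4 * ((c ^+ 2 *+ 2 - 1) * c - (c * sin (pi / 5)) *+ 2 * sin (pi / 5)
         + (c ^+ 2 *+ 2 - 1)
         + 2 * c * (sin (pi / 5) ^+ 2 - (1 - c ^+ 2))) by ring.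
  by rewrite e s2; ring.
move/eqP; rewrite mulf_eq0 gt_eqF ?addr_gt0 //= subr_eq0 => /eqP e2.
have h4 : 0 <= 4 * c - 1.
  rewrite leNgt; apply/negP => h.
  have : (1 - 4 * c) ^+ 2 < 1 by rewrite expr_lt1 //; lra.
  by rewrite -sqrrN opprB e2; lra.
have : Num.sqrt 5 = 4 * c - 1 by rewrite -e2 sqrtr_sqr ger0_norm.
by move=> ->; field.
Qed.

Definition encl2 (P : itv * itv) (x : R) := encl P.1 (cos x) /\ encl P.2 (sin x).

End Angles.

Definition sub_itv X Y : itv := add_itv X (opp_itv Y).
Definition sqr_itv X : itv := mul_itv X X.

Definition add2_itv (P Q : itv * itv) : itv * itv :=
  (sub_itv (mul_itv P.1 Q.1) (mul_itv P.2 Q.2),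
   add_itv (mul_itv P.2 Q.1) (mul_itv P.1 Q.2)).

(** The sine comes from [sin (2 x) = 2 sin x cos x]; the root of [(1 - cos (2 x)) / 2] would lose
    precision by cancellation at small angles. *)
Definition halve2_itv (P : itv * itv) : itv * itv :=
  let c := sqrt_itv (mul_itv (add_itv (cst_itv 1) P.1) (inv_itv (cst_itv 2))) in
  (c, mul_itv P.2 (inv_itv (mul_itv (cst_itv 2) c))).

Definition pi3_itv : itv * itv :=
  (mul_itv (cst_itv 1) (inv_itv (cst_itv 2)),
   sqrt_itv (sub_itv (cst_itv 1) (sqr_itv (mul_itv (cst_itv 1) (inv_itv (cst_itv 2)))))).

Definition cos_pi5_itv : itv :=
  mul_itv (add_itv (cst_itv 1) (sqrt_itv (cst_itv 5))) (inv_itv (cst_itv 4)).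

Definition pi5_itv : itv * itv :=
  (cos_pi5_itv, sqrt_itv (sub_itv (cst_itv 1) (sqr_itv cos_pi5_itv))).

Definition neg2_itv (P : itv * itv) : itv * itv := (P.1, opp_itv P.2).

(* pi / 15 = 2 pi / 3 - 3 pi / 5 *)
Definition pi15_itv : itv * itv :=
  add2_itv (add2_itv pi3_itv pi3_itv)
    (neg2_itv (add2_itv pi5_itv (add2_itv pi5_itv pi5_itv))).

Definition pi240_itv : itv * itv :=
  halve2_itv (halve2_itv (halve2_itv (halve2_itv pi15_itv))).

Fixpoint rotations (n : nat) (P Q : itv * itv) : seq (itv * itv) :=
  if n is n'.+1 then P :: rotations n' (add2_itv P Q) Q else [::].

(** Stored in evaluated form. A full turn takes 480 entries, and the initial angles of the polygons
    lead beyond it. Past the end, the default [(None, None)] encloses everything. *)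
Definition angle_table : seq (itv * itv) :=
  Eval vm_compute in rotations 600 (cst_itv 1, cst_itv 0) pi240_itv.

Definition cos_itv (j : nat) : itv := (nth (None, None) angle_table j).1.
Definition sin_itv (j : nat) : itv := (nth (None, None) angle_table j).2.

Arguments sub_itv : simpl never.
Arguments sqr_itv : simpl never.

Lemma encl_sub (R : realType) X Y (x y : R) :
  encl X x -> encl Y y -> encl (sub_itv X Y) (x - y).
Proof. by move=> Xx Yy; apply: encl_add => //; exact: encl_opp. Qed.

Lemma encl_sqr (R : realType) X (x : R) : encl X x -> encl (sqr_itv X) (x ^+ 2).
Proof. by move=> Xx; exact: encl_mul. Qed.

Ltac encl_step := match goal with
  | H : encl ?X ?x |- encl ?X ?x => exact H
  | |- encl (add_itv _ _) _ => refine (encl_add _ _)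
  | |- encl (sub_itv _ _) _ => refine (encl_sub _ _)
  | |- encl (opp_itv _) _ => refine (encl_opp _)
  | |- encl (mul_itv _ _) _ => refine (encl_mul _ _)
  | |- encl (sqr_itv _) _ => refine (encl_sqr _)
  | |- encl (inv_itv _) _ => refine (encl_inv _)
  | |- encl (sqrt_itv _) _ => refine (encl_sqrt _)
  | |- encl (cst_itv ?z) _ => exact (encl_cst (Z.to_nat z))
  end.

Section AngleTable.
Context {R : realType}.

Lemma encl2_add P Q (x y : R) : encl2 P x -> encl2 Q y -> encl2 (add2_itv P Q) (x + y).
Proof.
move=> [Px1 Px2] [Qy1 Qy2]; split; rewrite /= ?cosD ?sinD; repeat encl_step.
Qed.

Lemma encl2_neg P (x : R) : encl2 P x -> encl2 (neg2_itv P) (- x).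
Proof. by move=> [Px1 Px2]; split; rewrite /= ?cosN ?sinN; repeat encl_step. Qed.

Lemma encl2_halve P (x : R) : 0 <= x < pi / 2 -> encl2 P (x *+ 2) ->
  encl2 (halve2_itv P) x.
Proof.
have pi0 := pi_gt0 R.
move=> /andP[x0 x1] [Px1 Px2].
have c0 : 0 < cos x by apply: cos_gt0_pihalf; apply/andP; split; lra.
have cE : cos x = Num.sqrt ((1 + cos (x *+ 2)) / 2).
  rewrite cos_mulr2n; have -> : (1 + (cos x ^+ 2 *+ 2 - 1)) / 2 = cos x ^+ 2 by field.
  by rewrite sqrtr_sqr gtr0_norm.
have enc : encl (halve2_itv P).1 (cos x).
  by rewrite cE /halve2_itv /=; repeat encl_step.
split => //; rewrite /halve2_itv /=.
have -> : sin x = sin (x *+ 2) * (2 * cos x)^-1.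
  by rewrite sin_mulr2n; field; rewrite gt_eqF.
by rewrite /halve2_itv /= in enc; repeat encl_step.
Qed.

Lemma encl2_pi3 : encl2 pi3_itv (pi / 3 : R).
Proof.
have pi0 := pi_gt0 R.
split; rewrite /pi3_itv /=; first by rewrite cos_pi3; repeat encl_step.
have -> : sin (pi / 3) = Num.sqrt (1 - (1 / 2) ^+ 2) :> R.
  rewrite -cos_pi3 -sin2cos2 sqrtr_sqr ger0_norm //.
  by apply: sin_ge0_pi; apply/andP; split; lra.
by repeat encl_step.
Qed.

Lemma encl2_pi5 : encl2 pi5_itv (pi / 5 : R).
Proof.
have pi0 := pi_gt0 R.
have c5 : encl cos_pi5_itv (cos (pi / 5) : R) by rewrite cos_pi5 /cos_pi5_itv; repeat encl_step.
split; rewrite /pi5_itv /=; first exact: c5.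
have -> : sin (pi / 5) = Num.sqrt (1 - cos (pi / 5) ^+ 2) :> R.
  rewrite -sin2cos2 sqrtr_sqr ger0_norm //.
  by apply: sin_ge0_pi; apply/andP; split; lra.
by repeat encl_step.
Qed.

Lemma encl2_pi240 : encl2 pi240_itv (angle 1 : R).
Proof.
have pi0 := pi_gt0 R.
have ltpi j : (j < 120)%N -> 0 <= (angle j : R) < pi / 2.
  move=> j120; have j0 : 0 <= j%:R :> R by [].
  have : j.+1%:R <= 120%:R :> R by rewrite ler_nat.
  by rewrite -natr1 /angle => h; apply/andP; split; nra.
have := encl2_add (encl2_add encl2_pi3 encl2_pi3)
  (encl2_neg (encl2_add encl2_pi5 (encl2_add encl2_pi5 encl2_pi5))).
rewrite (_ : _ + _ = angle 8 *+ 2); last by rewrite /angle; field.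
move=> h; apply: encl2_halve; first exact: ltpi.
rewrite -angle_half; apply: encl2_halve; first exact: ltpi.
rewrite -angle_half; apply: encl2_halve; first exact: ltpi.
by rewrite -angle_half; apply: encl2_halve; first exact: ltpi.
Qed.

Lemma encl2_rotations n P Q (x y : R) i : encl2 P x -> encl2 Q y -> (i < n)%N ->
  encl2 (nth (None, None) (rotations n P Q) i) (x + i%:R * y).
Proof.
move=> + Qy; elim: n P x i => [|n IH] P x [|i] Px //= ilt.
  by rewrite mul0r addr0.
by rewrite -natr1 mulrDl mul1r [_ + y]addrC addrA; apply: IH => //; exact: encl2_add.
Qed.

Lemma angle_tableE : angle_table = rotations 600 (cst_itv 1, cst_itv 0) pi240_itv.
Proof. by vm_compute. Qed.

Lemma encl_angle j : encl2 (nth (None, None) angle_table j) (angle j : R).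
Proof.
rewrite angle_tableE; have [jlt|jge] := ltnP j 600; last first.
  by rewrite nth_default // -angle_tableE.
have -> : angle j = 0 + j%:R * angle 1 :> R by rewrite add0r /angle; ring.
apply: encl2_rotations jlt; last exact: encl2_pi240.
by split; rewrite /= ?cos0 ?sin0; encl_step.
Qed.

Lemma encl_cos j : encl (cos_itv j) (cos (angle j) : R).
Proof. exact: (encl_angle j).1. Qed.

Lemma encl_sin j : encl (sin_itv j) (sin (angle j) : R).
Proof. exact: (encl_angle j).2. Qed.

End AngleTable.

Global Opaque add_itv opp_itv mul_itv inv_itv sqrt_itv cst_itv angle_table.

(** * Isolation of polynomial roots *)

Definition sure_lt (X Y : itv) : bool :=
  if X is Some (_, b) then if Y is Some (c, _) then (b <? c)%stdZ else false
  else false.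

Definition horner_itv (C : seq itv) (X : itv) : itv :=
  foldr (fun A acc => add_itv (mul_itv acc X) A) (cst_itv 0) C.

Definition itv_of (l h : Z) : itv := Some (l, h).

(** One Horner pass for the value at [m] and the divided difference: for [p = X q + a] one has
    [p[m, x] = x q[m, x] + q(m)]. *)
Definition slope_itv (C : seq itv) (M X : itv) : itv * itv :=
  foldr (fun A P => (add_itv (mul_itv P.1 M) A, add_itv (mul_itv P.2 X) P.1))
    (cst_itv 0, cst_itv 0) C.

(* [p(m) + p[m, x] (x - m)], where [p[m, x]] is the divided difference. *)
Definition centered_itv (C : seq itv) (l h : Z) : itv :=
  let m := Z.shiftr (l + h) 1 in
  let P := slope_itv C (itv_of m m) (itv_of l h) in
  add_itv P.1 (mul_itv P.2 (sub_itv (itv_of l h) (itv_of m m))).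

Definition nonzero_itv (X : itv) : bool :=
  if X is Some (a, b) then (0 <? a)%stdZ || (b <? 0)%stdZ else false.

(* Here [None] is the empty set. *)
Definition join_boxes (X Y : option (Z * Z)) : option (Z * Z) :=
  match X, Y with
  | Some (a, b), Some (c, d) => Some (Z.min a c, Z.max b d)
  | None, _ => Y
  | _, None => X
  end.

(* The convex hull of the boxes of width 2 ^ (- n) (h - l) that the centered
   form does not separate from the roots. *)
Fixpoint isolate (n : nat) (C : seq itv) (l h : Z) : itv :=
  if nonzero_itv (centered_itv C l h) then None
  else if n is n'.+1 then
    let m := Z.shiftr (l + h) 1 in
    join_boxes (isolate n' C l m) (isolate n' C m h)
  else Some (l, h).

Definition opposite_signs (X Y : itv) : bool :=
  sure_lt X (cst_itv 0) && sure_lt (cst_itv 0) Y ||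
  sure_lt Y (cst_itv 0) && sure_lt (cst_itv 0) X.

(** The change of sign guarantees a root, so that [root_between] is not the default 0 of [xget].
    Every root between the bounds is enclosed, in particular the one chosen. *)
Definition root_itv (n : nat) (C : seq itv) (A B : itv) : itv :=
  if opposite_signs (horner_itv C A) (horner_itv C B) && sure_lt A B then
    if A is Some (a, _) then if B is Some (_, b) then isolate n C a b else None
    else None
  else None.

Section Roots.
Context {R : realType}.
Implicit Types (x y : R) (c : seq R).

Fixpoint encls (C : seq itv) c : Prop :=
  match C, c with
  | [::], [::] => True
  | X :: C', x :: c' => encl X x /\ encls C' c'
  | _, _ => False
  end.

Lemma sure_ltP X Y x y : encl X x -> encl Y y -> sure_lt X Y -> x < y.
Proof.
move: X Y => [[a b]|] [[c d]|] //= /andP[_ xb] /andP[cy _] bc.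
rewrite -(ltr_pM2r (@S_gt0 R)); apply: le_lt_trans xb (lt_le_trans _ cy).
by apply: zR_lt; lia.
Qed.

Lemma encl_horner C X c x : encls C c -> encl X x ->
  encl (horner_itv C X) (Poly c).[x].
Proof.
rewrite horner_Poly => + Xx; elim: C c => [|A C IH] [|a c] //=.
  by move=> _; exact: (encl_cst 0).
by move=> [Aa Cc]; apply: encl_add => //; apply: encl_mul => //; exact: IH.
Qed.

Lemma encl_centered C c l h x : encls C c -> encl (itv_of l h) x ->
  encl (centered_itv C l h) (Poly c).[x].
Proof.
move=> Cc Xx; rewrite /centered_itv; cbv zeta; move: (Z.shiftr _ _) => m.
pose y := zR m / zR unit_scale : R.
have My : encl (itv_of m m) y by rewrite /encl /= divfK ?lexx // gt_eqF // S_gt0.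
suff [v [s [Vv Ss ->]]] : exists v s, [/\ encl (slope_itv C (itv_of m m) (itv_of l h)).1 v,
    encl (slope_itv C (itv_of m m) (itv_of l h)).2 s & (Poly c).[x] = v + s * (x - y)].
  by apply: encl_add => //; apply: encl_mul => //; apply: encl_sub.
rewrite horner_Poly; elim: C c Cc => [|A C IH] [|a c] //=.
  by move=> _; exists 0, 0; split; rewrite ?mul0r ?addr0 //; exact: (encl_cst 0).
move=> [Aa /IH[v [s [Vv Ss ->]]]]; exists (v * y + a), (s * x + v); split.
- by apply: encl_add => //; exact: encl_mul.
- by apply: encl_add => //; exact: encl_mul.
- by ring.
Qed.

Lemma nonzero_itvP X x : encl X x -> nonzero_itv X -> x != 0.
Proof.
move: X => [[a b]|] //= /andP[ax xb] /orP[h|h].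
  have : 0 < x * zR unit_scale.
    by apply: lt_le_trans ax; rewrite -zR0; apply: zR_lt; lia.
  by apply: contraTneq => ->; rewrite mul0r ltxx.
have : x * zR unit_scale < 0.
  by apply: (le_lt_trans xb); rewrite -zR0; apply: zR_lt; lia.
by apply: contraTneq => ->; rewrite mul0r ltxx.
Qed.

Lemma isolateP n C c l h x : encls C c -> root (Poly c) x -> encl (itv_of l h) x ->
  exists l' h', isolate n C l h = Some (l', h') /\ encl (itv_of l' h') x.
Proof.
move=> Cc rx; elim: n l h => [|n IH] l h lxh /=.
  case: ifP => [nz|_]; last by exists l, h.
  by move: (nonzero_itvP (encl_centered Cc lxh) nz); rewrite -/(root _ _) rx.
case: ifP => [nz|_].
  by move: (nonzero_itvP (encl_centered Cc lxh) nz); rewrite -/(root _ _) rx.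
set m := Z.shiftr _ _.
have [lx xh] := andP lxh.
have hull I0 J0 : (exists l' h', I0 = Some (l', h') /\ encl (itv_of l' h') x) ->
    exists l' h', join_boxes I0 J0 = Some (l', h') /\ encl (itv_of l' h') x.
  move=> [l1 [h1 [-> /andP[lx1 xh1]]]].
  case: J0 => [[a b]|]; last by exists l1, h1; split => //; apply/andP.
  exists (Z.min l1 a), (Z.max h1 b); split => //; apply/andP; split.
    by apply: le_trans lx1; apply: zR_le; lia.
  by apply: (le_trans xh1); apply: zR_le; lia.
case: (leP (x * zR unit_scale) (zR m)) => [xm|/ltW mx].
  by apply: hull; apply: IH; apply/andP.
have -> : join_boxes (isolate n C l m) (isolate n C m h) =
          join_boxes (isolate n C m h) (isolate n C l m).
  by case: (isolate n C l m) (isolate n C m h) => [[a b]|] [[a' b']|] //=;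
    rewrite Z.min_comm Z.max_comm.
by apply: hull; apply: IH; apply/andP.
Qed.

Lemma encl_root n C A B c (a b : R) : encls C c -> encl A a -> encl B b ->
  encl (root_itv n C A B) (root_between (Poly c) a b).
Proof.
move=> Cc Aa Bb; rewrite /root_itv; case: ifP => // /andP[sgn AB].
case: A B Aa Bb sgn AB => [[a0 a1]|] [[b0 b1]|] // Aa Bb sgn AB.
have ab := ltW (sure_ltP Aa Bb AB).
have ca := encl_horner Cc Aa; have cb := encl_horner Cc Bb.
have [r /andP[ar rb] rr] : exists2 r, a <= r <= b & root (Poly c) r.
  have c0 := @encl_cst R 0.
  case/orP: sgn => /andP[s1 s2].
    have h1 := sure_ltP ca c0 s1; have h2 := sure_ltP c0 cb s2.
    by apply: poly_ivt => //; rewrite (ltW h1) (ltW h2).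
  have h1 := sure_ltP cb c0 s1; have h2 := sure_ltP c0 ca s2.
  have [|r rab] := @poly_ivt R (- Poly c) a b ab.
    by rewrite !hornerN oppr_le0 oppr_ge0 (ltW h1) (ltW h2).
  by rewrite rootN => rr; exists r.
have : [set x | a <= x <= b /\ root (Poly c) x] (root_between (Poly c) a b).
  by apply: xgetPex; exists r; split => //; apply/andP.
move: (root_between _ _ _) => x [/andP[ax xb] rx].
case/andP: Aa => a0a _; case/andP: Bb => _ bb1.
have S0 := ltW (@S_gt0 R).
have [|l [h [-> //]]] := @isolateP n C c a0 b1 x Cc rx.
apply/andP; split; first by apply: (le_trans a0a); exact: ler_wpM2r.
by apply: le_trans bb1; exact: ler_wpM2r.
Qed.

End Roots.

(** * Enclosures of the Johnson solids *)

Definition pt_itv : Type := itv * itv * itv.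

Definition dot_itv (U P : pt_itv) : itv :=
  add_itv (add_itv (mul_itv U.1.1 P.1.1) (mul_itv U.1.2 P.1.2)) (mul_itv U.2 P.2).
Definition scale_itv (A : itv) (P : pt_itv) : pt_itv :=
  (mul_itv A P.1.1, mul_itv A P.1.2, mul_itv A P.2).
Definition addp_itv (P Q : pt_itv) : pt_itv :=
  (add_itv P.1.1 Q.1.1, add_itv P.1.2 Q.1.2, add_itv P.2 Q.2).
Definition oppp_itv (P : pt_itv) : pt_itv :=
  (opp_itv P.1.1, opp_itv P.1.2, opp_itv P.2).

Section Points.
Context {R : realType}.
Local Notation V := 'rV[R]_3.
Implicit Types (v u w : V) (P U : pt_itv) (L : seq pt_itv) (s : seq V).

Definition enclp P v :=
  [/\ encl P.1.1 (v 0 0), encl P.1.2 (v 0 1) & encl P.2 (v 0 2)].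

Fixpoint encl_pts L s : Prop :=
  match L, s with
  | [::], [::] => True
  | P :: L', v :: s' => enclp P v /\ encl_pts L' s'
  | _, _ => False
  end.

Lemma enclp_pt X Y Z (x y z : R) : encl X x -> encl Y y -> encl Z z ->
  enclp (X, Y, Z) (pt x y z).
Proof. by move=> Xx Yy Zz; split; rewrite mxE. Qed.

Lemma encl_pts_cat L L' s s' : encl_pts L s -> encl_pts L' s' ->
  encl_pts (L ++ L') (s ++ s').
Proof. by elim: L s => [|P L IH] [|v s] //= [Pv Ls] L's'; split => //; exact: IH. Qed.

Lemma encl_pts_map (T : eqType) (F : T -> pt_itv) (f : T -> V) (l : seq T) :
  (forall i, i \in l -> enclp (F i) (f i)) ->
  encl_pts [seq F i | i <- l] [seq f i | i <- l].
Proof.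
elim: l => //= a l IH h; split; first by apply: h; rewrite inE eqxx.
by apply: IH => i il; apply: h; rewrite inE il orbT.
Qed.

Lemma encl_pts_map2 (F : pt_itv -> pt_itv) (f : V -> V) L s :
  (forall P v, enclp P v -> enclp (F P) (f v)) -> encl_pts L s ->
  encl_pts (map F L) (map f s).
Proof. by move=> Ff; elim: L s => [|P L IH] [|v s] //= [/Ff ? /IH]. Qed.

Lemma encl_dot U P u v : enclp U u -> enclp P v -> encl (dot_itv U P) (dot u v).
Proof.
move=> [u0 u1 u2] [v0 v1 v2].
by rewrite dotE /dot_itv; repeat encl_step.
Qed.

Lemma encl_scale A P (a : R) v : encl A a -> enclp P v ->
  enclp (scale_itv A P) (a *: v).
Proof. by move=> Aa [v0 v1 v2]; split; rewrite /= mxE; encl_step. Qed.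

Lemma encl_addp P U v u : enclp P v -> enclp U u -> enclp (addp_itv P U) (v + u).
Proof. by move=> [v0 v1 v2] [u0 u1 u2]; split; rewrite /= mxE; encl_step. Qed.

Lemma encl_oppp P v : enclp P v -> enclp (oppp_itv P) (- v).
Proof. by move=> [v0 v1 v2]; split; rewrite /= mxE; encl_step. Qed.

End Points.

Arguments dot_itv : simpl never.

Definition polygon_itv (n : nat) (r : itv) (a : nat) (z : itv) : seq pt_itv :=
  [seq (mul_itv r (cos_itv (a + (2 * k + 1) * (240 %/ n))),
        mul_itv r (sin_itv (a + (2 * k + 1) * (240 %/ n))), z) | k <- iota 0 n].

Definition circumradius_itv (n : nat) : itv :=
  inv_itv (mul_itv (cst_itv 2) (sin_itv (240 %/ n))).

Definition apothem_itv (n : nat) : itv :=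
  mul_itv (circumradius_itv n) (cos_itv (240 %/ n)).

Definition ngon_itv (n a : nat) (z : itv) : seq pt_itv :=
  polygon_itv n (circumradius_itv n) a z.

Definition slant_itv (n : nat) : itv :=
  sqrt_itv (sub_itv (cst_itv 1) (sqr_itv (circumradius_itv n))).

Definition gold_itv : itv :=
  mul_itv (add_itv (cst_itv 1) (sqrt_itv (cst_itv 5))) (inv_itv (cst_itv 2)).

Definition prism_itv (n : nat) : seq pt_itv :=
  ngon_itv n 0 (cst_itv 0) ++ ngon_itv n 0 (opp_itv (cst_itv 1)).

Definition antiprism_height_itv (n : nat) : itv :=
  sqrt_itv (sub_itv (cst_itv 1)
    (inv_itv (sqr_itv (mul_itv (cst_itv 2) (cos_itv (240 %/ (2 * n))))))).

Definition antiprism_itv (n : nat) : seq pt_itv :=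
  ngon_itv n 0 (cst_itv 0) ++
  ngon_itv n (240 %/ n) (opp_itv (antiprism_height_itv n)).

Definition pyramid_cap_itv (n : nat) : seq pt_itv :=
  [:: (cst_itv 0, cst_itv 0, slant_itv n)].

Definition cupola_cap_itv (n a : nat) : seq pt_itv := ngon_itv n a (slant_itv n).

Definition rotunda_cap_itv (a : nat) : seq pt_itv :=
  polygon_itv 5 (mul_itv gold_itv (circumradius_itv 5)) (a + 48)
    (mul_itv gold_itv (slant_itv 5)) ++
  ngon_itv 5 a
    (sqrt_itv (sub_itv (sqr_itv gold_itv) (sqr_itv (circumradius_itv 5)))).

Definition below_itv (d : itv) (L : seq pt_itv) : seq pt_itv :=
  [seq (P.1.1, P.1.2, sub_itv (opp_itv d) P.2) | P : pt_itv <- L].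

Definition side_apex_itv (n k : nat) : pt_itv :=
  let r := add_itv (apothem_itv n) (slant_itv 4) in
  (mul_itv r (cos_itv (2 * k * (240 %/ n))), mul_itv r (sin_itv (2 * k * (240 %/ n))),
   opp_itv (inv_itv (cst_itv 2))).

Definition apex_itv (U : pt_itv) (c : itv) (n : nat) (e : itv) : pt_itv :=
  let uu := dot_itv U U in
  scale_itv (mul_itv (add_itv c (mul_itv (mul_itv (slant_itv n) e) (sqrt_itv uu)))
                     (inv_itv uu)) U.

Definition signs_itv (x y z : itv) : seq pt_itv :=
  let o := opp_itv in
  [:: (x, y, z); (x, y, o z); (x, o y, z); (x, o y, o z);
      (o x, y, z); (o x, y, o z); (o x, o y, z); (o x, o y, o z)].

Definition even_signs_itv (x y z : itv) : seq pt_itv :=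
  let o := opp_itv in
  [:: (x, y, z); (x, o y, o z); (o x, y, o z); (o x, o y, z)].

Definition cyclic_itv (x y z : itv) : seq pt_itv :=
  signs_itv x y z ++ signs_itv y z x ++ signs_itv z x y.

Definition signs_xy_itv (x y z : itv) : seq pt_itv :=
  let o := opp_itv in [:: (x, y, z); (x, o y, z); (o x, y, z); (o x, o y, z)].

Definition signs_x_itv (x z : itv) : seq pt_itv :=
  [:: (x, cst_itv 0, z); (opp_itv x, cst_itv 0, z)].

Definition signs_y_itv (y z : itv) : seq pt_itv :=
  [:: (cst_itv 0, y, z); (cst_itv 0, opp_itv y, z)].

Definition cyclic0_itv (y z : itv) : seq pt_itv :=
  let o := opp_itv in let c := cst_itv 0 in
  [:: (c, y, z); (c, y, o z); (c, o y, z); (c, o y, o z);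
      (y, z, c); (y, o z, c); (o y, z, c); (o y, o z, c);
      (z, c, y); (z, c, o y); (o z, c, y); (o z, c, o y)].

Ltac eq_mem_cases := rewrite ?oppr0 !(mem_cat, inE) -?orbA;
  repeat (case: (_ == _); rewrite ?orbT ?orbF //=).

Section Blocks.
Context {R : realType}.
Local Notation V := 'rV[R]_3.

(* The lists of Defs with a coordinate 0, without the repetitions. *)
Definition signs_x (x z : R) : seq V := [:: pt x 0 z; pt (- x) 0 z].
Definition signs_y (y z : R) : seq V := [:: pt 0 y z; pt 0 (- y) z].
Definition cyclic0 (y z : R) : seq V :=
  [:: pt 0 y z; pt 0 y (- z); pt 0 (- y) z; pt 0 (- y) (- z);
      pt y z 0; pt y (- z) 0; pt (- y) z 0; pt (- y) (- z) 0;
      pt z 0 y; pt z 0 (- y); pt (- z) 0 y; pt (- z) 0 (- y)].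

Lemma signs_xy0y (y z : R) : signs_xy 0 y z =i signs_y y z.
Proof. by move=> v; rewrite /signs_xy /signs_y; eq_mem_cases. Qed.

Lemma signs_xyx0 (x z : R) : signs_xy x 0 z =i signs_x x z.
Proof. by move=> v; rewrite /signs_xy /signs_x; eq_mem_cases. Qed.

Lemma cyclic0P (y z : R) : cyclic 0 y z =i cyclic0 y z.
Proof. by move=> v; rewrite /cyclic /signs /cyclic0; eq_mem_cases. Qed.

Lemma cyclic_rot (x y z : R) : cyclic x y z =i cyclic y z x.
Proof. by move=> v; rewrite /cyclic !mem_cat orbC -orbA. Qed.

Lemma encl_polygon n r a z (rr al zz : R) : (n %| 240)%N -> encl r rr ->
  al = angle a -> encl z zz -> encl_pts (polygon_itv n r a z) (polygon n rr al zz).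
Proof.
move=> n240 Er -> Ez; apply: encl_pts_map => k _.
have -> : angle a + (2 * k + 1)%:R * pi / n%:R =
          angle (a + (2 * k + 1) * (240 %/ n)) :> R.
  by rewrite angleD -mulrA angle_div // /angle natrM !mulrA.
by apply: enclp_pt => //; encl_step => //; [exact: encl_cos|exact: encl_sin].
Qed.

Lemma encl_circumradius n : (n %| 240)%N ->
  encl (circumradius_itv n) (circumradius n : R).
Proof.
move=> n240; rewrite /circumradius /circumradius_itv angle_div //.
by have := @encl_sin R (240 %/ n) => h; repeat encl_step.
Qed.

Lemma encl_apothem n : (n %| 240)%N -> encl (apothem_itv n) (apothem n : R).
Proof.
move=> n240; rewrite /apothem /apothem_itv angle_div //.
have h := @encl_cos R (240 %/ n); have := encl_circumradius n240 => h'.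
by repeat encl_step.
Qed.

Lemma encl_ngon n a z (al zz : R) : (n %| 240)%N ->
  al = angle a -> encl z zz -> encl_pts (ngon_itv n a z) (ngon n al zz).
Proof. by move=> n240 E Ez; apply: encl_polygon => //; exact: encl_circumradius. Qed.

Lemma encl_slant n : (n %| 240)%N -> encl (slant_itv n) (slant n : R).
Proof.
move=> /encl_circumradius h; rewrite /slant /slant_itv; repeat encl_step.
Qed.

Lemma encl_gold : encl gold_itv (gold : R).
Proof. by rewrite /gold_itv /gold; repeat encl_step. Qed.

Global Opaque gold_itv circumradius_itv apothem_itv.

Lemma angle0 : 0 = angle 0 :> R. Proof. by rewrite /angle !mul0r. Qed.

Lemma encl_prism n : (n %| 240)%N -> encl_pts (prism_itv n) (prism n : seq V).
Proof.
by move=> n240; apply: encl_pts_cat; apply: encl_ngon;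
  rewrite -?angle0 //; repeat encl_step.
Qed.

Lemma encl_antiprism_height n : (2 * n %| 240)%N ->
  encl (antiprism_height_itv n) (antiprism_height n : R).
Proof.
move=> n240; rewrite /antiprism_height /antiprism_height_itv angle_div //.
by have h := @encl_cos R (240 %/ (2 * n)); repeat encl_step.
Qed.

Global Opaque slant_itv antiprism_height_itv.

Lemma encl_antiprism n : (2 * n %| 240)%N ->
  encl_pts (antiprism_itv n) (antiprism n : seq V).
Proof.
move=> n2; have n240 : (n %| 240)%N by apply: dvdn_trans n2; exact: dvdn_mull.
apply: encl_pts_cat; apply: encl_ngon; rewrite -?angle0 ?angle_div //.
  by encl_step.
by have h := encl_antiprism_height n2; encl_step.
Qed.

Lemma encl_pyramid_cap n : (n %| 240)%N ->
  encl_pts (pyramid_cap_itv n) (pyramid_cap n : seq V).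
Proof.
by move=> n240; split => //; apply: enclp_pt; rewrite -?/(slant_itv n);
  [encl_step|encl_step|exact: encl_slant].
Qed.

Lemma encl_cupola_cap n a (al : R) : (n %| 240)%N -> al = angle a ->
  encl_pts (cupola_cap_itv n a) (cupola_cap n al).
Proof. by move=> n240 E; apply: encl_ngon => //; exact: encl_slant. Qed.

Lemma encl_rotunda_cap a (al : R) : al = angle a ->
  encl_pts (rotunda_cap_itv a) (rotunda_cap al).
Proof.
move=> E; have g := encl_gold.
have h5 := @encl_circumradius 5 isT; have s5 := @encl_slant 5 isT.
have d5 : (5 %| 240)%N by [].
rewrite /rotunda_cap_itv /rotunda_cap.
refine (encl_pts_cat (encl_polygon d5 _ _ _) (encl_ngon d5 E _)).
- by repeat encl_step.
- by rewrite angleD E (@angle_div R 5).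
- by repeat encl_step.
- by repeat encl_step.
Qed.

Global Opaque polygon_itv.

Lemma encl_below D L (d : R) s : encl D d -> encl_pts L s ->
  encl_pts (below_itv D L) (below d s).
Proof.
move=> Dd; apply: encl_pts_map2 => P v [v0 v1 v2].
by apply: enclp_pt => //; repeat encl_step.
Qed.

Lemma encl_side_apex n k : (n %| 240)%N ->
  enclp (side_apex_itv n k) (side_apex n k : V).
Proof.
move=> n240; rewrite /side_apex /side_apex_itv.
have -> : 2 * k%:R * pi / n%:R = angle (2 * k * (240 %/ n)) :> R.
  by rewrite -mulrA angle_div // /angle !natrM !mulrA.
have h1 := encl_apothem n240; have h2 := @encl_slant 4 isT.
have h3 := @encl_cos R (2 * k * (240 %/ n)); have h4 := @encl_sin R (2 * k * (240 %/ n)).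
by apply: enclp_pt; repeat encl_step.
Qed.

Lemma encl_apex U C n E (u : V) (c e : R) : (n %| 240)%N -> enclp U u -> encl C c ->
  encl E e -> enclp (apex_itv U C n E) (apex u c n e).
Proof.
move=> n240 Uu Cc Ee; rewrite /apex /apex_itv.
have h1 := encl_slant n240; have h2 := encl_dot Uu Uu.
by apply: encl_scale => //; repeat encl_step.
Qed.

Ltac pts := repeat match goal with
  | |- encl_pts (_ :: _) _ => split
  | |- encl_pts [::] _ => exact I
  | |- enclp (_, _) _ => refine (enclp_pt _ _ _)
  | |- encl _ _ => encl_step
  end.

Lemma encl_signs X Y Z (x y z : R) : encl X x -> encl Y y -> encl Z z ->
  encl_pts (signs_itv X Y Z) (signs x y z).
Proof. by move=> Xx Yy Zz; rewrite /signs_itv /signs; pts. Qed.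

Lemma encl_even_signs X Y Z (x y z : R) : encl X x -> encl Y y -> encl Z z ->
  encl_pts (even_signs_itv X Y Z) (even_signs x y z).
Proof. by move=> Xx Yy Zz; rewrite /even_signs_itv /even_signs; pts. Qed.

Lemma encl_cyclic X Y Z (x y z : R) : encl X x -> encl Y y -> encl Z z ->
  encl_pts (cyclic_itv X Y Z) (cyclic x y z).
Proof.
by move=> Xx Yy Zz; apply: encl_pts_cat; [|apply: encl_pts_cat]; exact: encl_signs.
Qed.

Lemma encl_signs_xy X Y Z (x y z : R) : encl X x -> encl Y y -> encl Z z ->
  encl_pts (signs_xy_itv X Y Z) (signs_xy x y z).
Proof. by move=> Xx Yy Zz; rewrite /signs_xy_itv /signs_xy; pts. Qed.

Lemma encl_signs_x X Z (x z : R) : encl X x -> encl Z z ->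
  encl_pts (signs_x_itv X Z) (signs_x x z).
Proof. by move=> Xx Zz; rewrite /signs_x_itv /signs_x; pts. Qed.

Lemma encl_signs_y Y Z (y z : R) : encl Y y -> encl Z z ->
  encl_pts (signs_y_itv Y Z) (signs_y y z).
Proof. by move=> Yy Zz; rewrite /signs_y_itv /signs_y; pts. Qed.

Lemma encl_cyclic0 Y Z (y z : R) : encl Y y -> encl Z z ->
  encl_pts (cyclic0_itv Y Z) (cyclic0 y z).
Proof. by move=> Yy Zz; rewrite /cyclic0_itv /cyclic0; pts. Qed.

End Blocks.

(** The result of an undecided comparison: it encloses every point, and [bounded_pt] rejects it in
    the final check. *)
Definition top_pt : pt_itv := (None, None, None).

Definition ax1_itv : pt_itv := (cst_itv 1, cst_itv 0, gold_itv).
Definition ax2_itv : pt_itv := (cst_itv 1, cst_itv 0, opp_itv gold_itv).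
Definition ax3_itv : pt_itv := (opp_itv gold_itv, cst_itv 1, cst_itv 0).

Definition dodecahedron_itv : seq pt_itv :=
  signs_itv (cst_itv 1) (cst_itv 1) (cst_itv 1) ++
  cyclic0_itv (inv_itv gold_itv) gold_itv.

Definition truncated_tetrahedron_itv : seq pt_itv :=
  even_signs_itv (cst_itv 3) (cst_itv 1) (cst_itv 1) ++
  even_signs_itv (cst_itv 1) (cst_itv 3) (cst_itv 1) ++
  even_signs_itv (cst_itv 1) (cst_itv 1) (cst_itv 3).

Definition sqrt2_itv : itv := sqrt_itv (cst_itv 2).

Definition truncated_cube_itv : seq pt_itv :=
  cyclic_itv (cst_itv 1) (add_itv (cst_itv 1) sqrt2_itv) (add_itv (cst_itv 1) sqrt2_itv).

Definition truncated_dodecahedron_itv : seq pt_itv :=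
  cyclic0_itv (inv_itv gold_itv) (add_itv (cst_itv 2) gold_itv) ++
  cyclic_itv (inv_itv gold_itv) gold_itv (mul_itv (cst_itv 2) gold_itv) ++
  cyclic_itv gold_itv (cst_itv 2) (add_itv gold_itv (cst_itv 1)).

Definition cube_itv (X : itv) : itv := mul_itv X (sqr_itv X).

Definition rhombicosidodecahedron_itv : seq pt_itv :=
  cyclic_itv (cst_itv 1) (cst_itv 1) (cube_itv gold_itv) ++
  cyclic_itv (sqr_itv gold_itv) gold_itv (mul_itv (cst_itv 2) gold_itv) ++
  cyclic0_itv (sqr_itv gold_itv) (add_itv (cst_itv 2) gold_itv).

Definition dodecahedron_apex_itv (U : pt_itv) : pt_itv :=
  apex_itv U (sqr_itv gold_itv) 5 (mul_itv (cst_itv 2) (inv_itv gold_itv)).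

Definition decagon_cap_itv : seq pt_itv :=
  let g := gold_itv in let o := opp_itv in let i := cst_itv 1 in let z := cst_itv 0 in
  [seq addp_itv (scale_itv (mul_itv (sub_itv (mul_itv (cst_itv 5) g) (cst_itv 2))
                                    (inv_itv (add_itv g (cst_itv 2)))) ax1_itv)
                (scale_itv (inv_itv g) W)
  | W <- [:: (o i, z, g); (g, i, z); (g, o i, z); (z, g, i); (z, o g, i)]].

Definition decagon_cap_opp_itv : seq pt_itv := map oppp_itv decagon_cap_itv.
Definition decagon_cap2_itv : seq pt_itv :=
  [seq (P.1.1, P.1.2, opp_itv P.2) | P : pt_itv <- decagon_cap_itv].

Definition in_cap_bound : itv := add_itv (mul_itv (cst_itv 3) gold_itv) (cst_itv 2).

Definition diminish_itv (U : pt_itv) (L : seq pt_itv) : seq pt_itv :=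
  [seq P <- L | ~~ sure_lt in_cap_bound (dot_itv U P)].

(** Filtering keeps the list of intervals aligned with that of points only if every comparison is
    decided. Gyration preserves the length and can resort to [top_pt]. *)
Definition in_cap_decided (U : pt_itv) (L : seq pt_itv) : bool :=
  all (fun P => sure_lt in_cap_bound (dot_itv U P) ||
                sure_lt (dot_itv U P) in_cap_bound) L.

Definition gyrate_itv (U : pt_itv) (L : seq pt_itv) : seq pt_itv :=
  [seq let d := dot_itv U P in
       if sure_lt in_cap_bound d then
         addp_itv (scale_itv (mul_itv (mul_itv (cst_itv 2) d) (inv_itv (dot_itv U U))) U)
                  (oppp_itv P)
       else if sure_lt d in_cap_bound then P else top_pt | P <- L].

Arguments sure_lt : simpl never.

Section Polyhedra.
Context {R : realType}.
Local Notation V := 'rV[R]_3.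

Definition dodecahedron_vertices : seq V := signs 1 1 1 ++ cyclic0 gold^-1 gold.

Definition truncated_dodecahedron_vertices : seq V :=
  cyclic0 gold^-1 (2 + gold) ++ cyclic gold^-1 gold (2 * gold) ++
  cyclic gold 2 (gold + 1).

Definition rhombicosidodecahedron_vertices : seq V :=
  cyclic 1 1 (gold ^+ 3) ++ cyclic (gold ^+ 2) gold (2 * gold) ++
  cyclic0 (gold ^+ 2) (2 + gold).

Lemma cat_eq_mem (s s' t t' : seq V) : s =i s' -> t =i t' -> s ++ t =i s' ++ t'.
Proof. by move=> ss tt v; rewrite !mem_cat ss tt. Qed.

Lemma dodecahedronP : dodecahedron =i dodecahedron_vertices.
Proof. by apply: cat_eq_mem => //; exact: cyclic0P. Qed.

Lemma truncated_dodecahedronP :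
  truncated_dodecahedron =i truncated_dodecahedron_vertices.
Proof. by apply: cat_eq_mem => //; exact: cyclic0P. Qed.

Lemma rhombicosidodecahedronP :
  rhombicosidodecahedron =i rhombicosidodecahedron_vertices.
Proof.
apply: cat_eq_mem => //; apply: cat_eq_mem => // v.
by rewrite cyclic_rot cyclic0P.
Qed.

Lemma gyrate_eq_mem (u : V) (s t : seq V) : s =i t -> gyrate u s =i gyrate u t.
Proof. by move=> st; exact: eq_mem_map. Qed.

Lemma diminish_eq_mem (u : V) (s t : seq V) : s =i t -> diminish u s =i diminish u t.
Proof. by move=> st v; rewrite !mem_filter st. Qed.

Lemma remove_eq_mem (u : V) (s t : seq V) : s =i t -> remove u s =i remove u t.
Proof. by move=> st v; rewrite !mem_filter st. Qed.

(** [remove] tests equality of real points, which intervals cannot decide. The remaining vertices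
    are therefore written out, and the equality is derived from [gold_gt1]. *)
Definition icosahedron2 : seq V :=
  [:: pt 0 gold 1; pt 0 gold (- 1); pt 0 (- gold) 1; pt 0 (- gold) (- 1);
      pt gold 1 0; pt gold (- 1) 0; pt (- gold) 1 0; pt (- gold) (- 1) 0;
      pt (- 1) 0 gold; pt (- 1) 0 (- gold)].

Definition icosahedron3 : seq V :=
  [:: pt 0 gold 1; pt 0 gold (- 1); pt 0 (- gold) 1; pt 0 (- gold) (- 1);
      pt gold 1 0; pt gold (- 1) 0; pt (- gold) (- 1) 0;
      pt (- 1) 0 gold; pt (- 1) 0 (- gold)].

Lemma pt_eqE (x y z x' y' z' : R) :
  (pt x y z == pt x' y' z') = [&& x == x', y == y' & z == z'].
Proof.
apply/eqP/and3P => [e|[/eqP -> /eqP -> /eqP ->] //].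
by split; apply/eqP; [have := congr1 (fun v : V => v 0 0) e|
  have := congr1 (fun v : V => v 0 1) e|have := congr1 (fun v : V => v 0 2) e];
  rewrite !mxE.
Qed.

Lemma gold_gt1 : 1 < gold :> R.
Proof.
have : 1 < Num.sqrt 5 :> R.
  by rewrite -[ltLHS]sqrtr1 ltr_sqrt // ltr1n.
by rewrite /gold; lra.
Qed.

Lemma removal_step (x y z x' y' z' : R) s t :
  [|| x != x', y != y' | z != z'] ->
  remove (pt x' y' z') s = t ->
  remove (pt x' y' z') (pt x y z :: s) = pt x y z :: t.
Proof. by move=> ne <-; rewrite /remove /= pt_eqE !negb_and ne. Qed.

Lemma removal_here (u : V) s t : remove u s = t -> remove u (u :: s) = t.
Proof. by move=> <-; rewrite /remove /= eqxx. Qed.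

Lemma icosahedronP : icosahedron =i (cyclic0 gold 1 : seq V).
Proof. by move=> v; rewrite cyclic_rot cyclic0P. Qed.

Definition icosahedron1 : seq V :=
  [:: pt 0 gold 1; pt 0 gold (- 1); pt 0 (- gold) 1; pt 0 (- gold) (- 1);
      pt gold 1 0; pt gold (- 1) 0; pt (- gold) 1 0; pt (- gold) (- 1) 0;
      pt 1 0 gold; pt (- 1) 0 gold; pt (- 1) 0 (- gold)].

Lemma distinct_coordinates : ((0 == 1 :> R) = false) * ((gold == 1 :> R) = false) *
    ((- gold == 1 :> R) = false) * ((-1 == 1 :> R) = false) *
    ((gold == - gold :> R) = false) * ((- gold == gold :> R) = false) *
    ((0 == - gold :> R) = false) * ((1 == - gold :> R) = false) *
    ((-1 == - gold :> R) = false).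
Proof. by have g1 := gold_gt1; do 8?split; apply/eqP; lra. Qed.

Ltac removal := repeat match goal with
  | |- remove _ [::] = _ => reflexivity
  | |- remove _ (_ :: _) = _ => first
      [ refine (removal_step _ _); [by rewrite ?distinct_coordinates ?orbT|]
      | refine (removal_here _) ]
  end.

Lemma remove_ax2 : remove ax2 (cyclic0 gold 1) = icosahedron1.
Proof.
by rewrite /ax2 /cyclic0 /icosahedron1; removal.
Qed.

Lemma icosahedron2P : remove ax1 (remove ax2 icosahedron) =i icosahedron2.
Proof.
have -> : icosahedron2 = remove ax1 icosahedron1.
  apply/esym; rewrite /ax1 /icosahedron1 /icosahedron2.
  by removal.
by apply: remove_eq_mem => v; rewrite (remove_eq_mem _ icosahedronP) remove_ax2.
Qed.

Lemma remove_comm (u w : V) s : remove u (remove w s) = remove w (remove u s).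
Proof. by rewrite /remove -!filter_predI; apply: eq_filter => v /=; exact: andbC. Qed.

Lemma icosahedron3P : remove ax1 (remove ax2 (remove ax3 icosahedron)) =i icosahedron3.
Proof.
have -> : icosahedron3 = remove ax3 icosahedron2.
  apply/esym; rewrite /ax3 /icosahedron2 /icosahedron3.
  by removal.
by rewrite [remove ax2 _]remove_comm remove_comm; apply: remove_eq_mem; exact: icosahedron2P.
Qed.

Lemma encl_ax1 : enclp ax1_itv (ax1 : V).
Proof. by have g := @encl_gold R; apply: enclp_pt; repeat encl_step. Qed.
Lemma encl_ax2 : enclp ax2_itv (ax2 : V).
Proof. by have g := @encl_gold R; apply: enclp_pt; repeat encl_step. Qed.
Lemma encl_ax3 : enclp ax3_itv (ax3 : V).
Proof. by have g := @encl_gold R; apply: enclp_pt; repeat encl_step. Qed.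

Lemma encl_dodecahedron : encl_pts dodecahedron_itv dodecahedron_vertices.
Proof.
have g := @encl_gold R.
by refine (encl_pts_cat (encl_signs _ _ _) (encl_cyclic0 _ _)); repeat encl_step.
Qed.

Lemma encl_truncated_tetrahedron :
  encl_pts truncated_tetrahedron_itv (truncated_tetrahedron : seq V).
Proof.
by refine (encl_pts_cat (encl_even_signs _ _ _)
  (encl_pts_cat (encl_even_signs _ _ _) (encl_even_signs _ _ _))); encl_step.
Qed.

Lemma encl_truncated_cube : encl_pts truncated_cube_itv (truncated_cube : seq V).
Proof.
have s : encl sqrt2_itv (Num.sqrt 2 : R) by rewrite /sqrt2_itv; repeat encl_step.
by refine (encl_cyclic _ _ _); repeat encl_step.
Qed.

Lemma encl_truncated_dodecahedron :
  encl_pts truncated_dodecahedron_itv truncated_dodecahedron_vertices.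
Proof.
have g := @encl_gold R.
by refine (encl_pts_cat (encl_cyclic0 _ _)
  (encl_pts_cat (encl_cyclic _ _ _) (encl_cyclic _ _ _))); repeat encl_step.
Qed.

Lemma encl_rhombicosidodecahedron :
  encl_pts rhombicosidodecahedron_itv rhombicosidodecahedron_vertices.
Proof.
have g := @encl_gold R.
have g3 : encl (cube_itv gold_itv) (gold ^+ 3 : R).
  by rewrite exprS /cube_itv; repeat encl_step.
by refine (encl_pts_cat (encl_cyclic _ _ _)
  (encl_pts_cat (encl_cyclic _ _ _) (encl_cyclic0 _ _))); repeat encl_step.
Qed.

Lemma encl_dodecahedron_apex U (u : V) : enclp U u ->
  enclp (dodecahedron_apex_itv U) (dodecahedron_apex u).
Proof.
have g := @encl_gold R; have d5 : (5 %| 240)%N by [].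
by move=> Uu; refine (encl_apex d5 Uu _ _); repeat encl_step.
Qed.

Lemma encl_decagon_cap : encl_pts decagon_cap_itv (decagon_cap : seq V).
Proof.
have g := @encl_gold R; have a1 := encl_ax1.
apply: encl_pts_map2 => [P v Pv|].
  by refine (encl_addp (encl_scale _ a1) (encl_scale _ Pv)); repeat encl_step.
by do 5?[split; first by apply: enclp_pt; repeat encl_step].
Qed.

Lemma encl_decagon_cap_opp : encl_pts decagon_cap_opp_itv (decagon_cap_opp : seq V).
Proof.
by apply: encl_pts_map2 encl_decagon_cap => P v; exact: encl_oppp.
Qed.

Lemma encl_decagon_cap2 : encl_pts decagon_cap2_itv (decagon_cap2 : seq V).
Proof.
apply: encl_pts_map2 encl_decagon_cap => P v [v0 v1 v2].
by apply: enclp_pt => //; encl_step.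
Qed.

Lemma encl_in_cap_bound : encl in_cap_bound (3 * gold + 2 : R).
Proof. by have g := @encl_gold R; rewrite /in_cap_bound; repeat encl_step. Qed.


Lemma encl_diminish U L (u : V) s : in_cap_decided U L -> enclp U u ->
  encl_pts L s -> encl_pts (diminish_itv U L) (diminish u s).
Proof.
rewrite /in_cap_decided /diminish_itv.
move: in_cap_bound encl_in_cap_bound => B c + Uu.
elim: L s => [|P L IH] [|v s] //= /andP[dP dL] [Pv Ls].
have d := encl_dot Uu Pv; rewrite /diminish /= /in_cap.
case: ifP => [h|/negbFE h].
  have {dP} hv : sure_lt (dot_itv U P) B by move: dP; rewrite (negbTE h).
  have lt := sure_ltP d c hv; rewrite ltNge (ltW lt) /=.
  by split => //; exact: IH.
by rewrite (sure_ltP c d h) /=; exact: IH.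
Qed.

Lemma encl_gyrate U L (u : V) s : enclp U u ->
  encl_pts L s -> encl_pts (gyrate_itv U L) (gyrate u s).
Proof.
rewrite /gyrate_itv; move: in_cap_bound encl_in_cap_bound => B c.
move=> Uu; apply: encl_pts_map2 => P v Pv.
have d := encl_dot Uu Pv; have uu := encl_dot Uu Uu.
rewrite /in_cap; case: ifP => h.
  rewrite (sure_ltP c d h); apply: encl_addp; last exact: encl_oppp.
  by apply: encl_scale => //; repeat encl_step.
case: ifP => h'; last by [].
by have lt := sure_ltP d c h'; rewrite ltNge (ltW lt).
Qed.

End Polyhedra.

Definition zpoly_itv (c : seq Z) : seq itv := map cst_itv c.

Definition half_itv : itv := mul_itv (cst_itv 1) (inv_itv (cst_itv 2)).

(** The boxes left after 30 bisections have width 2 ^ (- 30), far below the unit 2 ^ (- 12) to which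
    the certificate rounds. *)
Definition snub_disphenoid_itv : seq pt_itv :=
  let o := opp_itv in let i := cst_itv 1 in let z := cst_itv 0 in
  let q := root_itv 30 [:: o i; cst_itv 4; cst_itv 11; cst_itv 2] z i in
  let r := sqrt_itv q in
  let s := sqrt_itv (mul_itv (sub_itv i q) (inv_itv (mul_itv (cst_itv 2) q))) in
  let t := sqrt_itv (sub_itv (cst_itv 2) (mul_itv (cst_itv 2) q)) in
  [:: (t, r, z); (o t, r, z); (z, o r, t); (z, o r, o t);
      (i, o s, z); (o i, o s, z); (z, s, i); (z, s, o i)].

Definition snub_square_antiprism_itv : seq pt_itv :=
  let s2 := sqrt_itv (cst_itv 2) in let s3 := sqrt_itv (cst_itv 3) in
  let k := root_itv 30
    [:: sub_itv (mul_itv (cst_itv 7) (sqrt_itv (cst_itv 6))) (mul_itv (cst_itv 17) s3);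
        mul_itv (opp_itv (cst_itv 3)) (sub_itv (cst_itv 5) (mul_itv (cst_itv 2) s2));
        mul_itv (mul_itv (cst_itv 3) s3) (sub_itv (cst_itv 5) s2);
        cst_itv 9] (cst_itv 0) (cst_itv 1) in
  let d := sqrt_itv (sub_itv (cst_itv 3) (mul_itv (cst_itv 3) (sqr_itv k))) in
  let h := mul_itv
    (sub_itv (add_itv (add_itv s2 (cst_itv 8)) (mul_itv (mul_itv (cst_itv 2) s3) k))
             (mul_itv (mul_itv (cst_itv 3) (add_itv (cst_itv 2) s2)) (sqr_itv k)))
    (inv_itv (mul_itv (cst_itv 4) d)) in
  let r := add_itv (cst_itv 1) (mul_itv s3 k) in
  polygon_itv 4 s2 0 h ++ polygon_itv 4 r 60 (sub_itv h d) ++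
  polygon_itv 4 s2 60 (opp_itv h) ++ polygon_itv 4 r 0 (sub_itv d h).

Definition sphenocorona_k_itv : itv :=
  mul_itv (add_itv (add_itv (cst_itv 6) (sqrt_itv (cst_itv 6)))
     (mul_itv (cst_itv 2)
        (sqrt_itv (sub_itv (cst_itv 213) (mul_itv (cst_itv 57) (sqrt_itv (cst_itv 6)))))))
   (inv_itv (cst_itv 30)).

Definition spheno_s_itv (k : itv) : itv := sqrt_itv (sub_itv (cst_itv 1) (sqr_itv k)).

Definition spheno_itv (k : itv) : seq pt_itv :=
  let s := spheno_s_itv k in
  let w := sqrt_itv (sub_itv (cst_itv 3) (mul_itv (cst_itv 4) (sqr_itv k))) in
  let s2 := inv_itv (mul_itv (cst_itv 2) s) in
  signs_y_itv half_itv s ++ signs_xy_itv k half_itv (cst_itv 0) ++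
  signs_y_itv (add_itv half_itv (mul_itv w s2))
    (mul_itv (sub_itv (cst_itv 1) (mul_itv (cst_itv 2) (sqr_itv k))) s2) ++
  signs_x_itv half_itv (opp_itv (sqrt_itv (sub_itv (add_itv half_itv k) (sqr_itv k)))).

Definition sphenocorona_itv : seq pt_itv := spheno_itv sphenocorona_k_itv.

Definition sphenocorona_apex_itv : pt_itv :=
  let k := sphenocorona_k_itv in let s := spheno_s_itv k in
  let h := inv_itv (cst_itv 2) in
  (add_itv (mul_itv k h) (mul_itv (slant_itv 4) s), cst_itv 0,
   add_itv (mul_itv s h) (mul_itv (slant_itv 4) k)).

Definition sphenomegacorona_coefs : seq Z :=
  [:: -23; -56; 200; 304; -776; 240; 2000; -5584; -3384; 17248;
      2464; -24576; 1568; 17216; -3712; -4800; 1680]%stdZ.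

Definition quotient_itv (a b : Z) : itv := mul_itv (cst_itv a) (inv_itv (cst_itv b)).

Definition sphenomegacorona_itv : seq pt_itv :=
  let k := root_itv 22 (zpoly_itv sphenomegacorona_coefs)
    (quotient_itv 1 2) (quotient_itv 3 5) in
  let s := spheno_s_itv k in
  let w := sqrt_itv (sub_itv (cst_itv 3) (mul_itv (cst_itv 4) (sqr_itv k))) in
  let s3 := inv_itv (mul_itv (cst_itv 2) (cube_itv s)) in
  spheno_itv k ++
  signs_y_itv
    (add_itv half_itv
       (mul_itv (mul_itv w (sub_itv (cst_itv 1) (mul_itv (cst_itv 2) (sqr_itv k)))) s3))
    (mul_itv (sub_itv (mul_itv (cst_itv 2) (mul_itv k (cube_itv k))) (cst_itv 1)) s3).

Definition hebesphenomegacorona_coefs : seq Z :=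
  [:: -47; 494; -1119; -1808; 2128; 13696; 6112; -39680; -25600;
      35328; 26880]%stdZ.

Definition hebesphenomegacorona_itv : seq pt_itv :=
  let i := cst_itv 1 in let two := cst_itv 2 in let four := cst_itv 4 in
  let h := half_itv in let z := cst_itv 0 in
  let k := root_itv 22 (zpoly_itv hebesphenomegacorona_coefs)
    (quotient_itv 1 5) (quotient_itv 1 4) in
  let s := spheno_s_itv k in
  let w := sqrt_itv (sub_itv (mul_itv (cst_itv 3) (inv_itv four)) (sqr_itv k)) in
  let m := sqrt_itv (mul_itv (sub_itv two (mul_itv four k)) (inv_itv (add_itv i k))) in
  let q := inv_itv (mul_itv four (sub_itv i k)) in
  signs_xy_itv h h s ++ signs_xy_itv (add_itv h k) h z ++
  signs_x_itv h (opp_itv w) ++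
  signs_y_itv
    (add_itv h (mul_itv (sqrt_itv (mul_itv (sub_itv two (mul_itv four k))
                                           (inv_itv (sub_itv i k)))) (inv_itv two)))
    (sub_itv s (mul_itv (add_itv i k) (inv_itv (mul_itv two s)))) ++
  signs_y_itv (mul_itv (add_itv i (mul_itv (mul_itv two m) w)) q)
    (mul_itv (sub_itv (mul_itv (sub_itv (mul_itv four k) two) w) m) q).

Definition disphenocingulum_coefs : seq Z :=
  [:: -23; -24; 672; -944; -2024; 4352; 1248; -6592; 1552; 3712;
      -1664; -512; 256]%stdZ.

Definition disphenocingulum_itv : seq pt_itv :=
  let i := cst_itv 1 in let two := cst_itv 2 in let h := half_itv in
  let k := root_itv 19 (zpoly_itv disphenocingulum_coefs)
    (quotient_itv 3 4) (quotient_itv 4 5) in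
  let s := spheno_s_itv k in
  let g := mul_itv (sqrt_itv (sub_itv i (mul_itv two (sqr_itv (sub_itv k h)))))
                   (inv_itv two) in
  let s2 := inv_itv (mul_itv two s) in
  let top :=
    signs_x_itv h (add_itv g s) ++ signs_xy_itv h k g ++
    signs_x_itv
      (add_itv h
        (mul_itv (sqrt_itv (sub_itv (cst_itv 3) (mul_itv (cst_itv 4) (sqr_itv k)))) s2))
      (add_itv g (mul_itv (sub_itv i (mul_itv two (sqr_itv k))) s2)) in
  top ++ [seq (P.1.2, opp_itv P.1.1, opp_itv P.2) | P : pt_itv <- top].

Definition bilunabirotunda_itv : seq pt_itv :=
  let i := cst_itv 1 in let z := cst_itv 0 in let g := gold_itv in
  let o := opp_itv in let g2 := sqr_itv g in
  signs_itv g i i ++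
  [:: (i, z, g2); (i, z, o g2); (o i, z, g2); (o i, z, o g2)] ++
  [:: (z, g, z); (z, o g, z)].

Definition triangular_hebesphenorotunda_itv : seq pt_itv :=
  let c := inv_itv (sqrt_itv (cst_itv 3)) in
  let g := gold_itv in let g2 := sqr_itv g in let g3 := cube_itv g in
  let o := opp_itv in let i := cst_itv 1 in let two := cst_itv 2 in
  let z := cst_itv 0 in
  let z1 := mul_itv two c in let z2 := mul_itv (mul_itv two g) c in
  let z3 := mul_itv (mul_itv two g2) c in
  polygon_itv 6 two 40 z ++
  [:: (z, mul_itv (mul_itv (o two) g2) c, z1);
      (g2, mul_itv g2 c, z1); (o g2, mul_itv g2 c, z1);
      (g, mul_itv (o (add_itv g two)) c, z2); (o g, mul_itv (o (add_itv g two)) c, z2);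
      (g2, mul_itv (o (inv_itv g)) c, z2); (o g2, mul_itv (o (inv_itv g)) c, z2);
      (i, mul_itv g3 c, z2); (o i, mul_itv g3 c, z2);
      (z, mul_itv two c, z3); (i, o c, z3); (o i, o c, z3)].

Section Special.
Context {R : realType}.
Local Notation V := 'rV[R]_3.

(** Only membership is kept, so that [t] can omit repetitions: the test of exposedness compares
    entries by their index and could not separate a repeated vertex from its copy. *)
Definition enclosed (L : seq pt_itv) (s : seq V) : Prop :=
  exists2 t, s =i t & encl_pts L t.

Lemma enclosed_pts L s : encl_pts L s -> enclosed L s.
Proof. by exists s. Qed.

Lemma enclosed_cat L L' s s' : enclosed L s -> enclosed L' s' ->
  enclosed (L ++ L') (s ++ s').
Proof.
move=> [t st Lt] [t' st' Lt']; exists (t ++ t'); last exact: encl_pts_cat.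
exact: cat_eq_mem.
Qed.

Lemma enclosed_map F (f : V -> V) L s :
  (forall P v, enclp P v -> enclp (F P) (f v)) -> enclosed L s ->
  enclosed (map F L) (map f s).
Proof.
move=> Ff [t st Lt]; exists (map f t); first exact: eq_mem_map.
exact: encl_pts_map2.
Qed.

Lemma enclosed_gyrate U L (u : V) s : enclp U u -> enclosed L s ->
  enclosed (gyrate_itv U L) (gyrate u s).
Proof.
move=> Uu [t st Lt]; exists (gyrate u t); first exact: gyrate_eq_mem.
exact: encl_gyrate.
Qed.

Lemma enclosed_diminish U L (u : V) s : in_cap_decided U L -> enclp U u ->
  enclosed L s -> enclosed (diminish_itv U L) (diminish u s).
Proof.
move=> dec Uu [t st Lt]; exists (diminish u t); first exact: diminish_eq_mem.
exact: encl_diminish.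
Qed.

Lemma enclosed_signs_x X Z (x z : R) : encl X x -> encl Z z ->
  enclosed (signs_x_itv X Z) (signs_xy x 0 z).
Proof.
by move=> Xx Zz; exists (signs_x x z); [exact: signs_xyx0|exact: encl_signs_x].
Qed.

Lemma enclosed_signs_y Y Z (y z : R) : encl Y y -> encl Z z ->
  enclosed (signs_y_itv Y Z) (signs_xy 0 y z).
Proof.
by move=> Yy Zz; exists (signs_y y z); [exact: signs_xy0y|exact: encl_signs_y].
Qed.

Lemma enclosed_signs_xy X Y Z (x y z : R) : encl X x -> encl Y y -> encl Z z ->
  enclosed (signs_xy_itv X Y Z) (signs_xy x y z).
Proof. by move=> Xx Yy Zz; apply: enclosed_pts; exact: encl_signs_xy. Qed.

Lemma encl_zroot n c A B (a b : R) : encl A a -> encl B b ->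
  encl (root_itv n (zpoly_itv c) A B) (root_between (zpoly c) a b).
Proof.
apply: encl_root; elim: c => //= z c IH; split => //.
have := @encl_cstZ R z; congr encl.
case: z => [|p|p]; first exact: zR0.
  by rewrite -zR_nat positive_nat_Z.
by rewrite -zR_nat positive_nat_Z -zRN.
Qed.

Lemma encl_cube X (x : R) : encl X x -> encl (cube_itv X) (x ^+ 3).
Proof. by move=> Xx; rewrite exprS /cube_itv; repeat encl_step. Qed.

Lemma encl_fourth X (x : R) : encl X x -> encl (mul_itv X (cube_itv X)) (x ^+ 4).
Proof. by move=> Xx; rewrite exprS; encl_step; last exact: encl_cube. Qed.

End Special.

Ltac pts := repeat match goal with
  | |- encl_pts (_ :: _) _ => split
  | |- encl_pts [::] _ => exact I
  | |- enclp (_, _) _ => refine (enclp_pt _ _ _)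
  | |- enclosed (_ ++ _) _ => refine (enclosed_cat _ _)
  | |- enclosed (signs_x_itv _ _) _ => refine (enclosed_signs_x _ _)
  | |- enclosed (signs_y_itv _ _) _ => refine (enclosed_signs_y _ _)
  | |- enclosed (signs_xy_itv _ _ _) _ => refine (enclosed_signs_xy _ _ _)
  | |- encl (cube_itv _) _ => refine (encl_cube _)
  | |- encl (mul_itv ?X (cube_itv ?X)) _ => refine (encl_fourth _)
  | |- encl _ _ => encl_step
  end.

Section SpecialSolids.
Context {R : realType}.
Local Notation V := 'rV[R]_3.

Lemma enclosed_snub_disphenoid : enclosed snub_disphenoid_itv (snub_disphenoid : seq V).
Proof.
apply: enclosed_pts; rewrite /snub_disphenoid_itv /snub_disphenoid; cbv zeta.
have := @encl_root R 30 [:: opp_itv (cst_itv 1); cst_itv 4; cst_itv 11; cst_itv 2]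
  (cst_itv 0) (cst_itv 1) [:: -1; 4; 11; 2] 0 1.
move: (root_itv _ _ _ _) (root_between _ _ _) => Q q Qq.
have {}Qq : encl Q q by apply: Qq; do ?split; repeat encl_step.
by pts.
Qed.

Lemma enclosed_snub_square_antiprism :
  enclosed snub_square_antiprism_itv (snub_square_antiprism : seq V).
Proof.
apply: enclosed_pts; rewrite /snub_square_antiprism_itv /snub_square_antiprism.
cbv zeta; set C := [:: _; _; _; _] : seq itv; set c := [:: _; _; _; _] : seq R.
have := @encl_root R 30 C (cst_itv 0) (cst_itv 1) c 0 1.
move: (root_itv _ _ _ _) (root_between _ _ _) => K k Kk.
have {}Kk : encl K k by apply: Kk; rewrite /C /c; do ?split; repeat encl_step.
have d4 : (4 %| 240)%N by [].
refine (encl_pts_cat (encl_polygon d4 _ _ _) (encl_pts_cat (encl_polygon d4 _ _ _)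
  (encl_pts_cat (encl_polygon d4 _ _ _) (encl_polygon d4 _ _ _)))).
all: try exact: angle0.
all: try exact: (@angle_div R 4 isT).
all: by repeat encl_step.
Qed.

(** The part common to the sphenocorona and the sphenomegacorona, which differ in [k] and in two
    more vertices. *)
Definition spheno (k : R) : seq V :=
  let s := Num.sqrt (1 - k ^+ 2) in
  signs_xy 0 (1 / 2) s ++ signs_xy k (1 / 2) 0 ++
  signs_xy 0 (1 / 2 + Num.sqrt (3 - 4 * k ^+ 2) / (2 * s))
             ((1 - 2 * k ^+ 2) / (2 * s)) ++
  signs_xy (1 / 2) 0 (- Num.sqrt (1 / 2 + k - k ^+ 2)).

Lemma enclosed_spheno K (k : R) : encl K k -> enclosed (spheno_itv K) (spheno k).
Proof.
by move=> Kk; rewrite /spheno_itv /spheno /half_itv /spheno_s_itv; cbv zeta; pts.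
Qed.

Lemma encl_sphenocorona_k : encl sphenocorona_k_itv (sphenocorona_k : R).
Proof. by rewrite /sphenocorona_k_itv /sphenocorona_k; pts. Qed.

Lemma enclosed_sphenocorona : enclosed sphenocorona_itv (sphenocorona : seq V).
Proof. exact: (enclosed_spheno encl_sphenocorona_k). Qed.

Lemma encl_sphenocorona_apex : enclp sphenocorona_apex_itv (sphenocorona_apex : V).
Proof.
have k := encl_sphenocorona_k; have s := @encl_slant R 4 isT.
rewrite /sphenocorona_apex_itv /sphenocorona_apex /spheno_s_itv; cbv zeta.
by pts.
Qed.

Lemma encl_quotient a b : encl (quotient_itv (Z.of_nat a) (Z.of_nat b)) (a%:R / b%:R : R).
Proof. by apply: encl_mul; [|apply: encl_inv]; exact: encl_cst. Qed.

Lemma enclosed_sphenomegacorona :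
  enclosed sphenomegacorona_itv (sphenomegacorona : seq V).
Proof.
rewrite /sphenomegacorona_itv /sphenomegacorona -/sphenomegacorona_coefs.
have := encl_zroot 22 sphenomegacorona_coefs (encl_quotient 1 2) (encl_quotient 3 5).
move: (root_itv _ _ _ _) (root_between _ _ _) => K k Kk; cbv zeta.
set E := signs_xy 0 (_ + _ / (2 * _ ^+ 3)) _.
rewrite (_ : _ ++ _ = spheno k ++ E); last by rewrite /spheno -!catA.
refine (enclosed_cat (enclosed_spheno Kk) _).
by rewrite /E /half_itv /spheno_s_itv; pts.
Qed.

Lemma enclosed_hebesphenomegacorona :
  enclosed hebesphenomegacorona_itv (hebesphenomegacorona : seq V).
Proof.
rewrite /hebesphenomegacorona_itv /hebesphenomegacorona -/hebesphenomegacorona_coefs.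
have := encl_zroot 22 hebesphenomegacorona_coefs (encl_quotient 1 5) (encl_quotient 1 4).
move: (root_itv _ _ _ _) (root_between _ _ _) => K k Kk.
by rewrite /half_itv /spheno_s_itv; cbv zeta; pts.
Qed.

Lemma enclosed_disphenocingulum :
  enclosed disphenocingulum_itv (disphenocingulum : seq V).
Proof.
rewrite /disphenocingulum_itv /disphenocingulum -/disphenocingulum_coefs.
have := encl_zroot 19 disphenocingulum_coefs (encl_quotient 3 4) (encl_quotient 4 5).
move: (root_itv _ _ _ _) (root_between _ _ _) => K k Kk.
rewrite /half_itv /spheno_s_itv; cbv zeta.
refine (enclosed_cat _ (enclosed_map _ _)).
- by pts.
- by move=> P v [v0 v1 v2]; pts.
- by pts.
Qed.

Lemma enclosed_bilunabirotunda : enclosed bilunabirotunda_itv (bilunabirotunda : seq V).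
Proof.
have g := @encl_gold R.
refine (enclosed_cat (enclosed_pts (encl_signs _ _ _)) (enclosed_cat _ _)).
- by encl_step.
- by encl_step.
- by encl_step.
- exists [:: pt 1 0 (gold ^+ 2); pt 1 0 (- gold ^+ 2); pt (-1) 0 (gold ^+ 2);
             pt (-1) 0 (- gold ^+ 2)]; last by pts.
  by move=> v; rewrite /signs; eq_mem_cases.
- exists [:: pt 0 gold 0; pt 0 (- gold) 0]; last by pts.
  by move=> v; rewrite /signs; eq_mem_cases.
Qed.

Lemma enclosed_triangular_hebesphenorotunda :
  enclosed triangular_hebesphenorotunda_itv (triangular_hebesphenorotunda : seq V).
Proof.
have g := @encl_gold R; have d6 : (6 %| 240)%N by [].
apply: enclosed_pts; refine (encl_pts_cat (encl_polygon d6 _ _ _) _).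
- by encl_step.
- exact: (@angle_div R 6 isT).
- by encl_step.
- by pts.
Qed.

End SpecialSolids.

Definition icosahedron3_itv : seq pt_itv :=
  let i := cst_itv 1 in let z := cst_itv 0 in let g := gold_itv in
  let o := opp_itv in
  [:: (z, g, i); (z, g, o i); (z, o g, i); (z, o g, o i); (g, i, z); (g, o i, z);
      (o g, o i, z); (o i, z, g); (o i, z, o g)].

Definition icosahedron2_itv : seq pt_itv :=
  let i := cst_itv 1 in let z := cst_itv 0 in let g := gold_itv in
  let o := opp_itv in
  [:: (z, g, i); (z, g, o i); (z, o g, i); (z, o g, o i); (g, i, z); (g, o i, z);
      (o g, i, z); (o g, o i, z); (o i, z, g); (o i, z, o g)].

Definition johnson_itv (k : nat) : seq pt_itv :=
  match k with
  | 1%N => ngon_itv 4 0 (cst_itv 0) ++ pyramid_cap_itv 4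
  | 2%N => ngon_itv 5 0 (cst_itv 0) ++ pyramid_cap_itv 5
  | 3%N => ngon_itv 6 0 (cst_itv 0) ++ cupola_cap_itv 3 0
  | 4%N => ngon_itv 8 0 (cst_itv 0) ++ cupola_cap_itv 4 0
  | 5%N => ngon_itv 10 0 (cst_itv 0) ++ cupola_cap_itv 5 0
  | 6%N => ngon_itv 10 0 (cst_itv 0) ++ rotunda_cap_itv 0
  | 7%N => prism_itv 3 ++ pyramid_cap_itv 3
  | 8%N => prism_itv 4 ++ pyramid_cap_itv 4
  | 9%N => prism_itv 5 ++ pyramid_cap_itv 5
  | 10%N => antiprism_itv 4 ++ pyramid_cap_itv 4
  | 11%N => antiprism_itv 5 ++ pyramid_cap_itv 5
  | 12%N => ngon_itv 3 0 (cst_itv 0) ++ pyramid_cap_itv 3 ++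
      below_itv (cst_itv 0) (pyramid_cap_itv 3)
  | 13%N => ngon_itv 5 0 (cst_itv 0) ++ pyramid_cap_itv 5 ++
      below_itv (cst_itv 0) (pyramid_cap_itv 5)
  | 14%N => prism_itv 3 ++ pyramid_cap_itv 3 ++
      below_itv (cst_itv 1) (pyramid_cap_itv 3)
  | 15%N => prism_itv 4 ++ pyramid_cap_itv 4 ++
      below_itv (cst_itv 1) (pyramid_cap_itv 4)
  | 16%N => prism_itv 5 ++ pyramid_cap_itv 5 ++
      below_itv (cst_itv 1) (pyramid_cap_itv 5)
  | 17%N => antiprism_itv 4 ++ pyramid_cap_itv 4 ++
      below_itv (antiprism_height_itv 4) (pyramid_cap_itv 4)
  | 18%N => prism_itv 6 ++ cupola_cap_itv 3 0
  | 19%N => prism_itv 8 ++ cupola_cap_itv 4 0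
  | 20%N => prism_itv 10 ++ cupola_cap_itv 5 0
  | 21%N => prism_itv 10 ++ rotunda_cap_itv 0
  | 22%N => antiprism_itv 6 ++ cupola_cap_itv 3 0
  | 23%N => antiprism_itv 8 ++ cupola_cap_itv 4 0
  | 24%N => antiprism_itv 10 ++ cupola_cap_itv 5 0
  | 26%N => ngon_itv 4 0 (cst_itv 0) ++
      let h := half_itv in
      let r := mul_itv (sqrt_itv (cst_itv 3)) (inv_itv (cst_itv 2)) in
      [:: (h, cst_itv 0, r); (opp_itv h, cst_itv 0, r);
          (cst_itv 0, h, opp_itv r); (cst_itv 0, opp_itv h, opp_itv r)]
  | 27%N => ngon_itv 6 0 (cst_itv 0) ++ cupola_cap_itv 3 0 ++
      below_itv (cst_itv 0) (cupola_cap_itv 3 0)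
  | 28%N => ngon_itv 8 0 (cst_itv 0) ++ cupola_cap_itv 4 0 ++
      below_itv (cst_itv 0) (cupola_cap_itv 4 0)
  | 29%N => ngon_itv 8 0 (cst_itv 0) ++ cupola_cap_itv 4 0 ++
      below_itv (cst_itv 0) (cupola_cap_itv 4 60)
  | 30%N => ngon_itv 10 0 (cst_itv 0) ++ cupola_cap_itv 5 0 ++
      below_itv (cst_itv 0) (cupola_cap_itv 5 0)
  | 31%N => ngon_itv 10 0 (cst_itv 0) ++ cupola_cap_itv 5 0 ++
      below_itv (cst_itv 0) (cupola_cap_itv 5 48)
  | 32%N => ngon_itv 10 0 (cst_itv 0) ++ cupola_cap_itv 5 0 ++
      below_itv (cst_itv 0) (rotunda_cap_itv 0)
  | 33%N => ngon_itv 10 0 (cst_itv 0) ++ cupola_cap_itv 5 0 ++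
      below_itv (cst_itv 0) (rotunda_cap_itv 48)
  | 34%N => ngon_itv 10 0 (cst_itv 0) ++ rotunda_cap_itv 0 ++
      below_itv (cst_itv 0) (rotunda_cap_itv 0)
  | 35%N => prism_itv 6 ++ cupola_cap_itv 3 0 ++
      below_itv (cst_itv 1) (cupola_cap_itv 3 0)
  | 36%N => prism_itv 6 ++ cupola_cap_itv 3 0 ++
      below_itv (cst_itv 1) (cupola_cap_itv 3 80)
  | 37%N => prism_itv 8 ++ cupola_cap_itv 4 0 ++
      below_itv (cst_itv 1) (cupola_cap_itv 4 60)
  | 38%N => prism_itv 10 ++ cupola_cap_itv 5 0 ++
      below_itv (cst_itv 1) (cupola_cap_itv 5 0)
  | 39%N => prism_itv 10 ++ cupola_cap_itv 5 0 ++
      below_itv (cst_itv 1) (cupola_cap_itv 5 48)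
  | 40%N => prism_itv 10 ++ cupola_cap_itv 5 0 ++
      below_itv (cst_itv 1) (rotunda_cap_itv 0)
  | 41%N => prism_itv 10 ++ cupola_cap_itv 5 0 ++
      below_itv (cst_itv 1) (rotunda_cap_itv 48)
  | 42%N => prism_itv 10 ++ rotunda_cap_itv 0 ++
      below_itv (cst_itv 1) (rotunda_cap_itv 0)
  | 43%N => prism_itv 10 ++ rotunda_cap_itv 0 ++
      below_itv (cst_itv 1) (rotunda_cap_itv 48)
  | 44%N => antiprism_itv 6 ++ cupola_cap_itv 3 0 ++
      below_itv (antiprism_height_itv 6) (cupola_cap_itv 3 40)
  | 46%N => antiprism_itv 10 ++ cupola_cap_itv 5 0 ++
      below_itv (antiprism_height_itv 10) (cupola_cap_itv 5 24)
  | 48%N => antiprism_itv 10 ++ rotunda_cap_itv 0 ++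
      below_itv (antiprism_height_itv 10) (rotunda_cap_itv 24)
  | 49%N => prism_itv 3 ++ [:: side_apex_itv 3 0]
  | 50%N => prism_itv 3 ++ [:: side_apex_itv 3 0; side_apex_itv 3 1]
  | 51%N => prism_itv 3 ++
      [:: side_apex_itv 3 0; side_apex_itv 3 1; side_apex_itv 3 2]
  | 52%N => prism_itv 5 ++ [:: side_apex_itv 5 0]
  | 53%N => prism_itv 5 ++ [:: side_apex_itv 5 0; side_apex_itv 5 2]
  | 54%N => prism_itv 6 ++ [:: side_apex_itv 6 0]
  | 55%N => prism_itv 6 ++ [:: side_apex_itv 6 0; side_apex_itv 6 3]
  | 56%N => prism_itv 6 ++ [:: side_apex_itv 6 0; side_apex_itv 6 2]
  | 57%N => prism_itv 6 ++
      [:: side_apex_itv 6 0; side_apex_itv 6 2; side_apex_itv 6 4]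
  | 58%N => dodecahedron_itv ++ [:: dodecahedron_apex_itv ax1_itv]
  | 59%N => dodecahedron_itv ++
      [:: dodecahedron_apex_itv ax1_itv; dodecahedron_apex_itv (oppp_itv ax1_itv)]
  | 60%N => dodecahedron_itv ++
      [:: dodecahedron_apex_itv ax1_itv; dodecahedron_apex_itv ax2_itv]
  | 61%N => dodecahedron_itv ++
      [:: dodecahedron_apex_itv ax1_itv; dodecahedron_apex_itv ax2_itv;
          dodecahedron_apex_itv ax3_itv]
  | 62%N => icosahedron2_itv
  | 63%N => icosahedron3_itv
  | 64%N => icosahedron3_itv ++
      [:: apex_itv (cst_itv 1, sqr_itv gold_itv, cst_itv 0) (cube_itv gold_itv) 3 (cst_itv 2)]
  | 65%N => truncated_tetrahedron_itv ++
      let a := opp_itv (quotient_itv 11 3) in let b := opp_itv (quotient_itv 5 3) in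
      [:: (a, b, b); (b, a, b); (b, b, a)]
  | 66%N => truncated_cube_itv ++
      polygon_itv 4 sqrt2_itv 60 (add_itv (cst_itv 1) (mul_itv (cst_itv 2) sqrt2_itv))
  | 67%N => truncated_cube_itv ++
      polygon_itv 4 sqrt2_itv 60 (add_itv (cst_itv 1) (mul_itv (cst_itv 2) sqrt2_itv)) ++
      polygon_itv 4 sqrt2_itv 60 (opp_itv (add_itv (cst_itv 1) (mul_itv (cst_itv 2) sqrt2_itv)))
  | 68%N => truncated_dodecahedron_itv ++ decagon_cap_itv
  | 69%N => truncated_dodecahedron_itv ++ decagon_cap_itv ++ decagon_cap_opp_itv
  | 70%N => truncated_dodecahedron_itv ++ decagon_cap_itv ++ decagon_cap2_itv
  | 78%N => gyrate_itv ax2_itv (diminish_itv ax1_itv rhombicosidodecahedron_itv)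
  | 79%N =>
      gyrate_itv ax3_itv (gyrate_itv ax2_itv (diminish_itv ax1_itv rhombicosidodecahedron_itv))
  | 80%N => diminish_itv ax1_itv (diminish_itv (oppp_itv ax1_itv) rhombicosidodecahedron_itv)
  | 81%N => diminish_itv ax1_itv (diminish_itv ax2_itv rhombicosidodecahedron_itv)
  | 82%N =>
      gyrate_itv ax3_itv (diminish_itv ax1_itv (diminish_itv ax2_itv rhombicosidodecahedron_itv))
  | 83%N =>
      diminish_itv ax1_itv (diminish_itv ax2_itv (diminish_itv ax3_itv rhombicosidodecahedron_itv))
  | 84%N => snub_disphenoid_itv
  | 85%N => snub_square_antiprism_itv
  | 86%N => sphenocorona_itv
  | 87%N => sphenocorona_itv ++ [:: sphenocorona_apex_itv]
  | 88%N => sphenomegacorona_itv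
  | 89%N => hebesphenomegacorona_itv
  | 90%N => disphenocingulum_itv
  | 91%N => bilunabirotunda_itv
  | 92%N => triangular_hebesphenorotunda_itv
  | _ => [::]
  end.

Section Johnson.
Context {R : realType}.
Local Notation V := 'rV[R]_3.

Lemma enclosed_icosahedron2 :
  enclosed icosahedron2_itv (remove ax1 (remove ax2 icosahedron) : seq V).
Proof.
have g := @encl_gold R.
exists icosahedron2; first exact: icosahedron2P.
by rewrite /icosahedron2_itv /icosahedron2; cbv zeta; pts.
Qed.

Lemma enclosed_icosahedron3 :
  enclosed icosahedron3_itv (remove ax1 (remove ax2 (remove ax3 icosahedron)) : seq V).
Proof.
have g := @encl_gold R.
exists icosahedron3; first exact: icosahedron3P.
by rewrite /icosahedron3_itv /icosahedron3; cbv zeta; pts.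
Qed.

Lemma enclosed_dodecahedron : enclosed dodecahedron_itv (dodecahedron : seq V).
Proof. by exists dodecahedron_vertices; [exact: dodecahedronP|exact: encl_dodecahedron]. Qed.

Lemma enclosed_truncated_dodecahedron :
  enclosed truncated_dodecahedron_itv (truncated_dodecahedron : seq V).
Proof.
exists truncated_dodecahedron_vertices; first exact: truncated_dodecahedronP.
exact: encl_truncated_dodecahedron.
Qed.

Lemma enclosed_rhombicosidodecahedron :
  enclosed rhombicosidodecahedron_itv (rhombicosidodecahedron : seq V).
Proof.
exists rhombicosidodecahedron_vertices; first exact: rhombicosidodecahedronP.
exact: encl_rhombicosidodecahedron.
Qed.

Lemma encl_sqrt2 : encl sqrt2_itv (Num.sqrt 2 : R).
Proof. by rewrite /sqrt2_itv; pts. Qed.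

End Johnson.

Ltac angles := match goal with
  | |- 0 = angle _ => exact: angle0
  | |- _ = angle 80 => exact: (@angle_div _ 3 isT)
  | |- _ = angle 60 => exact: (@angle_div _ 4 isT)
  | |- _ = angle 48 => exact: (@angle_div _ 5 isT)
  | |- _ = angle 40 => exact: (@angle_div _ 6 isT)
  | |- _ = angle 24 => exact: (@angle_div _ 10 isT)
  end.

Ltac encl_johnson := repeat match goal with
  | |- enclosed (_ ++ _) _ => refine (enclosed_cat _ _)
  | |- enclosed dodecahedron_itv _ => exact enclosed_dodecahedron
  | |- enclosed truncated_dodecahedron_itv _ => exact enclosed_truncated_dodecahedron
  | |- enclosed rhombicosidodecahedron_itv _ => exact enclosed_rhombicosidodecahedron
  | |- enclosed icosahedron2_itv _ => exact enclosed_icosahedron2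
  | |- enclosed icosahedron3_itv _ => exact enclosed_icosahedron3
  | |- enclosed snub_disphenoid_itv _ => exact enclosed_snub_disphenoid
  | |- enclosed snub_square_antiprism_itv _ => exact enclosed_snub_square_antiprism
  | |- enclosed sphenocorona_itv _ => exact enclosed_sphenocorona
  | |- enclosed sphenomegacorona_itv _ => exact enclosed_sphenomegacorona
  | |- enclosed hebesphenomegacorona_itv _ => exact enclosed_hebesphenomegacorona
  | |- enclosed disphenocingulum_itv _ => exact enclosed_disphenocingulum
  | |- enclosed bilunabirotunda_itv _ => exact enclosed_bilunabirotunda
  | |- enclosed triangular_hebesphenorotunda_itv _ =>
      exact enclosed_triangular_hebesphenorotunda
  | |- enclosed (gyrate_itv _ _) _ => refine (enclosed_gyrate _ _)
  | |- enclosed (diminish_itv _ _) _ => refine (enclosed_diminish _ _ _); [by vm_compute| |]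
  | |- enclosed _ _ => refine (enclosed_pts _)
  | |- encl_pts (_ :: _) _ => split
  | |- encl_pts [::] _ => exact I
  | |- encl_pts (ngon_itv ?n _ _) _ => refine (@encl_ngon _ n _ _ _ _ isT _ _); [angles|]
  | |- encl_pts (polygon_itv ?n _ _ _) _ =>
      refine (@encl_polygon _ n _ _ _ _ _ _ isT _ _ _); [|angles|]
  | |- encl_pts (prism_itv ?n) _ => exact (@encl_prism _ n isT)
  | |- encl_pts (antiprism_itv ?n) _ => exact (@encl_antiprism _ n isT)
  | |- encl_pts (pyramid_cap_itv ?n) _ => exact (@encl_pyramid_cap _ n isT)
  | |- encl_pts (cupola_cap_itv ?n _) _ => refine (@encl_cupola_cap _ n _ _ isT _); angles
  | |- encl_pts (rotunda_cap_itv _) _ => refine (encl_rotunda_cap _); angles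
  | |- encl_pts (below_itv _ _) _ => refine (encl_below _ _)
  | |- encl_pts truncated_tetrahedron_itv _ => exact encl_truncated_tetrahedron
  | |- encl_pts truncated_cube_itv _ => exact encl_truncated_cube
  | |- encl_pts decagon_cap_itv _ => exact encl_decagon_cap
  | |- encl_pts decagon_cap2_itv _ => exact encl_decagon_cap2
  | |- encl_pts decagon_cap_opp_itv _ => exact encl_decagon_cap_opp
  | |- enclp ax1_itv _ => exact encl_ax1
  | |- enclp ax2_itv _ => exact encl_ax2
  | |- enclp ax3_itv _ => exact encl_ax3
  | |- enclp (oppp_itv _) _ => refine (encl_oppp _)
  | |- enclp (side_apex_itv ?n ?k) _ => exact (@encl_side_apex _ n k isT)
  | |- enclp (dodecahedron_apex_itv _) _ => refine (encl_dodecahedron_apex _)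
  | |- enclp (apex_itv _ _ ?n _) _ => refine (@encl_apex _ _ _ n _ _ _ _ isT _ _ _)
  | |- enclp sphenocorona_apex_itv _ => exact encl_sphenocorona_apex
  | |- enclp (_, _) _ => refine (enclp_pt _ _ _)
  | |- encl gold_itv _ => exact encl_gold
  | |- encl sqrt2_itv _ => exact encl_sqrt2
  | |- encl (cube_itv _) _ => refine (encl_cube _)
  | |- encl (antiprism_height_itv ?n) _ => exact (@encl_antiprism_height _ n isT)
  | |- encl (quotient_itv ?a ?b) _ => exact (encl_quotient (Z.to_nat a) (Z.to_nat b))
  | |- encl half_itv _ => exact (encl_quotient 1 2)
  | |- encl _ _ => encl_step
  end.

Definition solved : seq nat :=
  [seq k <- iota 1 92 | k \notin [:: 25; 45; 47; 71; 72; 73; 74; 75; 76; 77]%N].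

Lemma enclosed_johnson (R : realType) k : k \in solved ->
  enclosed (johnson_itv k) (johnson_vertices k : seq 'rV[R]_3).
Proof.
move=> ks; have : (k < 93)%N.
  by move: ks; rewrite mem_filter mem_iota => /and3P[].
(* The indices 0 to 92 one by one; for 0 and the ten excluded ones [ks] computes to a
   contradiction. *)
do 93 (case: k ks => [|k] ks; [move=> _; first [by exfalso; vm_compute in ks |
  rewrite /johnson_itv /johnson_vertices; cbv zeta; encl_johnson]|]).
by [].
Qed.

(** * Certificates *)

(** Midpoint and radius. After one rounding of the coordinates only polynomials with integer
    coefficients remain to be evaluated, so these operations need neither division nor further
    rounding. *)
Definition ball : Type := Z * Z.
Definition zvec : Type := Z * Z * Z.
Definition ball_vec : Type := ball * ball * ball.

Definition exact_ball (z : Z) : ball := (z, 0%stdZ).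
Definition add_ball (X Y : ball) : ball := (X.1 + Y.1, X.2 + Y.2)%stdZ.
Definition sub_ball (X Y : ball) : ball := (X.1 - Y.1, X.2 + Y.2)%stdZ.
Definition mul_ball (X Y : ball) : ball :=
  (X.1 * Y.1, Z.abs X.1 * Y.2 + Z.abs Y.1 * X.2 + X.2 * Y.2)%stdZ.
Definition pos_ball (X : ball) : bool := (X.2 <? X.1)%stdZ.
Definition nonzero_ball (X : ball) : bool := (X.2 <? Z.abs X.1)%stdZ.

Definition exact_vec (u : zvec) : ball_vec :=
  (exact_ball u.1.1, exact_ball u.1.2, exact_ball u.2).
Definition sub_ball_vec (A B : ball_vec) : ball_vec :=
  (sub_ball A.1.1 B.1.1, sub_ball A.1.2 B.1.2, sub_ball A.2 B.2).
Definition dot_ball (U A : ball_vec) : ball :=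
  add_ball (add_ball (mul_ball U.1.1 A.1.1) (mul_ball U.1.2 A.1.2)) (mul_ball U.2 A.2).
Definition det_ball (A B C : ball_vec) : ball :=
  add_ball (sub_ball
    (mul_ball A.1.1 (sub_ball (mul_ball B.1.2 C.2) (mul_ball B.2 C.1.2)))
    (mul_ball A.1.2 (sub_ball (mul_ball B.1.1 C.2) (mul_ball B.2 C.1.1))))
    (mul_ball A.2 (sub_ball (mul_ball B.1.1 C.1.2) (mul_ball B.1.2 C.1.1))).
Definition turn_ball (D W : ball * ball) : ball :=
  sub_ball (mul_ball D.1 W.2) (mul_ball D.2 W.1).
Definition sub_ball_pair (D W : ball * ball) : ball * ball :=
  (sub_ball D.1 W.1, sub_ball D.2 W.2).
Definition scale_ball_pair (n : Z) (D : ball * ball) : ball * ball :=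
  (mul_ball (exact_ball n) D.1, mul_ball (exact_ball n) D.2).

Definition translate_ball_pair (t : Z * Z) (D : ball * ball) : ball * ball :=
  (add_ball D.1 (exact_ball t.1), add_ball D.2 (exact_ball t.2)).

Definition zdot (u v : zvec) : Z := (u.1.1 * v.1.1 + u.1.2 * v.1.2 + u.2 * v.2)%stdZ.

(** Not normalised: the rotation then has rational entries with denominator [norm_sq] and is exactly
    orthogonal. *)
Definition quaternion : Type := Z * Z * Z * Z.

Definition norm_sq (q : quaternion) : Z :=
  let: (a, b, c, d) := q in (a * a + b * b + c * c + d * d)%stdZ.

(* [norm_sq q] times the rows of the rotation matrix of [q]. *)
Definition rotation_row (q : quaternion) (j : nat) : zvec :=
  let: (a, b, c, d) := q in
  match j with
  | 0%N => (a * a + b * b - c * c - d * d, 2 * (b * c - a * d), 2 * (b * d + a * c))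
  | 1%N => (2 * (b * c + a * d), a * a - b * b + c * c - d * d, 2 * (c * d - a * b))
  | _ => (2 * (b * d - a * c), 2 * (c * d + a * b), a * a - b * b - c * c + d * d)
  end%stdZ.

Definition project_ball (q : quaternion) (A : ball_vec) : ball * ball :=
  (dot_ball (exact_vec (rotation_row q 0)) A, dot_ball (exact_vec (rotation_row q 1)) A).

(* In units of [w / unit_scale]. *)
Definition ball_of_itv (w : Z) (X : itv) : ball :=
  if X is Some (l, h) then
    let c := ((l + h + w) / (2 * w))%stdZ in
    (c, Z.max (h / w + 1 - c) (c - l / w))%stdZ
  else (0, 0)%stdZ.

Definition bounded_itv (X : itv) : bool := if X is Some _ then true else false.

Definition ball_of_pt (w : Z) (P : pt_itv) : ball_vec :=
  (ball_of_itv w P.1.1, ball_of_itv w P.1.2, ball_of_itv w P.2).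

Definition bounded_pt (P : pt_itv) : bool :=
  [&& bounded_itv P.1.1, bounded_itv P.1.2 & bounded_itv P.2].

Definition centre (A : ball_vec) : zvec := (A.1.1.1, A.1.2.1, A.2.1).

Definition sub_zvec (u v : zvec) : zvec := (u.1.1 - v.1.1, u.1.2 - v.1.2, u.2 - v.2)%stdZ.
Definition add_zvec (u v : zvec) : zvec := (u.1.1 + v.1.1, u.1.2 + v.1.2, u.2 + v.2)%stdZ.
Definition shift_zvec (n : Z) (u : zvec) : zvec :=
  (Z.shiftr u.1.1 n, Z.shiftr u.1.2 n, Z.shiftr u.2 n).

Definition worst_point (u p : zvec) (A : seq zvec) : Z * zvec :=
  foldl (fun m x => let d := zdot u (sub_zvec p x) in if (d <? m.1)%stdZ then (d, x) else m)
    (zdot u (sub_zvec p (head p A)), head p A) A.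

(* The perceptron algorithm for a direction in which [p] is beyond all points
   of [A]; its answer is verified, so nothing is proved about it. *)
Fixpoint perceptron (fuel : nat) (n : Z) (p : zvec) (A : seq zvec) (u : zvec) : zvec :=
  if fuel is fuel'.+1 then
    let m := worst_point u p A in
    if (2 * (Z.abs u.1.1 + Z.abs u.1.2 + Z.abs u.2) <? m.1)%stdZ then u
    else perceptron fuel' n p A (add_zvec u (shift_zvec n (sub_zvec p m.2)))
  else u.

Definition centroid (A : seq zvec) : zvec :=
  let s := foldr add_zvec (0, 0, 0)%stdZ A in
  let n := Z.of_nat (size A) in (s.1.1 / n, s.1.2 / n, s.2 / n)%stdZ.

Definition zero_vec : ball_vec := exact_vec (0, 0, 0)%stdZ.

Definition beyond (u : zvec) (A B : ball_vec) : bool :=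
  pos_ball (dot_ball (exact_vec u) (sub_ball_vec A B)).

(** The search starts from the direction of the vertex seen from the centroid; as [n] is [bits - 6],
    directions are kept in units of 2 ^ (- 6). The margin at which [perceptron] stops, twice the sum
    of the absolute values of [u], is the error caused by two points with radii 1, so [beyond]
    succeeds for such balls. *)
Definition check_exposed (n : Z) (A : seq ball_vec) : bool :=
  let C := map centre A in
  let g := centroid C in
  all (fun i =>
    let p := nth (0, 0, 0)%stdZ C i in
    let u := perceptron 60 n p (take i C ++ drop i.+1 C) (shift_zvec n (sub_zvec p g)) in
    all (beyond u (nth zero_vec A i)) (take i A ++ drop i.+1 A)) (iota 0 (size A)).

(** The last vertex is used rather than the fourth because many of the lists begin with a plane
    polygon. *)
Definition check_spanning (A : seq ball_vec) : bool :=
  let p i := sub_ball_vec (nth zero_vec A i) (nth zero_vec A 0) in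
  (3 < size A)%N && nonzero_ball (det_ball (p 1%N) (p 2%N) (p (size A).-1)).

Definition zero_pair : ball * ball := (exact_ball 0, exact_ball 0).

(** The shadows arrive multiplied by [n1] and [n2]; multiplying each by the other norm makes them
    comparable without division. *)
Definition check_passage (n1 n2 : Z) (outer inner : seq (ball * ball)) (l : seq nat) : bool :=
  let W := map (scale_ball_pair n1) inner in
  all (fun i =>
    let a := nth zero_pair outer (nth 0%N l i) in
    let D := sub_ball_pair (nth zero_pair outer (nth 0%N l i.+1)) a in
    let b := scale_ball_pair n2 a in
    all (fun c => pos_ball (turn_ball D (sub_ball_pair c b))) W) (iota 0 (size l).-1).

(* Coordinates are rounded to multiples of [2 ^ - bits]; [translation] is in
   these units, times the squared norm of [inner_rotation], and the vertices
   with the indices [loop] run counter-clockwise around the outer shadow. *)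
Record certificate := Certificate {
  bits : Z; outer_rotation : quaternion; inner_rotation : quaternion;
  translation : Z * Z; loop : seq nat }.

Definition check (L : seq pt_itv) (C : certificate) : bool :=
  let w := (2 ^ (prec - bits C))%stdZ in
  let A := map (ball_of_pt w) L in
  let n1 := norm_sq (outer_rotation C) in
  let n2 := norm_sq (inner_rotation C) in
  let l := rcons (loop C) (head 0%N (loop C)) in
  let inner B := translate_ball_pair (translation C) (project_ball (inner_rotation C) B) in
  [&& (0 <? w)%stdZ, (0 <? n1)%stdZ, (0 <? n2)%stdZ, all bounded_pt L,
      (0 < size (loop C))%N, all (fun i => (i < size L)%N) (loop C),
      check_exposed (bits C - 6)%stdZ A, check_spanning A &
      check_passage n1 n2 (map (project_ball (outer_rotation C)) A) (map inner A) l].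

(** * Soundness of the check *)

Section Soundness.
Context {R : realType}.
Local Notation V := 'rV[R]_3.
Local Notation zR := (@zR R).
Implicit Types (x y : R) (v : V) (X Y : ball) (A B : ball_vec) (u : zvec) (q : quaternion).

Definition in_ball X x : Prop := `|x - zR X.1| <= zR X.2.

Lemma in_exact z : in_ball (exact_ball z) (zR z).
Proof. by rewrite /in_ball subrr normr0 /= zR0. Qed.

Lemma in_add X Y x y : in_ball X x -> in_ball Y y -> in_ball (add_ball X Y) (x + y).
Proof.
rewrite /in_ball !zRD opprD addrACA => Xx Yy.
exact: le_trans (ler_normD _ _) (lerD Xx Yy).
Qed.

Lemma in_sub X Y x y : in_ball X x -> in_ball Y y -> in_ball (sub_ball X Y) (x - y).
Proof.
rewrite /in_ball zRB zRD => Xx Yy.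
have -> : x - y - (zR X.1 - zR Y.1) = (x - zR X.1) - (y - zR Y.1) by ring.
exact: le_trans (ler_normB _ _) (lerD Xx Yy).
Qed.

Lemma zR_abs z : zR (Z.abs z) = `|zR z|.
Proof.
have [z0|z0] := Z.le_gt_cases 0 z.
  by rewrite Z.abs_eq // ger0_norm // -zR0; exact: zR_le.
have zn : (z <= 0)%stdZ by lia.
by rewrite Z.abs_neq // zRN ler0_norm // -zR0; exact: zR_le.
Qed.

Lemma in_mul X Y x y : in_ball X x -> in_ball Y y -> in_ball (mul_ball X Y) (x * y).
Proof.
rewrite /in_ball /= !zRD !zRM !zR_abs.
move: (zR X.1) (zR X.2) (zR Y.1) (zR Y.2) => a e b f Xx Yy.
have -> : x * y - a * b = a * (y - b) + b * (x - a) + (x - a) * (y - b) by ring.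
apply: le_trans (ler_normD _ _) _; apply: lerD; last first.
  by rewrite normrM; apply: ler_pM.
by apply: le_trans (ler_normD _ _) _; apply: lerD; rewrite normrM; apply: ler_wpM2l.
Qed.

Lemma pos_ballP X x : in_ball X x -> pos_ball X -> 0 < x.
Proof.
rewrite /in_ball /pos_ball ler_distl => /andP[Xx _] /Z.ltb_spec0 /(@zR_lt R _ _) h.
by apply: lt_le_trans Xx; rewrite subr_gt0.
Qed.

Lemma nonzero_ballP X x : in_ball X x -> nonzero_ball X -> x != 0.
Proof.
rewrite /in_ball /nonzero_ball => Xx /Z.ltb_spec0 /(@zR_lt R _ _); rewrite zR_abs => h.
by apply/eqP => x0; move: Xx; rewrite x0 sub0r normrN leNgt h.
Qed.

Definition in_ball_vec A v : Prop :=
  [/\ in_ball A.1.1 (v 0 0), in_ball A.1.2 (v 0 1) & in_ball A.2 (v 0 2)].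

Definition vec_of u : V := pt (zR u.1.1) (zR u.1.2) (zR u.2).

Lemma in_exact_vec u : in_ball_vec (exact_vec u) (vec_of u).
Proof. by split; rewrite mxE; exact: in_exact. Qed.

Lemma in_sub_vec A B v (w : V) : in_ball_vec A v -> in_ball_vec B w ->
  in_ball_vec (sub_ball_vec A B) (v - w).
Proof. by move=> [? ? ?] [? ? ?]; split; rewrite 2!mxE; exact: in_sub. Qed.

Lemma in_dot A B v (w : V) : in_ball_vec A v -> in_ball_vec B w ->
  in_ball (dot_ball A B) (dot v w).
Proof.
move=> [? ? ?] [? ? ?]; rewrite dotE.
by do ![exact: in_mul | apply: in_add].
Qed.

Lemma det_ball_unitmx A B C (w : 'I_3 -> V) : in_ball_vec A (w 0) ->
  in_ball_vec B (w 1) -> in_ball_vec C (w 2) -> nonzero_ball (det_ball A B C) ->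
  \matrix_(i < 3) w i \in unitmx.
Proof.
move=> [A0 A1 A2] [B0 B1 B2] [C0 C1 C2] nz.
rewrite unitmxE unitfE; apply: nonzero_ballP nz.
have -> : \det (\matrix_(i < 3) w i) =
    w 0 0 0 * (w 1 0 1 * w 2 0 2 - w 1 0 2 * w 2 0 1)
  - w 0 0 1 * (w 1 0 0 * w 2 0 2 - w 1 0 2 * w 2 0 0)
  + w 0 0 2 * (w 1 0 0 * w 2 0 1 - w 1 0 1 * w 2 0 0).
  rewrite (expand_det_row _ 0) !big_ord_recl big_ord0 /cofactor.
  rewrite !(expand_det_row _ 0) !big_ord_recl !big_ord0 /cofactor !det_mx11 !mxE /=.
  (* Naming the entries by natural numbers identifies the various ordinal terms that the expansion
     creates for one index. *)
  pose f a b := w (inord a) 0 (inord b).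
  have wE i j : w i 0 j = f i j by rewrite /f !inord_val.
  rewrite !wE /= /bump /= !addnE /= !addr0 !expr0 !expr1 !exprS expr0; ring.
by do ![assumption | apply: in_mul | apply: in_add | apply: in_sub].
Qed.

Lemma in_ball_of_itv (w : Z) (I : itv) x : (0 < w)%stdZ -> bounded_itv I ->
  encl I x -> in_ball (ball_of_itv w I) (zR unit_scale / zR w * x).
Proof.
move=> w0; case: I => [[l h]|] // _ /andP[lx xh].
have w0R : 0 < zR w by rewrite -zR0; exact: zR_lt.
rewrite /in_ball /=; move: ((l + h + w) / (2 * w))%stdZ => c.
rewrite mulrAC -(mulrC x) ler_distl ler_pdivlMr // ler_pdivrMr //.
rewrite -zRB -zRD -!zRM; apply/andP; split.
  apply: le_trans lx; apply: zR_le.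
  have := Z.mul_div_le l w w0; nia.
apply: le_trans xh _; apply: zR_le.
have := Z.mul_succ_div_gt h w w0; nia.
Qed.

Lemma in_ball_of_pt (w : Z) (P : pt_itv) v : (0 < w)%stdZ -> bounded_pt P ->
  enclp P v -> in_ball_vec (ball_of_pt w P) (zR unit_scale / zR w *: v).
Proof.
move=> w0 /and3P[b0 b1 b2] [v0 v1 v2].
by split; rewrite mxE; exact: in_ball_of_itv.
Qed.

Definition in_balls (L : seq ball_vec) (S : seq V) : Prop :=
  size L = size S /\
  forall i, (i < size S)%N -> in_ball_vec (nth zero_vec L i) (nth 0 S i).

Lemma in_balls_of_pts (w : Z) (L : seq pt_itv) S : (0 < w)%stdZ ->
  all bounded_pt L -> encl_pts L S ->
  in_balls (map (ball_of_pt w) L) (map ( *:%R (zR unit_scale / zR w)) S).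
Proof.
move=> w0; elim: L S => [|P L IH] [|v S] //= /andP[bP bL] [Pv LS].
have [sz h] := IH S bL LS; split; first by rewrite /= sz.
by case=> [_|i /h] //=; exact: in_ball_of_pt.
Qed.

Lemma check_exposedP n L S : in_balls L S -> check_exposed n L -> exposed S.
Proof.
move=> [sz LS] /allP chk x /(nthP 0)[i iS <-].
have /chk : i \in iota 0 (size L) by rewrite mem_iota sz.
cbv zeta; move: (perceptron _ _ _ _ _) => u; rewrite all_cat => /andP[/all_nthP h1 /all_nthP h2].
exists (vec_of u) => _ /(nthP 0)[j jS <-] ji.
have : beyond u (nth zero_vec L i) (nth zero_vec L j).
  have [ij|ij|ij] := ltngtP j i; last by rewrite ij eqxx in ji.
    have := h1 zero_vec j; rewrite nth_take // size_take sz iS.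
    exact.
  have := h2 zero_vec (j - i.+1)%N; rewrite nth_drop subnKC //; apply.
  by rewrite size_drop sz ltn_sub2r // (leq_ltn_trans ij).
rewrite -subr_gt0 -dotBr; apply: pos_ballP.
by apply: in_dot (in_exact_vec _) (in_sub_vec _ _); apply: LS.
Qed.

Lemma check_spanningP L S : in_balls L S -> check_spanning L -> spanning [set` S].
Proof.
move=> [sz LS] /andP[n3]; set n := (size L).-1 => nz.
pose g (i : 'I_3) : nat := nth 0%N [:: 1; 2; n]%N i.
have gS i : (g i < size S)%N.
  by rewrite /g -sz; case: i => [[|[|[|//]]] /= _]; rewrite /n; lia.
have S0 : (0 < size S)%N by rewrite -sz; lia.
exists (nth 0 S 0), (fun i => nth 0 S (g i)); split.
- exact: mem_nth.
- by move=> i; exact: mem_nth.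
- have := LS _ S0; have := LS _ (gS 0); have := LS _ (gS 1); have := LS _ (gS 2).
  by move=> *; apply: det_ball_unitmx nz; exact: in_sub_vec.
Qed.

(** Vectors are rows and are multiplied on the right, so the rows given by the quaternion become
    columns. *)
Definition rotation q : 'M[R]_3 :=
  \matrix_(i, j) (vec_of (rotation_row q j) 0 i / zR (norm_sq q)).

Lemma mul_rotation q v j :
  (v *m rotation q) 0 j = dot (vec_of (rotation_row q j)) v / zR (norm_sq q).
Proof.
by rewrite mxE /dot mulr_suml; apply: eq_bigr => i _; rewrite mxE mulrA (mulrC (v _ _)).
Qed.

Lemma dot_vec_of u (v : zvec) : dot (vec_of u) (vec_of v) = zR (zdot u v).
Proof. by rewrite dotE !mxE /= /zdot !zRD !zRM. Qed.

Lemma rotation_orthogonal q : (0 < norm_sq q)%stdZ -> rotation q *m (rotation q)^T = 1%:M.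
Proof.
move=> n0; have n0R : zR (norm_sq q) != 0.
  by rewrite gt_eqF // -zR0; exact: zR_lt.
apply: mulmx1C; apply/matrixP => i j; rewrite !mxE.
transitivity (dot (vec_of (rotation_row q i)) (vec_of (rotation_row q j)) /
  (zR (norm_sq q) * zR (norm_sq q))).
  rewrite /dot mulr_suml; apply: eq_bigr => l _; rewrite !mxE.
  by field.
have -> : dot (vec_of (rotation_row q i)) (vec_of (rotation_row q j)) =
    zR (if i == j then norm_sq q * norm_sq q else 0)%stdZ.
  (* Nine polynomial identities in [a], [b], [c], [d]: distinct rows are orthogonal, and each has
     the square of the norm as its squared length. *)
  rewrite dot_vec_of; congr zR; move: {n0 n0R} q => [[[a b] c] d].
  rewrite /zdot; case: i j => [[|[|[|//]]] ?] [[|[|[|//]]] ?]; cbn -[Z.add Z.sub Z.mul];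
    lia.
case: eqP => _; last by rewrite zR0 mul0r.
by rewrite zRM divff // mulf_neq0.
Qed.

Lemma in_project q A v : in_ball_vec A v ->
  in_ball (project_ball q A).1 (dot (vec_of (rotation_row q 0)) v) /\
  in_ball (project_ball q A).2 (dot (vec_of (rotation_row q 1)) v).
Proof. by move=> Av; split; apply: in_dot Av; exact: in_exact_vec. Qed.

Definition in_pair (X : ball * ball) (x : R * R) : Prop :=
  in_ball X.1 x.1 /\ in_ball X.2 x.2.

Lemma in_turn (a b c : ball * ball) (n1 n2 : Z) (o o' x : R * R) :
  in_pair a o -> in_pair b o' -> in_pair c x ->
  pos_ball (turn_ball (sub_ball_pair b a)
    (sub_ball_pair (scale_ball_pair n1 c) (scale_ball_pair n2 a))) ->
  0 < (o'.1 - o.1) * (zR n1 * x.2 - zR n2 * o.2)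
    - (o'.2 - o.2) * (zR n1 * x.1 - zR n2 * o.1).
Proof.
move=> [a1 a2] [b1 b2] [c1 c2]; apply: pos_ballP.
have n1E := in_exact n1; have n2E := in_exact n2.
by do ![assumption | apply: in_sub | apply: in_mul].
Qed.

(** The balls describe the vertices multiplied by [k = unit_scale / w]. The criterion is applied to
    this enlarged list, and the similarity absorbs the factor: its ratio becomes [c / k]. *)
Lemma check_rupert L (S : seq V) C (P : set V) :
  encl_pts L S -> check L C -> similar_to [set` S] P -> rupert P.
Proof.
move=> LS; rewrite /check; cbv zeta.
set w := (2 ^ _)%stdZ; move: w => w.
set q1 := outer_rotation C; set q2 := inner_rotation C.
case/and5P => /Z.ltb_spec0 w0 /Z.ltb_spec0 n1 /Z.ltb_spec0 n2 bL.
case/and5P => l0 lL expA spanA pass.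
have sizeLS : size L = size S.
  by elim: (L) (S) LS => [|? ? IH] [|? ?] //= [_ /IH ->].
have w0R : 0 < zR w by rewrite -zR0; exact: zR_lt.
have n1R : 0 < zR (norm_sq q1) by rewrite -zR0; exact: zR_lt.
have n2R : 0 < zR (norm_sq q2) by rewrite -zR0; exact: zR_lt.
set k : R := zR unit_scale / zR w; have k0 : 0 < k by rewrite divr_gt0 // S_gt0.
have LS' := in_balls_of_pts w0 bL LS; rewrite -/k in LS'.
have [S' S'E] : exists S', S' = map ( *:%R k) S by exists (map ( *:%R k) S).
rewrite -S'E in LS'; move=> [c c0 [M [b [MM PE]]]].
have szS' : size S' = size S by rewrite S'E size_map.
set r := rcons (loop C) _ in pass.
(* The criterion asks for a vertex at every [i]; past the end the index defaults to 0, which is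
   valid since the loop is not empty. *)
have rL i : (nth 0%N r i < size S')%N.
  have h j : (j < size (loop C))%N -> (nth 0%N (loop C) j < size S')%N.
    by move=> jl; rewrite szS' -sizeLS; apply: (allP lL); exact: mem_nth.
  rewrite nth_rcons; case: (ltngtP i) => [il|_|_]; [exact: h| |by rewrite -nth0; exact: h].
  exact: leq_ltn_trans (leq0n _) (h 0%N l0).
pose t : V := pt (zR (translation C).1 / zR (norm_sq q2))
                 (zR (translation C).2 / zR (norm_sq q2)) 0.
apply: (@rupert_criterion R S' (rotation q1) (rotation q2) t (size (loop C))
          (fun i => nth 0 S' (nth 0%N r i))).
- exact: check_exposedP LS' expA.
- exact: check_spanningP LS' spanA.
- exact: rotation_orthogonal.
- exact: rotation_orthogonal.
- by [].
- by rewrite !nth_rcons ltnn eqxx l0 nth0.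
- by move=> i; exact: mem_nth.
- move=> i _ il /(nthP 0)[j jS <-].
  have proj (q : quaternion) a : (a < size S')%N ->
      in_pair (project_ball q (nth zero_vec (map (ball_of_pt w) L) a))
        (dot (vec_of (rotation_row q 0)) (nth 0 S' a),
         dot (vec_of (rotation_row q 1)) (nth 0 S' a)).
    by move=> aS; apply: in_project; apply: LS'.2.
  have sizeA : size (map (ball_of_pt w) L) = size S' by rewrite size_map sizeLS.
  move: pass proj sizeA; move: (map (ball_of_pt w) L) => A pass proj sizeA.
  move: pass; rewrite /check_passage size_rcons => /allP/(_ i).
  rewrite mem_iota add0n il => /(_ isT); cbv zeta.
  rewrite !(nth_map zero_vec) ?sizeA // => /(all_nthP zero_pair)/(_ j).
  rewrite !size_map sizeA => /(_ jS).
  rewrite (nth_map zero_pair) ?size_map ?sizeA // (nth_map zero_vec) ?sizeA //.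
  have [I1 I2] := proj q2 j jS; set x := nth 0 S' j in I1 I2 *.
  have I' : in_pair (translate_ball_pair (translation C) (project_ball q2 (nth zero_vec A j)))
     (dot (vec_of (rotation_row q2 0)) x + zR (translation C).1,
      dot (vec_of (rotation_row q2 1)) x + zR (translation C).2).
    by split; apply: in_add => //; exact: in_exact.
  move=> /(in_turn (proj q1 _ (rL i)) (proj q1 _ (rL i.+1)) I') /=.
  have tE l : (x *m rotation q2 + t) 0 l = (x *m rotation q2) 0 l + t 0 l by rewrite mxE.
  have t0 : t 0 0 = zR (translation C).1 / zR (norm_sq q2) by rewrite mxE.
  have t1 : t 0 1 = zR (translation C).2 / zR (norm_sq q2) by rewrite mxE.
  rewrite !tE t0 t1 !mul_rotation /= (modn_small (isT : (1 < 3)%N)).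
  move: (dot _ (nth 0 S' (nth 0%N r i.+1))) (dot _ (nth 0 S' (nth 0%N r i.+1))).
  move: (dot _ (nth 0 S' (nth 0%N r i))) (dot _ (nth 0 S' (nth 0%N r i))) (dot _ x) (dot _ x).
  move: (zR (norm_sq q1)) (zR (norm_sq q2)) n1R n2R => m1 m2 m1_gt0 m2_gt0.
  move: (zR _) (zR _) => z0 z1 u0 u1 y0 y1 v0 v1 turn_gt0.
  (* The verified inequality is the required one times [m1 * m1 * m2]: one factor [m1] from the
     edge, [m1 * m2] from the difference of cross-multiplied shadows. *)
  rewrite -(pmulr_rgt0 _ (mulr_gt0 (mulr_gt0 m1_gt0 m1_gt0) m2_gt0)).
  congr (0 < _): turn_gt0; field.
  by rewrite !gt_eqF.
- exists (c / k); first by rewrite divr_gt0.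
  exists M, b; split => //; rewrite PE S'E.
  apply/seteqP; split=> [_ [x xS <-]|_ [_ /mapP[x xS ->] <-]].
    exists (k *: x); first exact: map_f.
    by rewrite -scalemxAl scalerA divfK // gt_eqF.
  by exists x => //; rewrite -scalemxAl scalerA divfK // gt_eqF.
Qed.

End Soundness.

(** A larger [bits] makes the balls smaller relative to the solid, and thereby allows a tighter
    passage. *)
Definition certificates : seq (nat * certificate) := [::
  (1%N, Certificate 12 (16, 0, 0, -1) (-15, -2, 6, 0) (0, 0) [:: 2; 3; 0; 1]%N);
  (2%N, Certificate 12 (-8, 0, 0, -14) (4, 3, -11, 11) (131072, 262144) [:: 0; 1; 2; 3;
    4]%N);
  (3%N, Certificate 12 (-6, -1, 0, -15) (0, 10, -6, 11) (-163840, 32768) [:: 0; 1; 2; 3;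
    4; 5]%N);
  (4%N, Certificate 12 (16, -1, 1, -2) (-1, 7, 9, 11) (0, 0) [:: 4; 5; 6; 7; 0; 1; 2;
    3]%N);
  (5%N, Certificate 12 (3, -14, -6, -2) (-11, -11, 1, 1) (0, 0) [:: 6; 5; 4; 3; 2; 1; 0;
    9; 8; 7]%N);
  (6%N, Certificate 12 (-60, 2, 1, -23) (-30, -17, -48, 25) (-1048576, 1048576) [:: 3; 4;
    5; 6; 7; 8; 9; 0; 1; 2]%N);
  (7%N, Certificate 12 (8, -8, -10, -7) (0, 16, 2, 0) (196608, -393216) [:: 2; 5; 4; 3; 0;
    6]%N);
  (8%N, Certificate 12 (-8, -12, -1, 6) (14, 0, 0, 8) (262144, 393216) [:: 2; 8; 0; 4; 7;
    6]%N);
  (9%N, Certificate 14 (-14, -5, -4, -5) (0, 9, -13, 0) (-1572864, 835584) [:: 7; 2; 3; 4;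
    0; 5; 6]%N);
  (10%N, Certificate 14 (18, -16, 20, -6) (23, 2, 1, 22) (-3342336, -1900544) [:: 4; 7; 3;
    8; 1; 5]%N);
  (11%N, Certificate 12 (15, -5, -3, 2) (10, -5, 9, 8) (356352, 147456) [:: 2; 7; 8; 9; 0;
    1]%N);
  (12%N, Certificate 12 (29, -17, -49, 25) (-9, -21, -59, 10) (-2621440, -1048576) [:: 3;
    1; 4; 0]%N);
  (13%N, Certificate 12 (7, 0, 0, 31) (-22, -11, 18, 9) (-1048576, 131072) [:: 0; 1; 2; 3;
    4]%N);
  (14%N, Certificate 12 (-11, 0, 11, 0) (-15, 0, 0, 5) (524288, 131072) [:: 6; 2; 5; 7; 3;
    0]%N);
  (15%N, Certificate 12 (-2, 7, 10, 10) (13, 0, 0, 9) (-262144, -524288) [:: 7; 9; 5; 1;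
    8; 3]%N);
  (16%N, Certificate 12 (-7, 3, 10, -10) (-11, 0, 0, -11) (393216, 229376) [:: 0; 10; 2;
    7; 11; 5]%N);
  (17%N, Certificate 12 (18, -14, -18, 14) (1, 31, -6, 0) (2293760, -131072) [:: 8; 2; 5;
    9; 7; 0]%N);
  (18%N, Certificate 12 (-14, -5, 5, 4) (0, -13, -9, 0) (262144, 131072) [:: 13; 14; 5;
    11; 6; 7; 8; 2]%N);
  (19%N, Certificate 12 (-4, -14, -6, -3) (-4, 11, -4, -11) (-720896, 524288) [:: 12; 11;
    3; 2; 1; 0; 7; 15; 14; 13]%N);
  (20%N, Certificate 12 (8, -2, -3, 14) (-10, -2, -11, 6) (655360, -262144) [:: 1; 2; 3;
    4; 14; 15; 16; 17; 18; 19; 9; 0]%N);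
  (21%N, Certificate 12 (-15, -2, 4, 5) (0, -13, -9, 0) (262144, 32768) [:: 22; 28; 23; 8;
    18; 19; 10; 11; 12; 13; 3; 4; 5]%N);
  (22%N, Certificate 14 (-118, 145, -170, 42) (2, 228, 107, -48) (-303038464, -157286400)
    [:: 7; 6; 11; 5; 14; 13; 2]%N);
  (23%N, Certificate 20 (234, 243, 383, -41) (-308, -67, -356, 190) (0, 0) [:: 13; 5; 4;
    18; 17; 2; 1; 8; 15; 14]%N);
  (24%N, Certificate 18 (5, -84, -72, -64) (90, -58, 69, 8) (0, 0) [:: 17; 16; 15; 14; 13;
    3; 2; 1; 20; 0; 9; 8]%N);
  (26%N, Certificate 18 (-2, -7, 8, -12) (-4, -8, -14, 2) (-1572864, 4194304) [:: 6; 0; 4;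
    5; 2; 7]%N);
  (27%N, Certificate 12 (-5, -1, 0, -15) (-5, 5, -10, 10) (-65536, -65536) [:: 0; 1; 2; 3;
    4; 5]%N);
  (28%N, Certificate 12 (12, 0, 0, 10) (-11, -10, -6, 3) (0, 0) [:: 2; 3; 4; 5; 6; 7; 0;
    1]%N);
  (29%N, Certificate 12 (15, -2, 3, 4) (-9, 11, 1, 7) (0, 0) [:: 3; 4; 5; 6; 7; 0; 1;
    2]%N);
  (30%N, Certificate 12 (0, 1, -16, 0) (11, -11, 1, -1) (0, 0) [:: 0; 9; 8; 7; 6; 5; 4; 3;
    2; 1]%N);
  (31%N, Certificate 12 (0, 4, 15, 0) (10, -10, -6, 6) (0, 0) [:: 9; 8; 7; 6; 5; 4; 3; 2;
    1; 0]%N);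
  (32%N, Certificate 12 (-1, -11, -30, -2) (-18, -23, 10, 9) (-262144, -262144) [:: 8; 7;
    6; 5; 4; 3; 2; 1; 0; 9]%N);
  (33%N, Certificate 12 (-15, 0, 0, -4) (-3, 11, 1, -11) (-147456, 57344) [:: 4; 5; 6; 7;
    8; 9; 0; 1; 2; 3]%N);
  (34%N, Certificate 16 (-189, 0, 0, -476) (40, 324, 392, -46) (0, 0) [:: 1; 2; 3; 4; 5;
    6; 7; 8; 9; 0]%N);
  (35%N, Certificate 12 (-7, 11, 4, -9) (0, 13, 10, 0) (524288, -262144) [:: 13; 2; 8; 16;
    15; 17; 11; 5; 14]%N);
  (36%N, Certificate 12 (-4, -8, 7, 11) (0, 13, 9, 0) (524288, -262144) [:: 12; 0; 6; 17;
    15; 16; 9; 3; 13; 14]%N);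
  (37%N, Certificate 12 (-5, 20, -14, -20) (0, 11, -30, 0) (1572864, -1310720) [:: 1; 9;
    20; 23; 22; 13; 5; 18; 17; 16]%N);
  (38%N, Certificate 12 (-11, 18, -20, -12) (1, 1, 23, 23) (262144, 262144) [:: 12; 11;
    25; 29; 18; 17; 7; 6; 5; 22; 21; 3; 2]%N);
  (39%N, Certificate 12 (3, -14, 8, -2) (8, -5, 10, 8) (0, 393216) [:: 13; 12; 11; 10; 0;
    9; 8; 7; 6; 5; 15; 14]%N);
  (40%N, Certificate 12 (7, -18, 25, 4) (0, 26, -18, 0) (-393216, -917504) [:: 12; 25; 11;
    10; 29; 19; 18; 17; 7; 6; 5; 4; 3; 2]%N);
  (41%N, Certificate 14 (7, 4, -31, -5) (0, 32, -5, 0) (3932160, -2097152) [:: 0; 9; 8;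
    18; 17; 27; 32; 26; 14; 13; 3; 2; 1]%N);
  (42%N, Certificate 12 (-12, 10, 3, 0) (-3, 0, 0, -16) (131072, -524288) [:: 5; 15; 32;
    37; 38; 39; 35; 34; 10; 0; 24; 25; 26; 27; 22]%N);
  (43%N, Certificate 12 (1, -10, 9, 9) (15, 0, 0, 5) (262144, -262144) [:: 20; 1; 11; 34;
    39; 38; 32; 16; 6; 22; 27; 26]%N);
  (44%N, Certificate 12 (-44, 44, 8, 9) (-1, -59, 25, 1) (-393216, -4521984) [:: 3; 8; 16;
    17; 11; 0; 12; 13]%N);
  (46%N, Certificate 16 (-891, -53, -494, 94) (-765, -341, -406, -428) (-33554432,
    -67108864) [:: 27; 15; 16; 7; 8; 9; 0; 1; 2; 12; 13; 14]%N);
  (48%N, Certificate 14 (46, 31, -31, 11) (1, 60, -22, -1) (7864320, 13893632) [:: 21; 26;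
    27; 28; 29; 23; 8; 17; 33; 39; 35; 36; 30; 12; 3]%N);
  (49%N, Certificate 12 (9, 10, -24, -16) (-28, 7, -9, -11) (1835008, -655360) [:: 0; 6;
    5; 4; 1]%N);
  (50%N, Certificate 12 (-7, -10, -29, 7) (-22, 8, 21, -3) (-2097152, 1048576) [:: 6; 5;
    2; 1; 7; 3]%N);
  (51%N, Certificate 14 (14, 15, -14, -59) (33, 39, 26, 29) (41418752, -19398656) [:: 6;
    3; 7; 4; 8; 2]%N);
  (52%N, Certificate 12 (10, 3, -10, -29) (12, 15, -17, 19) (393216, -4063232) [:: 10; 5;
    6; 7; 2; 3; 4]%N);
  (53%N, Certificate 12 (3, -4, -4, 15) (-3, 10, 6, 11) (524288, 524288) [:: 10; 0; 1; 11;
    7; 8; 9]%N);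
  (54%N, Certificate 12 (6, 1, 5, 14) (9, 1, -11, 7) (-655360, -524288) [:: 12; 6; 7; 8;
    9; 3; 4; 5]%N);
  (55%N, Certificate 12 (-5, -15, -4, 0) (-8, 11, -3, -8) (-262144, 786432) [:: 13; 2; 1;
    0; 12; 11; 10; 9]%N);
  (56%N, Certificate 12 (-3, -9, -13, -1) (7, 11, 2, -9) (-393216, -131072) [:: 10; 9; 3;
    2; 13; 1; 0; 12; 11]%N);
  (57%N, Certificate 16 (-1, -4, 15, -2) (11, -8, -8, -3) (-3145728, 10485760) [:: 12; 5;
    4; 14; 9; 8; 13; 7; 6]%N);
  (58%N, Certificate 14 (11, 6, -10, -1) (-13, 7, 3, 6) (-65536, -32768) [:: 8; 20; 2; 13;
    3; 11; 9; 5; 14; 4]%N);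
  (59%N, Certificate 12 (-3, 10, 2, -12) (3, 1, -2, -16) (0, 0) [:: 20; 8; 4; 14; 5; 21;
    11; 3; 13; 2]%N);
  (60%N, Certificate 18 (-10, 1, 11, -5) (-1, 2, -16, 3) (0, 0) [:: 20; 10; 6; 15; 7; 11;
    21; 1; 12; 0]%N);
  (61%N, Certificate 12 (28, -51, 6, 26) (1, 34, 53, 11) (-524288, 262144) [:: 4; 22; 5;
    9; 21; 3; 13; 2; 10; 8]%N);
  (62%N, Certificate 12 (12, -2, -2, 10) (-9, 11, 5, -4) (65536, 65536) [:: 0; 6; 7; 3; 5;
    4]%N);
  (63%N, Certificate 12 (9, 2, -2, -13) (-13, 9, -3, 0) (16384, 81920) [:: 2; 5; 4; 1; 8;
    6]%N);
  (64%N, Certificate 12 (11, -1, -6, 29) (-7, 18, 14, -21) (131072, -393216) [:: 9; 0; 7;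
    6; 3; 5; 4]%N);
  (65%N, Certificate 12 (1, 16, 0, 0) (-3, 8, 12, -5) (-262144, 786432) [:: 12; 2; 6; 4;
    0; 1; 5; 13]%N);
  (66%N, Certificate 12 (7, 11, -10, 2) (0, 16, -1, 0) (0, 0) [:: 4; 0; 24; 27; 18; 10;
    11; 3; 7; 23; 21; 13; 12]%N);
  (67%N, Certificate 12 (8, -4, -10, 8) (-13, -3, 0, 9) (0, 0) [:: 27; 24; 25; 22; 14; 15;
    23; 29; 30; 31; 17; 9; 8; 16]%N);
  (68%N, Certificate 12 (-12, 53, 31, 14) (0, -9, -62, -12) (262144, 262144) [:: 27; 51;
    59; 35; 33; 57; 49; 25; 6; 4; 20; 44; 52; 61; 62; 54; 46; 22; 5; 7]%N);
  (69%N, Certificate 12 (13, -5, 7, 2) (-1, -6, -11, 9) (0, 0) [:: 69; 65; 68; 19; 15; 39;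
    47; 23; 22; 46; 38; 64; 60; 63; 12; 16; 40; 48; 24; 25; 49; 41]%N);
  (70%N, Certificate 12 (-14, -42, 16, 43) (-55, 11, 5, -30) (0, 0) [:: 60; 63; 36; 44;
    20; 21; 45; 37; 68; 65; 3; 19; 43; 51; 27; 26; 50; 42; 18; 2]%N);
  (78%N, Certificate 12 (-23, 13, 15, 11) (0, 0, 23, 23) (-262144, 262144) [:: 12; 13; 35;
    47; 22; 52; 23; 29; 7; 6; 28; 44; 2; 4; 26; 34]%N);
  (79%N, Certificate 12 (102, -36, 65, 24) (88, -88, 19, -19) (6815744, 1572864) [:: 33;
    25; 3; 5; 47; 31; 9; 8; 30; 46; 4; 2; 44; 32; 10; 11]%N);
  (80%N, Certificate 12 (30, 48, -19, -22) (34, 33, 9, -42) (0, 0) [:: 22; 2; 40; 24; 32;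
    12; 13; 48; 21; 1; 43; 31; 39; 19; 18; 49]%N);
  (81%N, Certificate 12 (8, -7, -17, -61) (-42, -42, -16, -16) (262144, 262144) [:: 15;
    13; 33; 25; 5; 9; 46; 37; 17; 16; 18; 38; 30; 10; 6; 45; 34; 14]%N);
  (82%N, Certificate 12 (7, 44, 46, 3) (-1, 1, -45, 45) (-1048576, 0) [:: 7; 11; 47; 39;
    19; 18; 46; 37; 17; 8; 4; 44; 32; 12; 13; 15; 35; 45]%N);
  (83%N, Certificate 12 (68, 9, 67, 85) (9, -65, -81, 75) (4194304, 2097152) [:: 23; 37;
    1; 19; 44; 17; 16; 34; 28; 38; 24; 32; 14; 12; 13; 31]%N);
  (84%N, Certificate 12 (2, -11, 3, 11) (8, -6, -9, 9) (-196608, -393216) [:: 6; 7; 3; 5;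
    2]%N);
  (85%N, Certificate 12 (-1, -2, -16, -2) (-6, 6, -12, -7) (196608, 0) [:: 7; 15; 6; 14;
    5; 13; 4; 12]%N);
  (86%N, Certificate 12 (0, -16, 0, -2) (-9, -9, -9, 4) (114688, -131072) [:: 4; 6; 2; 3;
    7; 5]%N);
  (87%N, Certificate 12 (-6, -5, 3, 14) (-12, -1, 10, 5) (-131072, -65536) [:: 10; 2; 6;
    9; 5; 1]%N);
  (88%N, Certificate 12 (10, -4, 11, 4) (-8, 13, 5, -2) (0, 0) [:: 10; 8; 11; 7; 1; 0;
    6]%N);
  (89%N, Certificate 12 (-2, -15, -1, 28) (-31, 5, -2, -3) (-1048576, -524288) [:: 1; 0;
    10; 12; 9; 13; 11]%N);
  (90%N, Certificate 12 (18, -7, -24, -8) (-2, -29, -11, -9) (294912, -458752) [:: 0; 3;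
    14; 8; 9; 15; 4; 2]%N);
  (91%N, Certificate 12 (-9, -6, -10, -7) (15, -2, -5, 2) (0, 0) [:: 9; 11; 7; 6; 10; 8;
    0; 1]%N);
  (92%N, Certificate 12 (-25, 1, -1, -20) (-4, -19, -18, 18) (4063232, 6422528) [:: 14; 8;
    12; 10; 6; 9; 11; 7; 13]%N)]%stdZ.

(** The second test ensures that no index of [solved] lacks a certificate. *)
Lemma certificates_check :
  all (fun c => check (johnson_itv c.1) c.2) certificates &&
  (map fst certificates == solved).
Proof. by vm_compute. Qed.

Lemma certificate_exists k : k \in solved -> exists C, check (johnson_itv k) C.
Proof.
have /andP[chk /eqP <-] := certificates_check.
elim: certificates chk => //= c s IH /andP[ck /IH sk].
by rewrite inE => /orP[/eqP ->|/sk //]; exists c.2.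
Qed.

Theorem theorem4 (R : realType) (k : nat) (P : set 'rV[R]_3)
    (hk : (1 <= k <= 92)%N)
    (hk' : k \notin [:: 25; 45; 47; 71; 72; 73; 74; 75; 76; 77]%N)
    (hP : johnson_solid k P) :
  rupert P.
Proof.
have ks : k \in solved by rewrite mem_filter hk' mem_iota.
have [C chk] := certificate_exists ks.
have [s js Ls] := enclosed_johnson R ks.
apply: check_rupert Ls chk _; move: hP; rewrite /johnson_solid.
(* The certificate concerns the list [s], which has the same members and hence the same set of
   vertices. *)
by rewrite (_ : [set` johnson_vertices k] = [set` s]) //; apply/seteqP; split=> x /=; rewrite js.
Qed.
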